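(* Let $\nu,\mu\in\mathbb{C}$, put $\nu_0:=\mathrm{Re}\,\nu$, $\mu_0:=\mathrm{Re}\,\mu$, and assume that they satisfy the inequalities $$n\nu_0+d\mu_0>\frac{n(n+1)}{2},\qquad n\nu_0-d\mu_0>\frac{n(n+1)}{2},$$ and $$\nu_0+\mu_0\ge n+1,\qquad \mu_0\le 0 .$$ Put $\alpha=\nu/2$, $\beta=-\mu/2$. Let $p,q\ge 0$ be integers with $p+q=n$. Then the integral $$\mathcal{P}f(y)=\int_{\Omega(p,q)}f(z)K^{\alpha,\beta}(z,y)\,d\omega(z)\qquad(y\in\mathrm{M}^\circ_{n,d}(\mathbb{R}))$$ converges and gives a bounded linear operator $\mathcal{P}:\mathcal{H}^G_\nu(p,q)\to\mathcal{H}^L_\mu$ which intertwines $\pi^G_\nu|_L$ to $\pi^L_\mu$.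
   Context: Let $1\le d\le n-1$ and $L=\mathrm{GL}_n(\mathbb{R})$. Here $L$ is the Levi subgroup $\left\{\begin{pmatrix}a&0\\0&{}^ta^{-1}\end{pmatrix}\right\}$ of the Siegel parabolic $P_S$ of $G=\mathrm{Sp}_{2n}(\mathbb{R})$. $\mathrm{Sym}_n(\mathbb{R})$ is the space of real symmetric $n\times n$ matrices with Lebesgue measure $dz$; it embeds as an open dense subset of $G/P_S$. $\Omega(p,q)=\{z\in\mathrm{Sym}_n(\mathbb{R})\mid z\text{ has signature }(p,q)\}$, with $L$-invariant measure $d\omega(z)=|\det z|^{-\frac{n+1}{2}}dz$ (for the action $z\mapsto az\,{}^ta$). $\mathrm{M}^\circ_{n,d}(\mathbb{R})$ is the set of real $n\times d$ matrices of rank $d$, and $S_{n,d}=\{y\in\mathrm{M}^\circ_{n,d}(\mathbb{R})\mid{}^tyy=1_d\}$ is the Stiefel manifold with its nonzero $\mathrm{O}(n)$-invariant measure $d\sigma$. Kernel: $K^{\alpha,\beta}(z,y)=|\det z|^{\alpha}\,|\det({}^tyz^{-1}y)|^{\beta}=|\det z|^{\alpha-\beta}\left|\det\begin{pmatrix}z&y\\{}^ty&0\end{pmatrix}\right|^{\beta}$. Degenerate principal series of $G$: $\pi^G_\nu=\mathrm{Ind}_{P_S}^G\chi_{P_S}$ (unnormalized induction), $\chi_{P_S}\begin{pmatrix}a&w\\0&{}^ta^{-1}\end{pmatrix}=|\det a|^\nu$, realized on the Hilbert space $\mathcal{H}^G_\nu$ of functions $f:\mathrm{Sym}_n(\mathbb{R})\to\mathbb{C}$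 with $\int_{\mathrm{Sym}_n(\mathbb{R})}|f(z)|^2(\det(1+z^2))^{\nu_0-\frac{n+1}{2}}dz<\infty$. Its restriction to $L$ is $(\pi^G_\nu(a)f)(z)=|\det a|^{-\nu}f(a^{-1}z\,{}^ta^{-1})$ for $a\in\mathrm{GL}_n(\mathbb{R})$. $\mathcal{H}^G_\nu(p,q)=L^2(\Omega(p,q),(\det(1+z^2))^{\nu_0-\frac{n+1}{2}}dz)$ is a closed $L$-stable subspace of $\mathcal{H}^G_\nu$. Degenerate principal series of $L$: $\pi^L_\mu=\mathrm{Ind}_Q^L\chi_Q$ with $Q=\left\{\begin{pmatrix}k&*\\0&k'\end{pmatrix}\right\}$, $k\in\mathrm{GL}_d(\mathbb{R})$, $k'\in\mathrm{GL}_{n-d}(\mathbb{R})$, and $\chi_Q=|\det k|^\mu$. It is realized on the Hilbert space $\mathcal{H}^L_\mu$ which is the completion, for the norm $\|F\|^2=\int_{S_{n,d}}|F(v)|^2d\sigma(v)$, of the space of smooth $F:\mathrm{M}^\circ_{n,d}(\mathbb{R})\to\mathbb{C}$ with $F(yk)=|\det k|^{-\mu}F(y)$ for all $k\in\mathrm{GL}_d(\mathbb{R})$; the action is $(\pi^L_\mu(a)F)(y)=F(a^{-1}y)$. *)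

(* Defs.v *)
From HB Require Import structures.
From mathcomp Require Import all_boot all_order all_algebra.
From mathcomp Require Import complex.
From mathcomp Require Import all_classical all_reals all_analysis.

Set Implicit Arguments.
Unset Strict Implicit.
Unset Printing Implicit Defensive.

Import Order.TTheory GRing.Theory Num.Theory.
Import numFieldNormedType.Exports.
Import ComplexField.

Local Open Scope classical_set_scope.
Local Open Scope ring_scope.

Section matrix_measurable.
Context {R : realType} {m n : nat}.

(* Product sigma-algebra of the entries, which is the Borel sigma-algebra of
   'M[R]_(m, n); same convention as the library's instance on n.-tuple R. *)
Definition mx_cylinders : set (set 'M[R]_(m, n)) :=
  \bigcup_(ij in [set: 'I_m * 'I_n])
    preimage_set_system setT (fun A : 'M[R]_(m, n) => A ij.1 ij.2) measurable.

Let mx0 : <<s mx_cylinders >> set0.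
Proof. exact: sigma_algebra0. Qed.

Let mxC A : <<s mx_cylinders >> A -> <<s mx_cylinders >> (~` A).
Proof. exact: sigma_algebraC. Qed.

Let mx_bigcup (F : (set 'M[R]_(m, n))^nat) :
  (forall i, <<s mx_cylinders >> (F i)) -> <<s mx_cylinders >> (\bigcup_i F i).
Proof. exact: sigma_algebra_bigcup. Qed.

HB.instance Definition _ := @isMeasurable.Build default_measure_display
  'M[R]_(m, n) <<s mx_cylinders >> mx0 mxC mx_bigcup.

End matrix_measurable.

Section lebesgue_cons.
Context {R : realType} {n : nat}.
Variable mu : {sigma_finite_measure set (n.-tuple R) -> \bar R}.

Let cons2 (x : R * n.-tuple R) : n.+1.-tuple R := [tuple of x.1 :: x.2].

Definition lebesgue_cons : set (n.+1.-tuple R) -> \bar R :=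
  pushforward (lebesgue_measure \x mu)%E cons2.

Let measurable_cons2 : measurable_fun setT cons2.
Proof. by apply: measurable_cons. Qed.

HB.instance Definition _ := Measure.copy lebesgue_cons
  (measure_function_pushforward__canonical__measure_function_Measure
     (lebesgue_measure \x mu)%E measurable_cons2).

Let lebesgue_cons_sigma_finite : sigma_finite setT lebesgue_cons.
Proof.
have /sigma_finiteP[F [TF ndF Foo]] := sigma_finiteT (@lebesgue_measure R).
have /sigma_finiteP[G [TG ndG Goo]] := sigma_finiteT mu.
pose uncons (t : n.+1.-tuple R) : R * n.-tuple R :=
  (tnth t ord0, [tuple of behead t]).
have muncons : measurable_fun setT uncons.
  apply/measurable_fun_pairP; split => /=.
  - exact: (measurable_tnth ord0).
  - exact: measurable_behead.
have consK x : uncons (cons2 x) = x.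
  case: x => x t; rewrite /uncons /cons2 /=; congr pair; exact: val_inj.
exists (fun k => uncons @^-1` (F k `*` G k)).
  apply/esym; rewrite -subTset => t _.
  have [i _ Fi] : (\bigcup_i F i) (uncons t).1 by rewrite -TF.
  have [j _ Gj] : (\bigcup_j G j) (uncons t).2 by rewrite -TG.
  exists (maxn i j) => //; split.
  - by move: (uncons t).1 Fi; exact/subsetPset/ndF/leq_maxl.
  - by move: (uncons t).2 Gj; exact/subsetPset/ndG/leq_maxr.
move=> k; have [mF Fk] := Foo k; have [mG Gk] := Goo k; split.
  by rewrite -[X in measurable X]setTI; apply: muncons => //; exact: measurableX.
rewrite /lebesgue_cons /pushforward -comp_preimage.
rewrite (_ : uncons \o cons2 = id); last by apply/funext => x /=; rewrite consK.
by rewrite preimage_id product_measure1E// lte_mul_pinfty// ge0_fin_numE.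
Qed.

HB.instance Definition _ := @Measure_isSigmaFinite.Build _ _ _ lebesgue_cons
  lebesgue_cons_sigma_finite.

End lebesgue_cons.

(* Lebesgue measure on R^n. *)
Fixpoint lebesgue_tuple (R : realType) (n : nat) :
    {sigma_finite_measure set (n.-tuple R) -> \bar R} :=
  if n is n'.+1 then lebesgue_cons (lebesgue_tuple R n')
  else dirac [tuple].

Section lebesgue_sym.
Context {R : realType} {n : nat}.

(* The symmetric matrix whose lower triangular part, read row by row, is t;
   a linear isomorphism from R^(n(n+1)/2) onto Sym_n(R). *)
Definition sym_of_tuple (t : 'C(n.+1, 2).-tuple R) : 'M[R]_n :=
  \matrix_(i, j) t`_('C((maxn i j).+1, 2) + minn i j).

Lemma measurable_sym_of_tuple : measurable_fun setT sym_of_tuple.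
Proof.
apply: (@measurability _ _ _ _ setT sym_of_tuple mx_cylinders) => //.
move=> _ [B [[i j] _ /= [Y mY <-]] <-]; rewrite setTI setTI.
rewrite -comp_preimage -[X in measurable X]setTI.
suff : measurable_fun setT
    ((fun A : 'M[R]_n => A i j) \o sym_of_tuple) by move=> /(_ measurableT _ mY).
rewrite (_ : _ \o _ = fun t : 'C(n.+1, 2).-tuple R =>
  t`_('C((maxn i j).+1, 2) + minn i j)); last first.
  by apply/funext => t /=; rewrite mxE.
have [ltk|lek] := ltnP ('C((maxn i j).+1, 2) + minn i j) 'C(n.+1, 2).
  rewrite (_ : (fun _ => _) = (@tnth _ R ^~ (Ordinal ltk))).
    exact: measurable_tnth.
  by apply/funext => t; rewrite (tnth_nth 0).
rewrite (_ : (fun _ => _) = cst 0); first exact: measurable_cst.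
by apply/funext => t; rewrite nth_default// size_tuple.
Qed.

(* Lebesgue measure dz on Sym_n(R), as a measure on 'M[R]_n carried by the
   symmetric matrices. *)
Definition lebesgue_sym : set 'M[R]_n -> \bar R :=
  pushforward (lebesgue_tuple R 'C(n.+1, 2)) sym_of_tuple.

HB.instance Definition _ := Measure.copy lebesgue_sym
  (measure_function_pushforward__canonical__measure_function_Measure
     (lebesgue_tuple R 'C(n.+1, 2)) measurable_sym_of_tuple).

End lebesgue_sym.
Arguments lebesgue_sym {R n}.

Section complex_valued.
Context {R : realType}.

(* t ^ s for t >= 0 and s complex, with 0 ^ s = 0 for s != 0 and 0 ^ 0 = 1. *)
Definition cpow (t : R) (s : R[i]) : R[i] :=
  if t == 0 then (s == 0)%:R
  else (expR (complex.Re s * ln t))%:C%C *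
       (cos (complex.Im s * ln t) +i* sin (complex.Im s * ln t))%C.

Definition normsq (z : R[i]) : R := Normc.normc z ^+ 2.

Context d (T : measurableType d).

Definition cmeasurable_fun (D : set T) (f : T -> R[i]) : Prop :=
  measurable_fun D (fun x => complex.Re (f x)) /\
  measurable_fun D (fun x => complex.Im (f x)).

Definition cintegrable (m : {measure set T -> \bar R}) (D : set T)
    (f : T -> R[i]) : Prop :=
  m.-integrable D (EFin \o (fun x => complex.Re (f x))) /\
  m.-integrable D (EFin \o (fun x => complex.Im (f x))).

Definition cintegral (m : {measure set T -> \bar R}) (D : set T)
    (f : T -> R[i]) : R[i] :=
  (Rintegral m D (fun x => complex.Re (f x)) +i*
   Rintegral m D (fun x => complex.Im (f x)))%C.

End complex_valued.

Section smoothness.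
Context {R : realType} {V : normedModType R}.

Fixpoint iter_derive (vs : seq V) (f : V -> R) : V -> R :=
  if vs is v :: vs' then fun x => 'D_v (iter_derive vs' f) x else f.

(* C^infinity on an open set U of a finite-dimensional space V: all iterated
   directional derivatives exist and are continuous at every point of U. *)
Definition smooth_on (U : set V) (f : V -> R) : Prop :=
  forall (vs : seq V) (x : V), U x ->
    {for x, continuous (iter_derive vs f)} /\
    forall v, derivable (iter_derive vs f) x v.

Definition csmooth_on (U : set V) (f : V -> R[i]) : Prop :=
  smooth_on U (fun x => complex.Re (f x)) /\
  smooth_on U (fun x => complex.Im (f x)).

End smoothness.

Section spaces.
Context {R : realType} {n : nat}.

(* z is symmetric of signature (p, q): it is congruent to a diagonal matrix
   with p positive and q negative entries. *)
Definition has_signature (p q : nat) (z : 'M[R]_n) : Prop :=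
  exists (g : 'M[R]_n) (e : 'rV[R]_n),
    [/\ g \in unitmx, z = g *m diag_mx e *m g^T,
        #|[set i | 0 < e 0 i]%SET| = p & #|[set i | e 0 i < 0]%SET| = q].

Definition Omega (p q : nat) : set 'M[R]_n := [set z | has_signature p q z].

Definition full_rank {d : nat} : set 'M[R]_(n, d) := [set y | \rank y = d].

Definition Stiefel {d : nat} : set 'M[R]_(n, d) := [set y | y^T *m y = 1%:M].

(* A nonzero O(n)-invariant (finite Borel) measure on the Stiefel manifold,
   seen as a measure on 'M[R]_(n, d) carried by Stiefel; it is unique up to a
   positive constant. *)
Definition Stiefel_measure (d : nat)
    (sigma : {finite_measure set 'M[R]_(n, d) -> \bar R}) : Prop :=
  [/\ sigma (~` Stiefel) = 0%E, sigma Stiefel <> 0%E &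
      forall (k : 'M[R]_n) (A : set 'M[R]_(n, d)),
        k^T *m k = 1%:M -> measurable A ->
        sigma ((fun y => k *m y) @^-1` A) = sigma A].

End spaces.

Section representations.
Context {R : realType} {n : nat}.

(* The restriction of pi^G_nu to GL_n(R). *)
Definition piG (nu : R[i]) (a : 'M[R]_n) (f : 'M[R]_n -> R[i]) :
    'M[R]_n -> R[i] :=
  fun z => cpow `|\det a| (- nu) * f (invmx a *m z *m (invmx a)^T).

Definition HG_normsq (nu0 : R) (p q : nat) (f : 'M[R]_n -> R[i]) : \bar R :=
  (\int[lebesgue_sym]_(z in Omega p q)
     (normsq (f z) * (\det (1%:M + z *m z)) `^ (nu0 - n.+1%:R / 2))%:E)%E.

(* Representatives of the elements of
   H^G_nu(p,q) = L^2(Omega(p,q), det(1+z^2)^(nu0-(n+1)/2) dz);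
   values outside Omega p q are irrelevant. *)
Definition HG (nu0 : R) (p q : nat) : set ('M[R]_n -> R[i]) :=
  [set f | cmeasurable_fun (Omega p q) f /\ (HG_normsq nu0 p q f < +oo)%E].

Context {d : nat}.

Definition piL (a : 'M[R]_n) (F : 'M[R]_(n, d) -> R[i]) :
    'M[R]_(n, d) -> R[i] :=
  fun y => F (invmx a *m y).

Definition equivariant (mu : R[i]) (F : 'M[R]_(n, d) -> R[i]) : Prop :=
  forall (y : 'M[R]_(n, d)) (k : 'M[R]_d), full_rank y -> k \in unitmx ->
    F (y *m k) = cpow `|\det k| (- mu) * F y.

Variable sigma : {finite_measure set 'M[R]_(n, d) -> \bar R}.

Definition HL_normsq (F : 'M[R]_(n, d) -> R[i]) : \bar R :=
  (\int[sigma]_(v in Stiefel) (normsq (F v))%:E)%E.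

Definition HL_smooth (mu : R[i]) : set ('M[R]_(n, d) -> R[i]) :=
  [set F | csmooth_on full_rank F /\ equivariant mu F].

(* Restriction to the Stiefel manifold embeds HL_smooth isometrically in
   L^2(sigma), so its completion H^L_mu is its closure there; each element of
   the closure has an equivariant Borel representative on full_rank. *)
Definition HL (mu : R[i]) : set ('M[R]_(n, d) -> R[i]) :=
  [set F | [/\ cmeasurable_fun full_rank F, equivariant mu F,
    (HL_normsq F < +oo)%E &
    forall eps : R, 0 < eps -> exists Phi, HL_smooth mu Phi /\
      (HL_normsq (fun y => F y - Phi y)%R < eps%:E)%E]].

Definition kernelK (alpha beta : R[i]) (z : 'M[R]_n) (y : 'M[R]_(n, d)) :
    R[i] :=
  cpow `|\det z| alpha * cpow `|\det (y^T *m invmx z *m y)| beta.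

(* The integrand with respect to dz; the last factor is the density of
   the L-invariant measure domega. *)
Definition integrandP (alpha beta : R[i]) (f : 'M[R]_n -> R[i])
    (y : 'M[R]_(n, d)) : 'M[R]_n -> R[i] :=
  fun z => f z * kernelK alpha beta z y *
           (`|\det z| `^ (- (n.+1%:R / 2)))%:C%C.

Definition opP (alpha beta : R[i]) (p q : nat) (f : 'M[R]_n -> R[i]) :
    'M[R]_(n, d) -> R[i] :=
  fun y => cintegral lebesgue_sym (Omega p q) (integrandP alpha beta f y).

End representations.

(* Main.v *)
Require Import Defs.
From HB Require Import structures.
From mathcomp Require Import all_boot all_order all_algebra.
From mathcomp Require Import complex.
From mathcomp Require Import all_classical all_reals all_analysis.
From mathcomp Require Import measurable_realfun.
From mathcomp Require Import ring lra.
Set Implicit Arguments.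
Unset Strict Implicit.
Unset Printing Implicit Defensive.
Import Order.TTheory GRing.Theory Num.Theory.
Import numFieldNormedType.Exports.
Local Open Scope classical_set_scope.
Local Open Scope ring_scope.

(** The transform converges and is bounded because of one pointwise estimate of
    its kernel. For z symmetric put D(z) = det(1 + z^2) >= 1. Then |det z| <=
    D(z)^(1/2) ([sqr_det_le]), and for y in the Stiefel manifold also |det z
    det(y^T z^-1 y)| <= D(z)^(1/2): the number on the left is the determinant
    of z (1 - y y^T) + y y^T, that is, the minor of z complementary to the span
    of y ([det_minorproj], [sqr_det_minorproj_le]). Collecting powers, the
    kernel times the density of the invariant measure has modulus at most |det
    z|^((nu0 + mu0 - (n+1)) / 2) |det z det(y^T z^-1 y)|^(-mu0 / 2); both
    exponents are nonnegative, so it is at most D(z)^((nu0 - (n+1)) / 4)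
    ([kernel_le]). By Cauchy-Schwarz against the weight D^(nu0 - (n+1)/2) of
    the source space, |P f(y)|^2 is bounded by a constant times |f|^2 times the
    integral of D^(-nu0/2), and nu0 >= n+1 bounds the latter by the integral of
    D^(-(n+1)/2). A general full rank y is v k with v in the Stiefel manifold
    and k invertible, which only costs a power of det k ([full_rank_polar]).

    The integral of D^(-(n+1)/2) over symmetric matrices is finite
    ([siegel_integral_finite]): it is the total mass of the U(n)-invariant
    measure of the Lagrangian Grassmannian, in which Sym_n is open and dense.
    The proof is by induction on n: splitting off the first row (c, b) of z, an
    affine change of the remaining block by a congruence factors D into a
    function of (c, b) and the same determinant in one dimension less
    ([det_1sqr_block]). It rests on the two changes of variables z -> z + w and
    z -> a z a^T, the second with Jacobian |det a|^(n+1)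
    ([sym_measure_translation], [sym_measure_congruence]); they are proved for
    a Lebesgue measure built block by block, which [lebesgue_sym_integral]
    identifies with the one built on coordinates. The second one also gives the
    intertwining property ([opP_intertwines]), as the integrand for the
    translated function is the original one in the variable a^-1 z a^-T;
    equivariance under GL_d is pointwise in z.

    It remains to see that P f lies in the completion of the smooth equivariant
    functions. First, P f is continuous, by dominated convergence: the
    integrand depends continuously on y wherever det(y^T z^-1 y) <> 0, and the
    exceptional z form a null set ([minorproj_null], [opP_continuous_part]).
    Second, a continuous equivariant function F is a uniform limit, on the
    Stiefel manifold, of smooth equivariant ones ([smooth_approximation]):
    det(y^T y)^(mu/2) F(y) depends only on the orthogonal projector onto the
    column space of y, and one averages finitely many values F(v_i) with
    weights exp(-N_i |projector(y) - v_i v_i^T|^2), then multiplies by det(y^T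
    y)^(-mu/2). These functions are compositions of rational functions,
    exponentials, logarithms and trigonometric functions, a class closed under
    differentiation, hence smooth ([elementary_smooth]). *)

(** * Determinants and positive definite matrices *)

Section determinants.
Context {R : comUnitRingType}.

(** Both sides are the determinant of the block matrix [1, A; -B, 1], factored
    in two ways. *)
Lemma det_1addM_comm (m n : nat) (A : 'M[R]_(m, n)) (B : 'M[R]_(n, m)) :
  \det (1%:M + A *m B) = \det (1%:M + B *m A).
Proof.
have e1 : block_mx 1%:M A (- B) 1%:M =
    block_mx 1%:M 0 (- B) 1%:M *m block_mx 1%:M A 0 (1%:M + B *m A).
  rewrite mulmx_block !(mul1mx, mul0mx, mulmx0, mulmx1, addr0, add0r).
  by rewrite mulNmx addrCA addNr addr0.
have e2 : block_mx 1%:M A (- B) 1%:M =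
    block_mx (1%:M + A *m B) A 0 1%:M *m block_mx 1%:M 0 (- B) 1%:M.
  rewrite mulmx_block !(mul1mx, mul0mx, mulmx0, mulmx1, addr0, add0r).
  by rewrite mulmxN addrK.
have := congr1 determinant e2.
rewrite {1}e1 !det_mulmx !det_lblock !det_ublock !det1 !mul1r !mulr1.
by move=> ->.
Qed.

Lemma det_schur (n : nat) (s : R) (B : 'rV[R]_n) (C : 'cV[R]_n) (D : 'M[R]_n) :
  s \is a GRing.unit ->
  \det (block_mx s%:M B C D) = s * \det (D - s^-1 *: (C *m B)).
Proof.
move=> us.
have -> : block_mx s%:M B C D = block_mx 1%:M 0 (s^-1 *: C) 1%:M *m
    block_mx s%:M B 0 (D - s^-1 *: (C *m B)).
  rewrite mulmx_block !(mul1mx, mul0mx, mulmx0, mulmx1, addr0, add0r) -!scalemxAl.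
  by rewrite mul_mx_scalar scalerA mulVr// scale1r addrC subrK.
by rewrite det_mulmx det_lblock det_ublock !det1 !mul1r det_scalar1.
Qed.

End determinants.

Section positive_definite.
Context {R : rcfType}.

Definition posdef n (M : 'M[R]_n) : Prop :=
  M^T = M /\ forall u : 'rV[R]_n, u != 0 -> 0 < (u *m M *m u^T) 0 0.

Lemma row_gramE n (u : 'rV[R]_n) : (u *m u^T) 0 0 = \sum_i u 0 i ^+ 2.
Proof. by rewrite mxE; apply: eq_bigr => i _; rewrite mxE expr2. Qed.

Lemma row_gram_ge0 n (u : 'rV[R]_n) : 0 <= (u *m u^T) 0 0.
Proof. by rewrite row_gramE sumr_ge0// => i _; exact: sqr_ge0. Qed.

Lemma row_gram_gt0 n (u : 'rV[R]_n) : u != 0 -> 0 < (u *m u^T) 0 0.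
Proof.
move=> u0; rewrite lt_neqAle row_gram_ge0 andbT eq_sym row_gramE.
apply: contra u0; rewrite psumr_eq0; last by move=> i _; exact: sqr_ge0.
move=> /allP h; apply/eqP/rowP => i; rewrite mxE; apply/eqP.
by rewrite -sqrf_eq0; apply: h; rewrite mem_index_enum.
Qed.

Lemma posdef_gram m n (A : 'M[R]_(n, m)) : row_free A -> posdef (A *m A^T).
Proof.
move=> fA; split; first by rewrite trmx_mul trmxK.
move=> u u0; have -> : u *m (A *m A^T) *m u^T = (u *m A) *m (u *m A)^T.
  by rewrite trmx_mul !mulmxA.
by apply: row_gram_gt0; rewrite mulmx_free_eq0.
Qed.

Lemma posdef_1gram m n (A : 'M[R]_(n, m)) : posdef (1%:M + A *m A^T).
Proof.
rewrite -[1%:M](mulmx1 1%:M) -[X in _ *m X + _]trmx1.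
rewrite -mul_row_col -tr_row_mx; apply: posdef_gram.
rewrite /row_free eqn_leq rank_leq_row /=.
have : row_mx 1%:M A *m col_mx 1%:M 0 = 1%:M :> 'M[R]_n.
  by rewrite mul_row_col mulmx1 mulmx0 addr0.
by move=> /(congr1 mxrank); rewrite mxrank1 => {1}<-; exact: mxrankM_maxl.
Qed.

Lemma trmx_block_sym n (M : 'M[R]_(1 + n)) : M^T = M ->
  [/\ M = block_mx (M 0 0)%:M (ursubmx M) (ursubmx M)^T (drsubmx M)
    & (drsubmx M)^T = drsubmx M].
Proof.
move=> sM; split; last by rewrite trmx_drsub sM.
rewrite -{1}(submxK M) trmx_ursub sM; congr block_mx.
apply/matrixP => i j; rewrite !ord1 !mxE eqxx mulr1n.
by congr (M _ _); apply/val_inj.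
Qed.

(** Only the existence of some square factor matters, so the induction may
    eliminate the first row and column by a Schur complement. *)
Lemma cholesky n (M : 'M[R]_n) : posdef M ->
  exists2 k, k \in unitmx & M = k *m k^T.
Proof.
elim: n M => [|n IH] M [sM pM].
  by exists 1%:M; [rewrite unitmx1|apply/matrixP => -[]].
have [] := @trmx_block_sym n M sM.
set a := M 0 0; set b := @ursubmx _ 1 n 1 n M; set C := @drsubmx _ 1 n 1 n M.
move=> ME sC.
have a0 : 0 < a.
  have := pM (delta_mx 0 0).
  rewrite -rowE trmx_delta -colE !mxE; apply.
  by apply/eqP => /matrixP/(_ 0 0); rewrite !mxE => /eqP; rewrite oner_eq0.
have [|k uk SE] := IH (C - a^-1 *: (b^T *m b)).
  split.
    by rewrite linearB linearZ/= trmx_mul trmxK sC.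
  move=> u u0.
  have := pM (row_mx (- a^-1 *: (u *m b^T)) u).
  rewrite ME (@tr_row_mx _ 1 1 n) (@mul_row_block _ 1 1 n 1 n).
  rewrite mul_mx_scalar scalerA mulrN divff ?gt_eqF// scaleN1r addNr.
  rewrite (@mul_row_col _ 1 1 n 1) mul0mx add0r !scaleNr mulNmx -scalemxAl -(mulmxA u b^T b).
  rewrite mulmxBr -scalemxAr addrC; apply.
  apply: contra u0 => /eqP/(congr1 (@rsubmx _ 1 1 n)).
  by rewrite row_mxKr linear0 => ->.
have sa0 : Num.sqrt a != 0 by rewrite gt_eqF ?sqrtr_gt0.
exists (block_mx (Num.sqrt a)%:M 0 ((Num.sqrt a)^-1 *: b^T) k).
  rewrite unitmxE (@det_lblock _ 1 n) det_scalar1 unitrM unitfE sa0/=.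
  by rewrite -unitmxE.
rewrite ME (@tr_block_mx _ 1 n 1 n) (@mulmx_block _ 1 n 1 n 1 n).
rewrite tr_scalar_mx trmx0 !mulmx0 !mul0mx !addr0 !linearZ/= trmxK.
rewrite -scalar_mxM -expr2 sqr_sqrtr ?(ltW a0)//.
rewrite -!scalemxAl !scalerA -invfM -expr2 sqr_sqrtr ?(ltW a0)//.
rewrite mul_scalar_mx mul_mx_scalar !scalerA mulVf// !scale1r.
by rewrite -SE addrC subrK.
Qed.

Lemma posdef_det_gt0 n (M : 'M[R]_n) : posdef M -> 0 < \det M.
Proof.
move=> /cholesky[k uk ->]; rewrite det_mulmx det_tr -expr2.
by rewrite exprn_even_gt0//= -unitfE -unitmxE.
Qed.

Lemma det_1gram_ge1 m n (A : 'M[R]_(n, m)) : 1 <= \det (1%:M + A *m A^T).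
Proof.
elim: m A => [|m IH] A.
  by rewrite [A]thinmx0 mul0mx addr0 det1.
rewrite -[A](@hsubmxK _ n 1 m) (@tr_row_mx _ n 1 m) (@mul_row_col _ n 1 m).
set w := @lsubmx _ n 1 m A; set W := @rsubmx _ n 1 m A.
rewrite addrCA; set P := 1%:M + W *m W^T.
have [k uk PE] := cholesky (posdef_1gram W).
have -> : w *m w^T + P = k *m (1%:M + invmx k *m w *m (invmx k *m w)^T) *m k^T.
  rewrite mulmxDr mulmx1 mulmxDl -PE addrC; congr (_ + _).
  rewrite trmx_mul !mulmxA mulmxV// mul1mx -2!mulmxA -trmx_mul.
  by rewrite mulmxV// trmx1 mulmx1.
rewrite 2!det_mulmx mulrAC -det_mulmx -PE.
apply: (le_trans (IH W)); rewrite -/P.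
apply: ler_peMr; first exact/ltW/posdef_det_gt0/posdef_1gram.
rewrite det_1addM_comm det_mx11 mxE mxE eqxx lerDl.
by rewrite -{2}[invmx k *m w]trmxK row_gram_ge0.
Qed.

(** When N is singular the left-hand side vanishes; otherwise factor out N on
    the left and N^T on the right and use det(1 + M M^T) >= 1. *)
Lemma det_gram_mono m n (N : 'M[R]_n) (A : 'M[R]_(n, m)) :
  0 <= \det (N *m N^T + A *m A^T) ->
  \det (N *m N^T) <= \det (N *m N^T + A *m A^T).
Proof.
have [uN _|nuN ge0] := boolP (N \in unitmx); last first.
  move: nuN; rewrite unitmxE unitfE negbK => /eqP dN.
  by rewrite det_mulmx dN mul0r.
have -> : N *m N^T + A *m A^T =
    N *m (1%:M + invmx N *m A *m (invmx N *m A)^T) *m N^T.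
  rewrite mulmxDr mulmx1 mulmxDl; congr (_ + _).
  rewrite trmx_mul !mulmxA mulmxV// mul1mx -2!mulmxA -trmx_mul.
  by rewrite mulmxV// trmx1 mulmx1.
rewrite !det_mulmx mulrAC; apply: ler_peMr; last exact: det_1gram_ge1.
by rewrite det_tr -expr2 sqr_ge0.
Qed.

Lemma det_1sqr_ge1 n (z : 'M[R]_n) : z^T = z -> 1 <= \det (1%:M + z *m z).
Proof. by move=> sz; rewrite -{2}sz det_1gram_ge1. Qed.

Lemma sqr_det_le n (z : 'M[R]_n) : z^T = z ->
  \det z ^+ 2 <= \det (1%:M + z *m z).
Proof.
move=> sz; have E : z *m z^T + 1%:M *m 1%:M^T = 1%:M + z *m z.
  by rewrite trmx1 mulmx1 sz addrC.
have := @det_gram_mono n n z 1%:M.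
rewrite E => /(_ (le_trans ler01 (det_1sqr_ge1 sz))).
by rewrite det_mulmx det_tr -expr2.
Qed.

(** On the orthogonal complement of the columns of y this is z, on their span
    it is the identity; its determinant is the minor of z complementary to y. *)
Definition minorproj n d (z : 'M[R]_n) (y : 'M[R]_(n, d)) : 'M[R]_n :=
  z *m (1%:M - y *m y^T) + y *m y^T.

Section stiefel.
Context {n d : nat} (y : 'M[R]_(n, d)) (yy : y^T *m y = 1%:M).

Let Pi := y *m y^T.
Let Q : 'M[R]_n := 1%:M - Pi.
Let QDPi : Q + Pi = 1%:M. Proof. by rewrite /Q subrK. Qed.
Let PiPi : Pi *m Pi = Pi.
Proof. by rewrite /Pi mulmxA -(mulmxA y) yy mulmx1. Qed.
Let sPi : Pi^T = Pi. Proof. by rewrite /Pi trmx_mul trmxK. Qed.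
Let sQ : Q^T = Q. Proof. by rewrite /Q linearB/= trmx1 sPi. Qed.
Let QPi : Q *m Pi = 0. Proof. by rewrite /Q mulmxBl mul1mx PiPi subrr. Qed.
Let PiQ : Pi *m Q = 0. Proof. by rewrite /Q mulmxBr mulmx1 PiPi subrr. Qed.
Let QQ : Q *m Q = Q. Proof. by rewrite {2}/Q mulmxBr mulmx1 QPi subr0. Qed.

(** Factoring z out of [minorproj z y] leaves a perturbation of the identity of
    rank at most d, whose determinant is d x d by [det_1addM_comm]. *)
Lemma det_minorproj (z : 'M[R]_n) : z \in unitmx ->
  \det z * \det (y^T *m invmx z *m y) = \det (minorproj z y).
Proof.
move=> uz; have -> : minorproj z y =
    z *m (1%:M + (invmx z *m y - y) *m y^T).
  rewrite /minorproj mulmxBl !mulmxDr !mulmxN !mulmx1 !mulmxA mulmxV// mul1mx.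
  by rewrite -addrA [- _ + _]addrC.
rewrite det_mulmx det_1addM_comm; congr (_ * \det _).
by rewrite mulmxBr yy addrC subrK mulmxA.
Qed.

(** 1 + z^2 is the Gram matrix of [minorproj z y] plus another Gram matrix. *)
Lemma sqr_det_minorproj_le (z : 'M[R]_n) : z^T = z ->
  \det (minorproj z y) ^+ 2 <= \det (1%:M + z *m z).
Proof.
move=> sz; set N := minorproj z y.
have E : 1%:M + z *m z = N *m N^T + row_mx Q (z *m y) *m (row_mx Q (z *m y))^T.
  have NE : N = z *m Q + Pi by [].
  have NT : N^T = Q *m z + Pi by rewrite NE linearD/= trmx_mul sQ sz sPi.
  have zyE : z *m y *m (z *m y)^T = z *m Pi *m z.
    by rewrite trmx_mul sz !mulmxA.
  rewrite tr_row_mx mul_row_col NT NE sQ zyE QQ mulmxDl (mulmxDr (z *m Q)) (mulmxDr Pi) PiPi.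
  rewrite -!(mulmxA z Q) QPi mulmx0 addr0 !(mulmxA Pi) PiQ mul0mx add0r.
  rewrite (mulmxA Q Q) QQ [Q + _]addrC addrACA -[z *m Pi *m z]mulmxA.
  by rewrite -mulmxDr -mulmxDl [Pi + Q]addrC QDPi mul1mx addrC.
rewrite expr2 -{2}det_tr -det_mulmx E; apply: det_gram_mono; rewrite -E.
exact: le_trans ler01 (det_1sqr_ge1 sz).
Qed.

(** On the line z + t the determinant is, up to powers of t, the characteristic
    polynomial of z (1 - y y^T) at -t. So a line in the direction of the
    identity meets the zero set of the determinant in finitely many points. *)
Lemma minorproj_shift (z : 'M[R]_n) (t : R) : t != 0 ->
  \det (minorproj (z + t%:M) y) = 0 -> root (char_poly (z *m Q)) (- t).
Proof.
move=> t0 d0.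
have E : minorproj (z + t%:M) y = (t^-1 *: (t%:M + z *m Q)) *m (Pi + t *: Q).
  rewrite /minorproj -/Pi -/Q (mulmxDl z) -scalemxAl (mulmxDl t%:M).
  rewrite (mulmxDr (z *m Q)) -scalemxAr -2!(mulmxA z) QPi QQ mulmx0 add0r.
  rewrite !mul_scalar_mx !scalerDr !scalerA mulrA mulVf// mul1r !scale1r.
  by rewrite addrC [z *m Q + _]addrC addrA.
have uD : (Pi + t *: Q) \in unitmx.
  suff /mulmx1_unit[] : (Pi + t *: Q) *m (Pi + t^-1 *: Q) = 1%:M by [].
  rewrite mulmxDl (mulmxDr Pi) (mulmxDr (t *: Q)) PiPi -!scalemxAr.
  rewrite -!scalemxAl PiQ QPi QQ.
  by rewrite !scaler0 addr0 add0r scalerA mulVf// scale1r /Q addrC subrK.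
move: d0; rewrite E det_mulmx detZ => /eqP; rewrite !mulf_eq0.
rewrite expf_eq0 invr_eq0 (negbTE t0) andbF/= orbC.
have := uD; rewrite unitmxE unitfE => /negbTE -> /= /eqP d0.
rewrite -eigenvalue_root_char; apply/eigenvalueP.
have /det0P[v v0 vE] : \det (t%:M + z *m Q) == 0 by rewrite d0.
exists v => //; apply/eqP; rewrite scaleNr -addr_eq0 addrC -mul_mx_scalar.
by rewrite -mulmxDr vE.
Qed.

End stiefel.

Lemma full_rank_polar n d (y : 'M[R]_(n, d)) : \rank y = d ->
  exists v k, [/\ k \in unitmx, v^T *m v = 1%:M & y = v *m k].
Proof.
move=> ry; have : posdef (y^T *m y^T^T).
  by apply: posdef_gram; rewrite /row_free mxrank_tr ry.
rewrite trmxK => /cholesky[k uk yk].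
exists (y *m invmx k^T), k^T; rewrite unitmx_tr; split=> //; last first.
  by rewrite -mulmxA mulVmx ?unitmx_tr// mulmx1.
rewrite trmx_mul mulmxA -(mulmxA _ y^T) yk !mulmxA trmx_inv trmxK mulVmx//.
by rewrite mul1mx mulmxV// unitmx_tr.
Qed.

Lemma stiefel_full_rank n d (v : 'M[R]_(n, d)) : v^T *m v = 1%:M -> \rank v = d.
Proof.
move=> vv; apply/eqP; rewrite eqn_leq rank_leq_col /=.
by move: vv => /(congr1 mxrank); rewrite mxrank1 => {1}<-; exact: mxrankM_maxr.
Qed.

Lemma full_rank_det_gt0 n d (y : 'M[R]_(n, d)) : \rank y = d ->
  0 < \det (y^T *m y).
Proof.
by move=> ry; rewrite -{2}[y]trmxK; apply: posdef_det_gt0; apply: posdef_gram; rewrite /row_free mxrank_tr ry.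
Qed.

Lemma full_rankE n d (y : 'M[R]_(n, d)) : \rank y = d <-> \det (y^T *m y) != 0.
Proof.
split=> [/full_rank_det_gt0/lt0r_neq0//|d0].
apply/eqP; rewrite eqn_leq rank_leq_col /=.
have : y^T *m y \in unitmx by rewrite unitmxE unitfE.
by move=> /mxrank_unit {1}<-; exact: mxrankM_maxr.
Qed.

(** Gauss elimination on the first row and column: every invertible matrix is a
    product of block shears and block diagonal matrices. A change of variables
    formula is multiplicative in the matrix, so it need only be checked on
    these. *)
Lemma unitmx_block_ind n (P : 'M[R]_(1 + n) -> Prop) :
  (forall a b, a \in unitmx -> b \in unitmx -> P a -> P b -> P (a *m b)) ->
  (forall x, P (block_mx 1%:M x 0 1%:M)) ->
  (forall y, P (block_mx 1%:M 0 y 1%:M)) ->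
  (forall (p : R) a, p != 0 -> a \in unitmx -> P (block_mx p%:M 0 0 a)) ->
  forall a, a \in unitmx -> P a.
Proof.
move=> PM PU PL PD.
have uU x : block_mx 1%:M x 0 1%:M \in (@unitmx R (1 + n)).
  by rewrite unitmxE det_ublock !det1 mulr1 unitr1.
have uL y : block_mx 1%:M 0 y 1%:M \in (@unitmx R (1 + n)).
  by rewrite unitmxE det_lblock !det1 mulr1 unitr1.
have main (p : R) w y D : p != 0 ->
    block_mx p%:M w y D \in (@unitmx R (1 + n)) ->
    P (block_mx p%:M w y D).
  move=> p0; rewrite unitmxE det_schur ?unitfE// mulf_eq0 negb_or p0 /= => uS.
  have -> : block_mx p%:M w y D = block_mx 1%:M 0 (p^-1 *: y) 1%:M *m
     (block_mx p%:M 0 0 (D - p^-1 *: (y *m w)) *m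
      block_mx 1%:M (p^-1 *: w) 0 1%:M).
    rewrite !mulmx_block !(mul1mx, mul0mx, mulmx0, mulmx1, addr0, add0r).
    rewrite -!scalemxAl -!scalemxAr mul_scalar_mx mul_mx_scalar !scalerA.
    rewrite -scalemxAr !scalerA mulVf// mulrAC mulVf// mul1r !scale1r.
    by rewrite addrC subrK.
  have uDg : block_mx p%:M 0 0 (D - p^-1 *: (y *m w)) \in (@unitmx R (1 + n)).
    by rewrite unitmxE det_ublock det_scalar1 unitfE mulf_neq0.
  apply: (PM) => //; first by rewrite unitmx_mul uDg uU.
  by apply: (PM) => //; apply: PD => //; rewrite unitmxE unitfE.
move=> a; rewrite -(submxK a).
move: (ulsubmx a) (ursubmx a) (dlsubmx a) (drsubmx a) => {a} p w y D.
rewrite [p]mx11_scalar.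
have [p0|] := eqVneq (p 0 0) 0; last exact: main.
rewrite p0 => ua.
have [i yi] : exists i, y i 0 != 0.
  apply/existsP; apply: contraTT ua => /existsPn y0.
  have -> : y = 0.
    apply/matrixP => i j; rewrite !ord1 [RHS]mxE.
    by have := y0 i; rewrite negbK => /eqP.
  by rewrite raddf0 unitmxE det_ublock det0 mul0r unitr0.
(* A shear by x makes the vanishing corner entry equal to 1. *)
pose x : 'rV[R]_n := (y i 0)^-1 *: delta_mx 0 i.
have xy : x *m y = 1%:M.
  rewrite -scalemxAl -rowE; apply/matrixP => j k.
  by rewrite !ord1 !mxE mulVf.
pose a1 : 'M[R]_(1 + n) := block_mx 1%:M (w + x *m D) y D.
have aE : block_mx 0%:M w y D = block_mx 1%:M (- x) 0 1%:M *m a1.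
  rewrite /a1 mulmx_block !mul1mx !mul0mx !add0r !mulNmx xy.
  by rewrite subrr addrK raddf0.
have ua1 : a1 \in unitmx.
  by move: ua; rewrite aE unitmx_mul => /andP[].
rewrite raddf0 in aE *; rewrite aE; apply: (PM) => //.
by apply: main => //; exact: oner_neq0.
Qed.

(** With C affine in C' as below, det(1 + z^2) splits into a factor depending
    only on (c, b) and the same determinant for C'. The translation part of C
    completes a square in the Schur complement of the first diagonal entry s of
    1 + z^2, and the hypothesis on k amounts to k^T (1 - s^-1 b^T b) k = 1. *)
Lemma det_1sqr_block n (c : R) (b : 'rV[R]_n) (C' k : 'M[R]_n) :
  k \in unitmx ->
  k *m k^T = 1%:M + (1 + c ^+ 2)^-1 *: (b^T *m b) ->
  let C := k *m C' *m k^T + (c / (1 + c ^+ 2)) *: (b^T *m b) in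
  let z := block_mx c%:M b b^T C in
  \det (1%:M + z *m z) =
  (1 + c ^+ 2) * (1 + (b *m b^T) 0 0 / (1 + c ^+ 2)) ^+ 2 *
  \det (1%:M + C' *m C').
Proof.
move=> uk kE C z; set q := 1 + c ^+ 2; set g := c / q; set t := (b *m b^T) 0 0.
set B := b^T *m b.
have q0 : 0 < q by rewrite ltr_pwDl// sqr_ge0.
have t0 : 0 <= t by rewrite row_gram_ge0.
pose s := q + t; have s0 : 0 < s by rewrite ltr_pwDl.
have bb : b *m b^T = t%:M by rewrite [LHS]mx11_scalar.
have detk : \det k * \det k = 1 + t / q.
  rewrite -{2}det_tr -det_mulmx kE -/q scalemxAl det_1addM_comm det_mx11.
  by rewrite -scalemxAr bb !mxE eqxx !mulr1n mulrC.
pose E := k *m C' *m k^T.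
(* Sherman-Morrison: the inverse of 1 + q^-1 B, since B^2 = t B and s = q + t. *)
have PV : (k *m k^T) *m (1%:M - s^-1 *: B) = 1%:M.
  rewrite kE -/q -/B mulmxBr mulmx1 mulmxDl mul1mx -scalemxAl -scalemxAr.
  have -> : B *m B = t *: B.
    by rewrite /B mulmxA -(mulmxA b^T) bb mul_mx_scalar scalemxAl.
  rewrite !scalerA -addrA -scalerDl -scalerBl.
  suff -> : q^-1 - (s^-1 + q^-1 / s * t) = 0 by rewrite scale0r addr0.
  by rewrite /s; field; rewrite !gt_eqF.
have kTk : k^T *m (1%:M - s^-1 *: B) *m k = 1%:M.
  have := congr1 (fun X => invmx k *m X *m k) PV.
  by rewrite mulmx1 mulVmx// !mulmxA mulVmx// mul1mx.
have EE : k *m (C' *m C') *m k^T = E *m E - s^-1 *: (E *m B *m E).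
  have -> : C' *m C' = C' *m (k^T *m (1%:M - s^-1 *: B) *m k) *m C'.
    by rewrite kTk mulmx1.
  transitivity (E *m (1%:M - s^-1 *: B) *m E); first by rewrite /E !mulmxA.
  by rewrite mulmxBr mulmxBl mulmx1 -scalemxAr -scalemxAl.
have zz : 1%:M + z *m z = block_mx s%:M (s *: (g *: b) + b *m E)
    (s *: (g *: b^T) + E *m b^T) (1%:M + B + (E + g *: B) *m (E + g *: B)).
  have cgs : s * g = c + g * t by rewrite /s /g; field; rewrite gt_eqF.
  rewrite /z (@mulmx_block _ 1 n 1 n 1 n) bb -scalar_mxM.
  rewrite (@scalar_mx_block _ 1 n 1) (@add_block_mx _ 1 n 1 n) !add0r.
  rewrite /C -/E -/g -/B mulmxDr mulmxDl -scalemxAr -scalemxAl.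
  have -> : b *m B = t *: b by rewrite /B mulmxA bb mul_scalar_mx.
  have -> : B *m b^T = t *: b^T by rewrite /B -mulmxA bb mul_mx_scalar.
  rewrite mul_scalar_mx mul_mx_scalar !scalerA cgs !scalerDl -!raddfD/=.
  congr block_mx; first by rewrite addrA.
  - by rewrite -addrA [b *m E + _]addrC.
  - by rewrite -addrA [E *m b^T + _]addrC.
  - by rewrite addrA.
(* The Schur complement of s in 1 + z^2 is k (1 + C'^2) k^T. *)
rewrite zz det_schur ?unitfE ?gt_eqF//.
have -> : 1%:M + B + (E + g *: B) *m (E + g *: B) -
    s^-1 *: ((s *: (g *: b^T) + E *m b^T) *m (s *: (g *: b) + b *m E)) =
    k *m (1%:M + C' *m C') *m k^T.
  rewrite [k *m (_ + _)]mulmxDr (mulmxDl (k *m _)) mulmx1 EE kE -/q -/B.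
  have -> : (s *: (g *: b^T) + E *m b^T) *m (s *: (g *: b) + b *m E) =
      (s * g) ^+ 2 *: B + (s * g) *: (B *m E + E *m B) + E *m B *m E.
    rewrite !scalerA mulmxDl !mulmxDr -!scalemxAl -!scalemxAr !scalerA !mulmxA.
    by rewrite -!(mulmxA E b^T b) -/B -expr2 scalerDr !addrA.
  have -> : (E + g *: B) *m (E + g *: B) =
      E *m E + g *: (B *m E + E *m B) + (g ^+ 2 * t) *: B.
    have BB : B *m B = t *: B.
      by rewrite /B mulmxA -(mulmxA b^T) bb mul_mx_scalar scalemxAl.
    rewrite mulmxDl !mulmxDr -!scalemxAl -!scalemxAr BB !scalerA -expr2.
    by rewrite scalerDr !addrA -!addrA [_ *: (E *m B) + (_ + _)]addrCA.
  move: (E *m E) (E *m B *m E) (B *m E + E *m B) (B) (1%:M : 'M[R]_n).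
  move=> X1 X2 X3 X4 X5; apply/matrixP => i j; rewrite !mxE /g /s.
  by move: s0 q0; rewrite /s /q => s0 q0; field; rewrite !gt_eqF.
rewrite !det_mulmx det_tr mulrAC detk mulrA; congr (_ * _).
by rewrite /s; field; rewrite gt_eqF.
Qed.

End positive_definite.

(** * Measurability of matrix operations *)

Section measurable_matrices.
Context {R : realType}.

Lemma measurable_entry m n (i : 'I_m) (j : 'I_n) :
  measurable_fun setT (fun A : 'M[R]_(m, n) => A i j).
Proof.
move=> _ B mB; rewrite setTI; apply: sub_sigma_algebra.
by exists (i, j) => //; exists B => //; rewrite setTI.
Qed.

Context d (T : measurableType d) (D : set T).

Lemma measurable_funE m n (f : T -> 'M[R]_(m, n)) i j :
  measurable_fun D f -> measurable_fun D (fun x => f x i j).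
Proof. by move=> mf; exact: measurableT_comp (measurable_entry i j) mf. Qed.

Lemma measurable_fun_mx m n (f : T -> 'M[R]_(m, n)) :
  (forall i j, measurable_fun D (fun x => f x i j)) -> measurable_fun D f.
Proof.
move=> mf mD; apply: (@measurability _ _ _ _ D f mx_cylinders) => //.
move=> _ [_ [[i j] _ [B mB <-]] <-]; rewrite setTI -comp_preimage.
exact: mf.
Qed.

Lemma measurable_trmx m n (f : T -> 'M[R]_(m, n)) :
  measurable_fun D f -> measurable_fun D (fun x => (f x)^T).
Proof.
move=> mf; apply: measurable_fun_mx => i j; under eq_fun do rewrite mxE.
exact: measurable_funE.
Qed.

Lemma measurable_addmx m n (f g : T -> 'M[R]_(m, n)) :
  measurable_fun D f -> measurable_fun D g ->
  measurable_fun D (fun x => f x + g x).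
Proof.
move=> mf mg; apply: measurable_fun_mx => i j; under eq_fun do rewrite mxE.
by apply: measurable_funD; exact: measurable_funE.
Qed.

Lemma measurable_scalemx m n (c : T -> R) (g : T -> 'M[R]_(m, n)) :
  measurable_fun D c -> measurable_fun D g ->
  measurable_fun D (fun x => c x *: g x).
Proof.
move=> mf mg; apply: measurable_fun_mx => i j; under eq_fun do rewrite mxE.
by apply: measurable_funM => //; exact: measurable_funE.
Qed.

Lemma measurable_mulmx m n p (f : T -> 'M[R]_(m, n)) (g : T -> 'M[R]_(n, p)) :
  measurable_fun D f -> measurable_fun D g ->
  measurable_fun D (fun x => f x *m g x).
Proof.
move=> mf mg; apply: measurable_fun_mx => i j; under eq_fun do rewrite mxE.
by apply: measurable_sum => k; apply: measurable_funM; exact: measurable_funE.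
Qed.

Lemma measurable_det n (f : T -> 'M[R]_n) :
  measurable_fun D f -> measurable_fun D (fun x => \det (f x)).
Proof.
move=> mf; apply: measurable_sum => s; apply: measurable_funM => //.
by apply: measurable_prod => k _; exact: measurable_funE.
Qed.

Lemma measurable_adjugate n (f : T -> 'M[R]_n) :
  measurable_fun D f -> measurable_fun D (fun x => \adj (f x)).
Proof.
move=> mf; apply: measurable_fun_mx => i j; under eq_fun do rewrite mxE.
apply: measurable_funM => //; apply: measurable_det.
apply: measurable_fun_mx => k l; under eq_fun do rewrite !mxE.
exact: measurable_funE.
Qed.

Lemma measurable_funVr (f : T -> R) :
  measurable_fun D f -> measurable_fun D (fun x => (f x)^-1).
Proof.
move=> mf; rewrite (_ : (fun _ => _) = fun x => f x * (f x ^+ 2) `^ (-1)).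
  apply: measurable_funM => //.
  exact: measurableT_comp (measurable_powR _) (measurable_funX _ mf).
apply/funext => x; rewrite powR_inv1 ?sqr_ge0//.
have [->|fx0] := eqVneq (f x) 0; first by rewrite invr0 mul0r.
by rewrite expr2 invfM mulrA divff// mul1r.
Qed.

(** The inverse is the adjugate divided by the determinant only on invertible
    matrices, whence the hypothesis on D. *)
Lemma measurable_invmx n (f : T -> 'M[R]_n) :
  (forall x, D x -> f x \in unitmx) ->
  measurable_fun D f -> measurable_fun D (fun x => invmx (f x)).
Proof.
move=> uf mf; apply/(@measurable_fun_eqP _ _ _ _ D _
   (fun x => (\det (f x))^-1 *: \adj (f x))).
  by move=> x /set_mem Dx; rewrite /= /invmx uf.
apply: measurable_scalemx; last exact: measurable_adjugate.
by apply: measurable_funVr; exact: measurable_det.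
Qed.

Lemma measurable_block_mx m1 m2 n1 n2 (f : T -> 'M[R]_(m1, n1))
    (g : T -> 'M[R]_(m1, n2)) (h : T -> 'M[R]_(m2, n1)) (k : T -> 'M[R]_(m2, n2)) :
  measurable_fun D f -> measurable_fun D g ->
  measurable_fun D h -> measurable_fun D k ->
  measurable_fun D (fun x => block_mx (f x) (g x) (h x) (k x)).
Proof.
move=> mf mg mh mk; apply: measurable_fun_mx => i j.
under eq_fun do rewrite mxE.
by case: splitP => i' _; under eq_fun do rewrite mxE;
  case: splitP => j' _; exact: measurable_funE.
Qed.

Lemma measurable_row_mx m n1 n2 (f : T -> 'M[R]_(m, n1))
    (g : T -> 'M[R]_(m, n2)) :
  measurable_fun D f -> measurable_fun D g ->
  measurable_fun D (fun x => row_mx (f x) (g x)).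
Proof.
move=> mf mg; apply: measurable_fun_mx => i j.
by under eq_fun do rewrite mxE; case: splitP => i' _; exact: measurable_funE.
Qed.

Lemma measurable_scalar_mx n (f : T -> R) :
  measurable_fun D f -> measurable_fun D (fun x => (f x)%:M : 'M[R]_n).
Proof.
move=> mf; apply: measurable_fun_mx => i j; under eq_fun do rewrite mxE.
case: (i == j); first exact: mf.
exact: (measurable_cst (0 : R)).
Qed.

End measurable_matrices.

Section open_matrices.
Context {R : realType} {m n : nat}.

(** The sigma-algebra is generated by the entries; an open set is a countable
    union of boxes with rational centres and radii 1/(k+1). This is how
    continuity gives measurability below. *)
Lemma mx_open_measurable (U : set 'M[R]_(m, n)) : open U -> measurable U.
Proof.
move=> oU.
pose B (qk : 'M[rat]_(m, n) * nat) : set 'M[R]_(m, n) :=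
  [set A | forall i j, `|ratr (qk.1 i j) - A i j| < qk.2.+1%:R^-1].
have mB qk : measurable (B qk).
  rewrite (_ : B qk = \bigcap_(ij in [set: 'I_m * 'I_n])
    ((fun A : 'M[R]_(m, n) => A ij.1 ij.2) @^-1`
      (ball (ratr (qk.1 ij.1 ij.2) : R) qk.2.+1%:R^-1))).
    apply: fin_bigcap_measurable => // ij _; rewrite -[X in measurable X]setTI.
    by apply: measurable_entry => //; exact: measurable_ball.
  apply/seteqP; split => [A BA ij _|A BA i j]; first exact: BA.
  exact: (BA (i, j)).
rewrite (_ : U = \bigcup_qk (if `[< B qk `<=` U >] then B qk else set0)).
  apply: countable_bigcupT_measurable => [|qk]; first exact: countableP.
  by case: ifP => // _; exact: mB.
apply/seteqP; split => [A UA|A [qk _]]; last first.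
  by case: ifPn => // /asboolP; exact.
have /nbhs_ballP[e /= e0 eU] : nbhs A U by exact: open_nbhs_nbhs.
have [k ke] : exists k : nat, 2 * k.+1%:R^-1 < e.
  exists (Num.truncn (2 / e)).
  by rewrite ltr_pdivrMr// mulrC -ltr_pdivrMr//; exact: truncnS_gt.
have qA i j : exists q : rat, `|ratr q - A i j| < k.+1%:R^-1.
  have : A i j - k.+1%:R^-1 < A i j + k.+1%:R^-1.
    by rewrite ltrD2l gtrN// invr_gt0.
  move=> /rat_in_itvoo[q]; rewrite in_itv/= => /andP[q1 q2]; exists q.
  by rewrite ltr_norml ltrBrDr addrC q1/= ltrBlDr addrC.
pose Q : 'M[rat]_(m, n) := \matrix_(i, j) sval (cid (qA i j)).
have BQA : B (Q, k) A by move=> i j; rewrite mxE; case: cid.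
exists (Q, k) => //; rewrite ifT//; apply/asboolP => C BQC; apply: eU.
split => // i j; apply: le_lt_trans ke.
rewrite -(subrKA (ratr (Q i j))) (le_trans (ler_normD _ _))// mulr2n mulrDl !mul1r.
by apply: lerD; [rewrite distrC|]; apply: ltW; [exact: BQA|exact: BQC].
Qed.

End open_matrices.

(** * Lebesgue measure on row vectors and symmetric matrices, by blocks *)

Section sigma_finite_product.
Local Open Scope ereal_scope.
Context d1 d2 (T1 : measurableType d1) (T2 : measurableType d2) (R : realType).
Variables (m1 : {sigma_finite_measure set T1 -> \bar R})
          (m2 : {sigma_finite_measure set T2 -> \bar R}).

(** The product measure under its own name, so that it can carry the
    sigma-finite structure needed to iterate products. *)
Definition sf_prod : set (T1 * T2) -> \bar R := m1 \x m2.

HB.instance Definition _ := Measure.copy sf_prod (m1 \x m2).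

Let sf_prod_sigma_finite : sigma_finite setT sf_prod.
Proof.
have /sigma_finiteP[F [TF ndF Foo]] := sigma_finiteT m1.
have /sigma_finiteP[G [TG ndG Goo]] := sigma_finiteT m2.
exists (fun n => F n `*` G n).
  rewrite -setXTT TF TG predeqE => -[x y]; split.
    move=> [/= [n _ Fnx] [k _ Gky]]; exists (maxn n k) => //; split.
    - by move: x Fnx; exact/subsetPset/ndF/leq_maxl.
    - by move: y Gky; exact/subsetPset/ndG/leq_maxr.
  by move=> [n _ []/= ? ?]; split; exists n.
move=> k; have [? ?] := Foo k; have [? ?] := Goo k.
split; first exact: measurableX.
by rewrite /sf_prod product_measure1E// lte_mul_pinfty// ge0_fin_numE.
Qed.

HB.instance Definition _ := @Measure_isSigmaFinite.Build _ _ _ sf_prod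
  sf_prod_sigma_finite.

End sigma_finite_product.

Section embedding_pushforward.
Context d1 d2 (T1 : measurableType d1) (T2 : measurableType d2) (R : realType).
Variables (phi : T1 -> T2) (psi : T2 -> T1).
Hypotheses (mphi : measurable_fun setT phi) (mpsi : measurable_fun setT psi).
Hypothesis phiK : cancel phi psi.

(** The left inverse psi is kept as a parameter because sigma-finiteness of the
    image measure comes from pulling back an exhaustion along psi. *)
Definition embed_measure of measurable_fun setT phi & measurable_fun setT psi
    & cancel phi psi := fun mu : {sigma_finite_measure set T1 -> \bar R} =>
  pushforward mu phi : set T2 -> \bar R.

Variable mu : {sigma_finite_measure set T1 -> \bar R}.
Local Notation nu := (embed_measure mphi mpsi phiK mu).

HB.instance Definition _ := Measure.copy nu
  (measure_function_pushforward__canonical__measure_function_Measure mu mphi).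

Let nu_sigma_finite : sigma_finite setT nu.
Proof.
have /sigma_finiteP[F [TF ndF Foo]] := sigma_finiteT mu.
exists (fun k => psi @^-1` (F k)).
  apply/esym; rewrite -subTset => t _.
  have [i _ Fi] : (\bigcup_i F i) (psi t) by rewrite -TF.
  by exists i.
move=> k; have [mF Fk] := Foo k; split.
  by rewrite -[X in measurable X]setTI; exact: mpsi.
rewrite /embed_measure /pushforward -comp_preimage.
by rewrite (_ : psi \o phi = id) //; apply/funext => x /=; rewrite phiK.
Qed.

HB.instance Definition _ := @Measure_isSigmaFinite.Build _ _ _ nu
  nu_sigma_finite.

End embedding_pushforward.

Section vector_measure.
Context {R : realType}.

Definition row_cons n (x : measurableTypeR R * 'rV[R]_n) : 'rV[R]_(1 + n) := row_mx x.1%:M x.2.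

Definition row_uncons n (b : 'rV[R]_(1 + n)) : measurableTypeR R * 'rV[R]_n :=
  (lsubmx b 0 0, rsubmx b).

Lemma measurable_row_cons n : measurable_fun setT (@row_cons n).
Proof.
by apply: measurable_row_mx; [apply: measurable_scalar_mx|];
  [exact: measurable_fst|exact: measurable_snd].
Qed.

Lemma measurable_row_uncons n : measurable_fun setT (@row_uncons n).
Proof.
apply: measurable_fun_pair => /=.
  by under eq_fun do rewrite mxE; exact: measurable_entry.
by apply: measurable_fun_mx => i j; under eq_fun do rewrite mxE;
  exact: measurable_entry.
Qed.

Lemma row_consK n : cancel (@row_cons n) (@row_uncons n).
Proof.
by case=> c b; rewrite /row_cons /row_uncons row_mxKl row_mxKr mxE eqxx.
Qed.

Definition lebesgue_prod d (T : measurableType d)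
    (mu : {sigma_finite_measure set T -> \bar R}) :
  {sigma_finite_measure set (measurableTypeR R * T)%type -> \bar R} :=
  sf_prod (@lebesgue_measure R) mu.

(** Adding one coordinate at a time is what lets Tonelli's theorem and
    induction on n replace a general change of variables theorem. *)
Fixpoint lebesgue_row n : {sigma_finite_measure set 'rV[R]_n -> \bar R} :=
  match n with
  | 0 => dirac (0 : 'rV[R]_0)
  | m.+1 => embed_measure (@measurable_row_cons m) (@measurable_row_uncons m)
      (@row_consK m) (lebesgue_prod (lebesgue_row m))
  end.

Lemma lebesgue_rowS n (g : 'rV[R]_(1 + n) -> \bar R) :
  measurable_fun setT g -> (forall b, 0 <= g b)%E ->
  (\int[lebesgue_row n.+1]_b g b =
   \int[lebesgue_measure]_c \int[lebesgue_row n]_b g (row_mx c%:M b))%E.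
Proof.
move=> mg g0.
rewrite [LHS](@ge0_integral_pushforward _ _ _ _ _ _ (@measurable_row_cons n))//.
rewrite fubini_tonelli1//; last by move=> x; exact: g0.
by apply: measurableT_comp => //; exact: measurable_row_cons.
Qed.

Lemma lebesgue_rowSr n (g : 'rV[R]_(1 + n) -> \bar R) :
  measurable_fun setT g -> (forall b, 0 <= g b)%E ->
  (\int[lebesgue_row n.+1]_b g b =
   \int[lebesgue_row n]_b \int[lebesgue_measure]_c g (row_mx c%:M b))%E.
Proof.
move=> mg g0.
rewrite [LHS](@ge0_integral_pushforward _ _ _ _ _ _ (@measurable_row_cons n))//.
rewrite fubini_tonelli2//; last by move=> x; exact: g0.
by apply: measurableT_comp => //; exact: measurable_row_cons.
Qed.

End vector_measure.

Section symmetric_measure.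
Context {R : realType}.

Definition sym_cons n (x : measurableTypeR R * ('rV[R]_n * 'M[R]_n)) : 'M[R]_(1 + n) :=
  block_mx x.1%:M x.2.1 x.2.1^T x.2.2.

Definition sym_uncons n (z : 'M[R]_(1 + n)) : measurableTypeR R * ('rV[R]_n * 'M[R]_n) :=
  (ulsubmx z 0 0, (ursubmx z, drsubmx z)).

Lemma measurable_sym_cons n : measurable_fun setT (@sym_cons n).
Proof.
have m2 : measurable_fun setT (fun x : measurableTypeR R * ('rV[R]_n * 'M[R]_n) => x.2.1).
  exact: measurableT_comp measurable_fst measurable_snd.
apply: measurable_block_mx => //.
- by apply: measurable_scalar_mx; exact: measurable_fst.
- exact: measurable_trmx.
- exact: measurableT_comp measurable_snd measurable_snd.
Qed.

Lemma measurable_sym_uncons n : measurable_fun setT (@sym_uncons n).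
Proof.
apply: measurable_fun_pair => /=.
  by under eq_fun do rewrite !mxE; exact: measurable_entry.
by apply: measurable_fun_pair => /=; apply: measurable_fun_mx => i j;
  under eq_fun do rewrite !mxE; exact: measurable_entry.
Qed.

Lemma sym_consK n : cancel (@sym_cons n) (@sym_uncons n).
Proof.
case=> c [b C]; rewrite /sym_cons /sym_uncons.
by rewrite block_mxKul block_mxKur block_mxKdr mxE eqxx.
Qed.

(** A symmetric matrix of size n+1 is a number c, a row b and a symmetric
    matrix C of size n; the block form is the one on which congruences act
    simply. *)
Fixpoint sym_measure n : {sigma_finite_measure set 'M[R]_n -> \bar R} :=
  match n with
  | 0 => dirac (0 : 'M[R]_0)
  | m.+1 => embed_measure (@measurable_sym_cons m) (@measurable_sym_uncons m)
      (@sym_consK m)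
      (lebesgue_prod (sf_prod (lebesgue_row m) (sym_measure m)))
  end.

Lemma sym_measureS n (g : 'M[R]_(1 + n) -> \bar R) :
  measurable_fun setT g -> (forall z, 0 <= g z)%E ->
  (\int[sym_measure n.+1]_z g z =
   \int[lebesgue_measure]_c \int[lebesgue_row n]_b \int[sym_measure n]_C
     g (block_mx c%:M b b^T C))%E.
Proof.
move=> mg g0.
rewrite [LHS](@ge0_integral_pushforward _ _ _ _ _ _ (@measurable_sym_cons n))//.
have mgc : measurable_fun setT (g \o @sym_cons n).
  by apply: measurableT_comp => //; exact: measurable_sym_cons.
have gc0 x : (0 <= (g \o @sym_cons n) x)%E by exact: g0.
rewrite fubini_tonelli1//; apply: eq_integral => c _.
rewrite /fubini_F fubini_tonelli1//.
exact: measurableT_comp mgc (measurable_pair1 c).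
Qed.

Lemma sym_measureSr n (g : 'M[R]_(1 + n) -> \bar R) :
  measurable_fun setT g -> (forall z, 0 <= g z)%E ->
  (\int[sym_measure n.+1]_z g z =
   \int[sym_measure n]_C \int[lebesgue_row n]_b \int[lebesgue_measure]_c
     g (block_mx c%:M b b^T C))%E.
Proof.
move=> mg g0.
rewrite [LHS](@ge0_integral_pushforward _ _ _ _ _ _ (@measurable_sym_cons n))//.
have mgc : measurable_fun setT (g \o @sym_cons n).
  by apply: measurableT_comp => //; exact: measurable_sym_cons.
have gc0 x : (0 <= (g \o @sym_cons n) x)%E by exact: g0.
rewrite fubini_tonelli2// fubini_tonelli2//; last first.
  by move=> x; exact: integral_ge0.
exact: measurable_fun_fubini_tonelli_G.
Qed.

End symmetric_measure.

(** * Linear changes of variables *)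

Section real_line.
Context {R : realType}.
Local Notation leb := (@lebesgue_measure R).

(** The image of |p| dx under x -> p x + q agrees with Lebesgue measure on
    half-open intervals. *)
Lemma lebesgue_affine (p q : R) (g : R -> \bar R) : p != 0 ->
  measurable_fun setT g -> (forall x, 0 <= g x)%E ->
  (\int[leb]_x g x = `|p|%:E * \int[leb]_x g (p * x + q)%R)%E.
Proof.
move=> p0 mg g0.
pose phi (x : measurableTypeR R) : measurableTypeR R := p * x + q.
have mphi : measurable_fun setT phi.
  by apply: measurable_funD => //; apply: measurable_funM.
pose pf := measure_function_pushforward__canonical__measure_function_Measure leb mphi.
pose nu := mscale (NngNum (normr_ge0 p)) pf.
have nuE A : measurable A -> leb A = nu A.
  apply: lebesgue_measure_unique => _ [[a b] _ <-].
  rewrite [RHS](_ : _ = (`|p|%:E * leb (phi @^-1` `]a, b]))%E)//=.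
  have [p_gt0|p_lt0|/eqP] := ltgtP 0 p; last by rewrite eq_sym (negbTE p0).
    rewrite (_ : phi @^-1` _ = `](a - q) / p, (b - q) / p]%classic); last first.
      apply/seteqP; split => x /=; rewrite !in_itv/= ltr_pdivrMr// ler_pdivlMr//;
        by rewrite ltrBlDr lerBrDr mulrC.
    rewrite !lebesgue_measure_itv/= !lte_fin ltr_pM2r ?invr_gt0// ltrD2r.
    case: ifPn => _; last by rewrite mule0.
    by rewrite -EFinB -EFinM gtr0_norm//; congr EFin; field; rewrite gt_eqF.
  rewrite (_ : phi @^-1` _ = `[(b - q) / p, (a - q) / p[%classic); last first.
    apply/seteqP; split => x /=; rewrite !in_itv/= ltr_ndivlMr// ler_ndivrMr//;
      by rewrite ltrBlDr lerBrDr mulrC andbC.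
  rewrite !lebesgue_measure_itv/= !lte_fin ltr_nM2r ?invr_lt0// ltrD2r.
  case: ifPn => _; last by rewrite mule0.
  by rewrite -EFinB -EFinM ltr0_norm//; congr EFin; field; rewrite lt_eqF.
rewrite (eq_measure_integral nu); last by move=> A mA _; exact: nuE.
rewrite ge0_integral_mscale//; congr (_ * _)%E.
by rewrite [LHS](@ge0_integral_pushforward _ _ _ _ _ _ mphi).
Qed.

End real_line.

Section row_vectors.
Context {R : realType}.
Local Notation leb := (@lebesgue_measure R).
Local Open Scope ereal_scope.

Lemma measurable_integral_row n (g : 'rV[R]_(1 + n) -> \bar R) :
  measurable_fun setT g -> (forall b, 0 <= g b) ->
  measurable_fun setT (fun c : R => \int[lebesgue_row n]_b g (row_mx c%:M b)).
Proof.
move=> mg g0; have mgc : measurable_fun setT (g \o @row_cons R n).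
  by apply: measurableT_comp => //; exact: measurable_row_cons.
apply: (@measurable_fun_fubini_tonelli_F _ _ _ _ _ _ _ mgc).
by move=> x; exact: g0.
Qed.

Lemma lebesgue_row_translation n (w : 'rV[R]_n) (g : 'rV[R]_n -> \bar R) :
  measurable_fun setT g -> (forall b, 0 <= g b) ->
  \int[lebesgue_row n]_b g b = \int[lebesgue_row n]_b g (b + w)%R.
Proof.
elim: n w g => [|n IH] w g mg g0.
  by apply: eq_integral => b _; rewrite [w]thinmx0 addr0.
rewrite -(@hsubmxK _ 1 1 n w).
move: (@lsubmx _ 1 1 n w) (@rsubmx _ 1 1 n w) => {w} w0 w.
rewrite [w0]mx11_scalar; move: (w0 0 0)%R => {}w0.
have mgw : measurable_fun setT
    (fun b : 'rV[R]_(1 + n) => g (b + row_mx w0%:M w)%R).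
  by apply: measurableT_comp => //; exact: measurable_addmx.
rewrite !lebesgue_rowS// (@lebesgue_affine _ 1 w0)//; last 2 first.
- exact: measurable_integral_row.
- by move=> c; exact: integral_ge0.
rewrite normr1 mul1e; apply: eq_integral => c _.
rewrite (IH w)//; last first.
  by apply: measurableT_comp => //; exact: measurable_row_mx.
by apply: eq_integral => b _; rewrite (@add_row_mx _ 1 1 n) mul1r raddfD.
Qed.

(** A shear translates one block by a function of the other, and a block
    diagonal matrix scales the first coordinate and acts on the others by
    induction. *)
Lemma lebesgue_row_linear n (a : 'M[R]_n) (g : 'rV[R]_n -> \bar R) :
  a \in unitmx -> measurable_fun setT g -> (forall b, 0 <= g b) ->
  \int[lebesgue_row n]_b g b =
  `|\det a|%R%:E * \int[lebesgue_row n]_b g (b *m a).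
Proof.
move=> ua; elim: n a ua g => [|n IH] a ua g mg g0.
  rewrite det_mx00 normr1 mul1e.
  by apply: eq_integral => b _; rewrite [b]thinmx0 mul0mx.
pose P (a : 'M[R]_(1 + n)) := forall g : 'rV[R]_(1 + n) -> \bar R,
  measurable_fun setT g -> (forall b, 0 <= g b) ->
  \int[lebesgue_row n.+1]_b g b =
  `|\det a|%R%:E * \int[lebesgue_row n.+1]_b g (b *m a).
suff : P a by exact.
have mgM (h : 'rV[R]_(1 + n) -> \bar R) (b : 'M[R]_(1 + n)) :
    measurable_fun setT h -> measurable_fun setT (fun x : 'rV[R]_(1 + n) => h (x *m b)).
  by move=> mh; apply: measurableT_comp => //; exact: measurable_mulmx.
move: ua; apply: unitmx_block_ind => {a g mg g0}.
- move=> a b _ _ Pa Pb g mg g0.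
  rewrite (Pb g mg g0) (Pa (fun x : 'rV[R]_(1 + n) => g (x *m b)))//; last exact: mgM.
  rewrite muleA -EFinM det_mulmx normrM mulrC; congr (_ * _).
  by apply: eq_integral => x _; rewrite mulmxA.
- move=> x g mg g0; rewrite det_ublock !det1 mul1r normr1 mul1e.
  rewrite !lebesgue_rowS//; last exact: mgM.
  apply: eq_integral => c _.
  rewrite (@lebesgue_row_translation _ (c *: x))//; last first.
    by apply: measurableT_comp => //; exact: measurable_row_mx.
  apply: eq_integral => b _; congr g.
  by rewrite (@mul_row_block _ 1 1 n 1 n) mulmx0 addr0 !mulmx1 mul_scalar_mx addrC.
- move=> y g mg g0; rewrite det_lblock !det1 mul1r normr1 mul1e.
  rewrite !lebesgue_rowSr//; last exact: mgM.
  apply: eq_integral => b _.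
  rewrite (@lebesgue_affine _ 1 ((b *m y) 0 0)%R)//; last first.
  - apply: measurableT_comp => //; apply: measurable_row_mx => //.
    exact: measurable_scalar_mx.
  rewrite normr1 mul1e; apply: eq_integral => c _; congr g.
  rewrite (@mul_row_block _ 1 1 n 1 n) mulmx0 add0r !mulmx1 mul1r raddfD/=.
  by congr row_mx; congr (_ + _)%R; rewrite [RHS]mx11_scalar.
- move=> p a p0 ua g mg g0.
  rewrite det_ublock det_scalar1 normrM !lebesgue_rowS//; last exact: mgM.
  rewrite (@lebesgue_affine _ p 0)//; last 2 first.
  - exact: measurable_integral_row.
  - by move=> c; exact: integral_ge0.
  rewrite EFinM -muleA; congr (_ * _).
  rewrite -ge0_integralZl//; last 2 first.
  - exact: (measurable_integral_row (mgM _ _ mg)).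
  - by move=> c _; exact: integral_ge0.
  apply: eq_integral => c _.
  rewrite (IH a ua)//; last first.
    by apply: measurableT_comp => //; exact: measurable_row_mx.
  congr (_ * _); apply: eq_integral => b _; congr g.
  by rewrite (@mul_row_block _ 1 1 n 1 n) !mulmx0 addr0 add0r addr0 -scalar_mxM mulrC.
Qed.

End row_vectors.

(** * Translations and congruences of symmetric matrices *)

Section symmetric_matrices.
Context {R : realType}.
Local Notation leb := (@lebesgue_measure R).
Local Notation blk c b C := (block_mx c%:M b b^T C).

Section measurable_inner.
Context {n : nat} (g : 'M[R]_(1 + n) -> \bar R).
Hypotheses (mg : measurable_fun setT g) (g0 : forall z, (0 <= g z)%E).

Let mgc : measurable_fun setT (g \o @sym_cons R n).
Proof. by apply: measurableT_comp => //; exact: measurable_sym_cons. Qed.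

Lemma measurable_block_c (b : 'rV[R]_n) (C : 'M[R]_n) :
  measurable_fun setT (fun c : R => g (blk c b C)).
Proof. exact: (measurableT_comp mgc (measurable_pair2 (b, C))). Qed.

Lemma measurable_block_C (c : R) (b : 'rV[R]_n) :
  measurable_fun setT (fun C : 'M[R]_n => g (blk c b C)).
Proof.
exact: (measurableT_comp (measurableT_comp mgc (measurable_pair1 c))
  (measurable_pair1 b)).
Qed.

Lemma measurable_integral_C (c : R) : measurable_fun setT
  (fun b : 'rV[R]_n => \int[sym_measure n]_C g (blk c b C))%E.
Proof.
have := measurableT_comp mgc (measurable_pair1 c).
by move=> /measurable_fun_fubini_tonelli_F; apply => x; exact: g0.
Qed.

Lemma measurable_integral_bC : measurable_fun setT
  (fun c : R => \int[lebesgue_row n]_b \int[sym_measure n]_C g (blk c b C))%E.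
Proof.
have mF := @measurable_fun_fubini_tonelli_F _ _ _ _ _
  (sf_prod (lebesgue_row n) (sym_measure n)) _ mgc (fun x => g0 _).
rewrite [X in measurable_fun _ X](_ : _ = fubini_F
  (sf_prod (lebesgue_row n) (sym_measure n)) (g \o @sym_cons R n)) //.
apply/funext => c; rewrite /fubini_F fubini_tonelli1//;
  last by move=> x; exact: g0.
exact: measurableT_comp mgc (measurable_pair1 c).
Qed.

Lemma measurable_integral_c (C : 'M[R]_n) : measurable_fun setT
  (fun b : 'rV[R]_n => \int[leb]_c g (blk c b C))%E.
Proof.
pose h (x : measurableTypeR R * 'rV[R]_n) := g (sym_cons (x.1, (x.2, C))).
have mh : measurable_fun setT h.
  apply: (measurableT_comp mgc); apply: measurable_fun_pair => //=.
  by apply: measurable_fun_pair => //=.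
by apply: (@measurable_fun_fubini_tonelli_G _ _ _ _ _ _ _ mh) => x; exact: g0.
Qed.

Lemma measurable_integral_bc : measurable_fun setT
  (fun C : 'M[R]_n => \int[lebesgue_row n]_b \int[leb]_c g (blk c b C))%E.
Proof.
have mG := @measurable_fun_fubini_tonelli_G _ _ _ _ _ leb _ mgc (fun x => g0 _).
apply: (@measurable_fun_fubini_tonelli_G _ _ _ _ _ (lebesgue_row n) _ mG).
by move=> x; apply: integral_ge0 => c _; exact: g0.
Qed.

End measurable_inner.

Local Open Scope ereal_scope.

Lemma lebesgue_integralZl (k : R) (g : R -> \bar R) : (0 <= k)%R ->
  measurable_fun setT g -> (forall x, 0 <= g x) ->
  k%:E * \int[leb]_x g x = \int[leb]_x (k%:E * g x).
Proof.
move=> k0 mg g0; rewrite (@ge0_integralZl_EFin _ (measurableTypeR R))//.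
Qed.

Lemma trmx_blk n (c : R) (b : 'rV[R]_n) (C : 'M[R]_n) : C^T = C ->
  (blk c b C)^T = blk c b C.
Proof. by move=> sC; rewrite tr_block_mx tr_scalar_mx trmxK sC. Qed.

(** The measure is carried by symmetric matrices; for the block construction
    this is an induction on the size. *)
Lemma sym_measure_eq n (g h : 'M[R]_n -> \bar R) :
  measurable_fun setT g -> measurable_fun setT h ->
  (forall z, 0 <= g z) -> (forall z, 0 <= h z) ->
  (forall z, z^T = z -> g z = h z) ->
  \int[sym_measure n]_z g z = \int[sym_measure n]_z h z.
Proof.
elim: n g h => [|n IH] g h mg mh g0 h0 gh.
  by apply: eq_integral => z _; apply: gh; apply/matrixP => -[].
rewrite (sym_measureS mg g0) (sym_measureS mh h0).
apply: eq_integral => c _; apply: eq_integral => b _.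
apply: IH => //; [exact: measurable_block_C|exact: measurable_block_C|].
by move=> C sC; apply: gh; exact: trmx_blk.
Qed.

Lemma sym_measure_translation n (w : 'M[R]_n) (g : 'M[R]_n -> \bar R) :
  w^T = w -> measurable_fun setT g -> (forall z, 0 <= g z) ->
  \int[sym_measure n]_z g z = \int[sym_measure n]_z g (z + w)%R.
Proof.
move=> sw; elim: n w sw g => [|n IH] w sw g mg g0.
  by apply: eq_integral => z _; rewrite [w]thinmx0 addr0.
have [wE sC] := @trmx_block_sym _ n w sw; rewrite wE.
move: (w 0 0)%R (@ursubmx _ 1 n 1 n w) (@drsubmx _ 1 n 1 n w) sC {wE}.
move=> w0 wb wC swC.
have mgw : measurable_fun setT (fun z : 'M[R]_(1 + n) => g (z + blk w0 wb wC)%R).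
  by apply: measurableT_comp => //; exact: measurable_addmx.
rewrite (sym_measureS mg g0) (sym_measureS mgw (fun=> g0 _)).
have G0 c : 0 <= \int[lebesgue_row n]_b \int[sym_measure n]_C g (blk c b C).
  by apply: integral_ge0 => b _; apply: integral_ge0 => C _; exact: g0.
rewrite (lebesgue_affine w0 (oner_neq0 _) (measurable_integral_bC mg g0) G0).
rewrite normr1 mul1e; apply: eq_integral => c _.
have H0 (b : 'rV[R]_n) : 0 <= \int[sym_measure n]_C g (blk (1 * c + w0)%R b C).
  by apply: integral_ge0 => C _; exact: g0.
rewrite (lebesgue_row_translation wb (measurable_integral_C mg g0 _) H0).
apply: eq_integral => b _.
rewrite (IH _ swC _ (measurable_block_C mg _ _) (fun=> g0 _)).
apply: eq_integral => C _.
by rewrite (@add_block_mx _ 1 n 1 n) mul1r !raddfD.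
Qed.

(** On block generators: a shear translates some of c, b and C by functions of
    the other blocks, hence preserves the measure for a suitable order of
    integration; diag(p, a) scales c by p^2, acts on b by p a^T and on C by
    congruence with a, and the exponents add up to 2 + n for |p| and to 1 + (n
    + 1) for |det a|. *)
Lemma sym_measure_congruence n (a : 'M[R]_n) (g : 'M[R]_n -> \bar R) :
  a \in unitmx -> measurable_fun setT g -> (forall z, 0 <= g z) ->
  \int[sym_measure n]_z g z =
  (`|\det a| ^+ n.+1)%R%:E * \int[sym_measure n]_z g (a *m z *m a^T).
Proof.
move=> ua; elim: n a ua g => [|n IH] a ua g mg g0.
  rewrite det_mx00 normr1 expr1n mul1e.
  by apply: eq_integral => z _; rewrite [z]thinmx0 mulmx0 mul0mx.
pose P (a : 'M[R]_(1 + n)) := forall g : 'M[R]_(1 + n) -> \bar R,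
  measurable_fun setT g -> (forall b, 0 <= g b) ->
  \int[sym_measure n.+1]_z g z =
  (`|\det a| ^+ n.+2)%R%:E * \int[sym_measure n.+1]_z g (a *m z *m a^T).
suff : P a by exact.
have mgM (h : 'M[R]_(1 + n) -> \bar R) (b : 'M[R]_(1 + n)) :
    measurable_fun setT h ->
    measurable_fun setT (fun z : 'M[R]_(1 + n) => h (b *m z *m b^T)).
  move=> mh; apply: measurableT_comp => //.
  by apply: measurable_mulmx => //; exact: measurable_mulmx.
move: ua; apply: unitmx_block_ind => {a g mg g0}.
- move=> a b _ _ Pa Pb g mg g0.
  rewrite (Pa g mg g0) (Pb (fun z : 'M[R]_(1 + n) => g (a *m z *m a^T)))//.
    rewrite muleA -EFinM det_mulmx normrM exprMn; congr (_ * _).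
    by apply: eq_integral => x _; rewrite trmx_mul !mulmxA.
  exact: mgM.
- move=> x g mg g0; rewrite det_ublock !det1 mul1r normr1 expr1n mul1e.
  have mgx := mgM _ (block_mx 1%:M x 0 1%:M) mg.
  rewrite (sym_measureSr mg g0) (sym_measureSr mgx (fun=> g0 _)).
  apply: (sym_measure_eq (measurable_integral_bc mg g0)
    (measurable_integral_bc mgx (fun=> g0 _))).
  + by move=> C; apply: integral_ge0 => b _; apply: integral_ge0 => c _; exact: g0.
  + by move=> C; apply: integral_ge0 => b _; apply: integral_ge0 => c _; exact: g0.
  move=> C sC.
  have H0 (b : 'rV[R]_n) : 0 <= \int[leb]_c g (blk c b C).
    by apply: integral_ge0 => c _; exact: g0.
  rewrite (lebesgue_row_translation (x *m C) (measurable_integral_c mg g0 C) H0).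
  apply: eq_integral => b _.
  pose k := ((x *m b^T + (b + x *m C) *m x^T) 0 0)%R.
  rewrite (lebesgue_affine k (oner_neq0 _) (measurable_block_c mg _ _) (fun=> g0 _)).
  rewrite normr1 mul1e; apply: eq_integral => c _; congr g.
  rewrite mul1r (@tr_block_mx _ 1 n 1 n) !trmx1 trmx0 !(@mulmx_block _ 1 n 1 n 1 n).
  rewrite !(mul1mx, mulmx1, mul0mx, mulmx0, add0r, addr0).
  congr block_mx; first by rewrite raddfD/= -mx11_scalar addrA.
  by rewrite linearD/= trmx_mul sC.
- move=> y g mg g0; rewrite det_lblock !det1 mul1r normr1 expr1n mul1e.
  have mgy := mgM _ (block_mx 1%:M 0 y 1%:M) mg.
  rewrite (sym_measureS mg g0) (sym_measureS mgy (fun=> g0 _)).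
  apply: eq_integral => c _.
  have H0 (b : 'rV[R]_n) : 0 <= \int[sym_measure n]_C g (blk c b C).
    by apply: integral_ge0 => C _; exact: g0.
  rewrite (lebesgue_row_translation (c *: y^T) (measurable_integral_C mg g0 c) H0).
  apply: eq_integral => b _.
  pose w := (y *m b + (y *m b)^T + c *: (y *m y^T))%R.
  have sw : w^T = w.
    by rewrite /w !linearD/= linearZ/= !trmx_mul !trmxK [(_ + y *m b)%R]addrC.
  rewrite (sym_measure_translation sw (measurable_block_C mg _ _) (fun=> g0 _)).
  apply: eq_integral => C _; congr g.
  rewrite (@tr_block_mx _ 1 n 1 n) !trmx1 trmx0 !(@mulmx_block _ 1 n 1 n 1 n).
  rewrite !(mul1mx, mulmx1, mul0mx, mulmx0, add0r, addr0).
  rewrite mul_mx_scalar mul_scalar_mx linearD/= linearZ/= trmxK.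
  congr block_mx; [by rewrite addrC|by rewrite addrC|].
  rewrite /w mulmxDl -scalemxAl trmx_mul.
  move: (y *m b) (b^T *m y^T) (c *: (y *m y^T)) (C : 'M[R]_n) => X Y Z T.
  by apply/matrixP => i j; rewrite !mxE; ring.
- move=> p a p0 ua g mg g0.
  have mgp := mgM _ (block_mx p%:M 0 0 a) mg.
  rewrite det_ublock det_scalar1 (sym_measureS mg g0) (sym_measureS mgp (fun=> g0 _)).
  have p20 : (p ^+ 2 != 0)%R by rewrite expf_neq0.
  have G0 (c : R) : 0 <= \int[lebesgue_row n]_b \int[sym_measure n]_C g (blk c b C).
    by apply: integral_ge0 => b _; apply: integral_ge0 => C _; exact: g0.
  rewrite (lebesgue_affine 0 p20 (measurable_integral_bC mg g0) G0).
  have -> : (`|p * \det a| ^+ n.+2 = `|p ^+ 2| * (`|p| ^+ n * `|\det a|) *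
      `|\det a| ^+ n.+1)%R.
    by rewrite normrM normrX exprMn !exprS; ring.
  have I0 (c : R) : 0 <= \int[lebesgue_row n]_b \int[sym_measure n]_C
      g (block_mx p%:M 0 0 a *m blk c b C *m (block_mx p%:M 0 0 a)^T).
    by apply: integral_ge0 => b _; apply: integral_ge0 => C _; exact: g0.
  rewrite -mulrA EFinM -muleA; congr (_ * _).
  have mI := measurable_integral_bC mgp (fun=> g0 _).
  rewrite (lebesgue_integralZl _ mI I0); last by rewrite !mulr_ge0// exprn_ge0.
  apply: eq_integral => c _; rewrite addr0.
  have upa : p *: a^T \in unitmx.
    by rewrite unitmxE detZ det_tr unitrM unitrX ?unitfE// -unitfE -unitmxE.
  have H0 (b : 'rV[R]_n) : 0 <= \int[sym_measure n]_C g (blk (p ^+ 2 * c)%R b C).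
    by apply: integral_ge0 => C _; exact: g0.
  rewrite (lebesgue_row_linear upa (measurable_integral_C mg g0 _) H0).
  rewrite detZ det_tr normrM normrX [in RHS]EFinM -muleA; congr (_ * _).
  have K0 (b : 'rV[R]_n) : 0 <= \int[sym_measure n]_C
      g (block_mx p%:M 0 0 a *m blk c b C *m (block_mx p%:M 0 0 a)^T).
    by apply: integral_ge0 => C _; exact: g0.
  have mK := measurable_integral_C mgp (fun=> g0 _) c.
  rewrite -(ge0_integralZl_EFin _ measurableT (fun b _ => K0 b) mK); last first.
    by rewrite exprn_ge0.
  apply: eq_integral => b _.
  rewrite (IH a ua _ (measurable_block_C mg _ _) (fun=> g0 _)); congr (_ * _).
  apply: eq_integral => C _; congr g.
  rewrite (@tr_block_mx _ 1 n 1 n) !trmx0 !(@mulmx_block _ 1 n 1 n 1 n).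
  rewrite !(mul0mx, mulmx0, add0r, addr0) tr_scalar_mx -!scalar_mxM expr2 mulrAC.
  rewrite mul_scalar_mx mul_mx_scalar -scalemxAl -scalemxAr linearZ/= trmx_mul trmxK.
  by rewrite scalemxAr.
Qed.

End symmetric_matrices.

(** * Integrability of det(1 + z^2)^(-(n+1)/2) *)

Section finite_integral.
Context {R : realType}.
Local Notation leb := (@lebesgue_measure R).
Local Open Scope ereal_scope.

Lemma measurable_powRr_comp d (T : measurableType d) (D : set T) (f : T -> R) s :
  measurable_fun D f -> measurable_fun D (fun x => f x `^ s)%R.
Proof. by move=> mf; exact: measurableT_comp (measurable_powR _) mf. Qed.

Lemma integralT_oneDsqrV : \int[leb]_x ((1 + x ^+ 2)^-1)%R%:E = (@pi R)%:E.
Proof.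
rewrite (@ge0_symfun_integralT R (fun x => (1 + x ^+ 2)^-1)%R).
- rewrite (_ : [set x | _] = `[0%R, +oo[%classic); last first.
    by apply/seteqP; split => x/=; rewrite in_itv/= andbT.
  by rewrite [X in _ * X]integral0y_oneDsqr -EFinM mulrCA divff// mulr1.
- by move=> x; rewrite invr_ge0 addr_ge0// sqr_ge0.
- exact: continuous_oneDsqrV.
- by move=> x /=; rewrite sqrrN.
Qed.

(** Scaling x by X^(1/2) reduces to X = 1, where the exponent is at most -1. *)
Lemma integral_shifted_sqr_le (X r : R) : (0 < X)%R -> (2^-1 <= r)%R ->
  \int[leb]_x ((X + x ^+ 2) `^ (- (r + 2^-1)))%R%:E <= (pi * X `^ (- r))%R%:E.
Proof.
move=> X0 r2.
have mD : measurable_fun setT (fun x : R => (X + x ^+ 2)%R).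
  by apply: measurable_funD => //; exact: measurable_funX.
have p0 : Num.sqrt X != 0%R by rewrite gt_eqF// sqrtr_gt0.
rewrite (@lebesgue_affine _ _ 0 _ p0); last 2 first.
- exact/measurable_EFinP/measurable_powRr_comp.
- by move=> x; rewrite lee_fin powR_ge0.
rewrite ger0_norm ?sqrtr_ge0//.
have E x : ((X + (Num.sqrt X * x + 0) ^+ 2) `^ (- (r + 2^-1)) =
    X `^ (- (r + 2^-1)) * (1 + x ^+ 2) `^ (- (r + 2^-1)))%R.
  rewrite addr0 exprMn sqr_sqrtr ?(ltW X0)// -{1}[X]mulr1 -mulrDr powRM//.
    exact: ltW.
  by rewrite addr_ge0// sqr_ge0.
under eq_integral do rewrite E EFinM.
have m1 : measurable_fun setT (fun x : R => (1 + x ^+ 2)%R).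
  by apply: measurable_funD => //; exact: measurable_funX.
have mp : measurable_fun setT
    (fun x : R => ((1 + x ^+ 2) `^ (- (r + 2^-1)))%:E).
  exact/measurable_EFinP/measurable_powRr_comp.
rewrite -(lebesgue_integralZl _ mp)//; last 2 first.
- exact: powR_ge0.
- by move=> x; rewrite lee_fin powR_ge0.
rewrite muleA -EFinM -powR12_sqrt ?(ltW X0)// -powRD; last first.
  by rewrite (gt_eqF X0) implybT.
rewrite opprD addrCA subrr addr0 mulrC EFinM lee_wpmul2l ?lee_fin ?powR_ge0//.
rewrite -integralT_oneDsqrV; apply: ge0_le_integral => //.
- by move=> x _; rewrite lee_fin powR_ge0.
- exact/measurable_EFinP/measurable_powRr_comp.
- by apply/measurable_EFinP; exact: measurable_funVr.
move=> x _; have q0 : (0 <= 1 + x ^+ 2)%R by rewrite addr_ge0 ?sqr_ge0.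
rewrite lee_fin -(powR_inv1 q0).
by apply: ler_powR; rewrite ?lerDl ?sqr_ge0//; lra.
Qed.

(** Integrating out one coordinate lowers the exponent by 1/2; the exponent
    stays in the range of [integral_shifted_sqr_le] throughout. *)
Lemma integral_row_le n (X r : R) : (0 < X)%R -> (2^-1 <= r)%R ->
  \int[lebesgue_row n]_b ((X + (b *m b^T) 0 0) `^ (- (r + n%:R / 2)))%R%:E
  <= (pi ^+ n * X `^ (- r))%R%:E.
Proof.
elim: n X r => [|n IH] X r X0 r2.
  rewrite [X in X <= _](@integral_dirac _ _ (0%R : 'rV[R]_0) R setT)//; last first.
    by apply/measurable_EFinP/measurable_powRr_comp/measurable_funD => //;
      apply: measurable_funE; apply: measurable_mulmx => //; exact: measurable_trmx.
  by rewrite diracT mul1e mul0mx mxE addr0 mul0r addr0 expr0 mul1r.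
have mg m (Y s : R) : measurable_fun setT (fun b : 'rV[R]_m =>
    ((Y + (b *m b^T) 0 0) `^ s)%R%:E).
  by apply/measurable_EFinP/measurable_powRr_comp/measurable_funD => //;
    apply: measurable_funE; apply: measurable_mulmx => //; exact: measurable_trmx.
have g0 m (Y s : R) (b : 'rV[R]_m) : 0 <= ((Y + (b *m b^T) 0 0) `^ s)%R%:E.
  by rewrite lee_fin powR_ge0.
rewrite (lebesgue_rowS (mg _ _ _) (g0 _ _ _)).
have mX : measurable_fun setT (fun c : R => (X + c ^+ 2)%R).
  by apply: measurable_funD => //; exact: measurable_funX.
have mXp : measurable_fun setT
    (fun c : R => ((X + c ^+ 2) `^ (- (r + 2^-1)))%R%:E).
  exact/measurable_EFinP/measurable_powRr_comp.
apply: (@le_trans _ _ (\int[leb]_c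
    ((pi ^+ n)%R%:E * ((X + c ^+ 2) `^ (- (r + 2^-1)))%R%:E))).
  apply: ge0_le_integral => //.
  - by move=> c _; apply: integral_ge0 => b _; exact: g0.
  - exact: (measurable_integral_row (mg _ _ _) (g0 _ _ _)).
  - exact: measurable_funeM.
  move=> c _; rewrite -EFinM; apply: le_trans (IH _ _ _ _); last 2 first.
  - by rewrite ltr_pwDl// sqr_ge0.
  - by rewrite (le_trans r2)// lerDl.
  rewrite le_eqVlt; apply/orP; left; apply/eqP.
  apply: eq_integral => b _; congr (_ `^ _)%R%:E.
    rewrite (@tr_row_mx _ 1 1 n) (@mul_row_col _ 1 1 n 1) mxE addrA.
    by rewrite tr_scalar_mx -scalar_mxM mxE eqxx mulr1n expr2.
  by rewrite -natr1; ring.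
rewrite -(lebesgue_integralZl _ mXp); last 2 first.
- by rewrite exprn_ge0// pi_ge0.
- by move=> c; rewrite lee_fin powR_ge0.
rewrite exprSr -mulrA EFinM lee_wpmul2l ?lee_fin ?exprn_ge0 ?pi_ge0//.
exact: integral_shifted_sqr_le.
Qed.

Definition siegel_integrand n s (z : 'M[R]_n) : \bar R :=
  (\det (1%:M + z *m z) `^ (- s))%R%:E.

Lemma measurable_siegel_integrand n s :
  measurable_fun setT (@siegel_integrand n s).
Proof.
apply/measurable_EFinP/measurable_powRr_comp/measurable_det.
by apply: measurable_addmx => //; exact: measurable_mulmx.
Qed.

Lemma siegel_integrand_ge0 n s z : 0 <= @siegel_integrand n s z.
Proof. by rewrite lee_fin powR_ge0. Qed.

(** By [det_1sqr_block] the integral over C is a product of powers of 1 + c^2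
    and 1 + c^2 + |b|^2 times the integral in size n with a larger exponent,
    finite by induction; the integral over b then leaves a multiple of 1 / (1 +
    c^2). *)
Lemma siegel_integral_finite n :
  \int[sym_measure n]_z siegel_integrand (n.+1%:R / 2) z < +oo.
Proof.
elim: n => [|n IH].
  rewrite [X in X < _](@integral_dirac _ _ (0%R : 'M[R]_0) R setT)//; last first.
    exact: measurable_siegel_integrand.
  by rewrite diracT mul1e ltry.
set s : R := (n.+2%:R / 2)%R.
set J := \int[sym_measure n]_z siegel_integrand s z.
(* J has the exponent of size n+1, larger than the one of size n; the minimum
   gives a comparison valid also off the symmetric matrices. *)
have Jlt : J < +oo.
  apply: le_lt_trans IH.
  rewrite /J (@sym_measure_eq _ n (siegel_integrand s)
    (fun z => mine (siegel_integrand s z) (siegel_integrand (n.+1%:R / 2) z))); last 5 first.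
  - exact: measurable_siegel_integrand.
  - apply: measurable_mine; exact: measurable_siegel_integrand.
  - exact: siegel_integrand_ge0.
  - by move=> z; rewrite le_min !siegel_integrand_ge0.
  - move=> z sz; apply/esym/min_idPl; rewrite lee_fin; apply: ler_powR.
      exact: det_1sqr_ge1.
    by rewrite lerN2 ler_wpM2r// ler_nat.
  apply: ge0_le_integral => //.
  - by move=> z _; rewrite le_min !siegel_integrand_ge0.
  - apply: measurable_mine; exact: measurable_siegel_integrand.
  - exact: measurable_siegel_integrand.
  - by move=> z _; rewrite ge_min lexx orbT.
have J0 : 0 <= J by apply: integral_ge0 => z _; exact: siegel_integrand_ge0.
have msi := @measurable_siegel_integrand n.+1 s.
have inner (c : R) (b : 'rV[R]_n) :
    \int[sym_measure n]_C siegel_integrand s (block_mx c%:M b b^T C) =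
    ((1 + c ^+ 2) `^ 2^-1)%R%:E *
    ((1 + c ^+ 2 + (b *m b^T) 0 0) `^ (- (3 / 2 + n%:R / 2)))%R%:E * J.
  set q := (1 + c ^+ 2)%R; have q0 : (0 < q)%R by rewrite ltr_pwDl// sqr_ge0.
  pose t := ((b *m b^T) 0 0)%R; have t0 : (0 <= t)%R by exact: row_gram_ge0.
  pose u := (1 + t / q)%R.
  have u0 : (0 < u)%R by rewrite ltr_pwDl// divr_ge0// ltW.
  have uq : (u * q = q + t)%R by rewrite /u mulrDl mul1r divfK// gt_eqF.
  (* The square root of 1 + q^-1 b^T b required by the block factorisation. *)
  have [k uk kE] := cholesky (posdef_1gram (((Num.sqrt q)^-1)%R *: b^T)).
  have {}kE : k *m k^T = (1%:M + q^-1 *: (b^T *m b))%R.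
    rewrite -kE linearZ/= trmxK -scalemxAl -scalemxAr scalerA -invfM -expr2.
    by rewrite sqr_sqrtr// ltW.
  have detk : `|\det k|%R = (u `^ 2^-1)%R.
    have dk2 : (\det k ^+ 2 = u)%R.
      rewrite expr2 -{2}det_tr -det_mulmx kE scalemxAl det_1addM_comm det_mx11.
      by rewrite -scalemxAr !mxE eqxx mulr1n /u /t mulrC mxE.
    by rewrite powR12_sqrt ?(ltW u0)// -dk2 sqrtr_sqr.
  pose w := ((c / q) *: (b^T *m b))%R.
  have sw : w^T = w by rewrite /w linearZ/= trmx_mul trmxK.
  have mC := measurable_block_C msi c b.
  rewrite (sym_measure_translation sw mC (fun=> siegel_integrand_ge0 _ _)).
  rewrite (sym_measure_congruence uk); last 2 first.
  - by apply: (measurableT_comp mC); exact: measurable_addmx.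
  - by move=> z; exact: siegel_integrand_ge0.
  have inE z : z^T = z ->
      siegel_integrand s (block_mx c%:M b b^T (k *m z *m k^T + w)%R) =
      ((q * u ^+ 2) `^ (- s))%R%:E * siegel_integrand s z.
    move=> sz; rewrite /siegel_integrand (det_1sqr_block z uk kE) -/q -/t -/u.
    have qu0 : (0 <= q * u ^+ 2)%R by rewrite mulr_ge0 ?sqr_ge0// ltW.
    by rewrite (powRM _ qu0 (le_trans ler01 (det_1sqr_ge1 sz))) EFinM.
  rewrite (@sym_measure_eq _ n _
     (fun z => ((q * u ^+ 2) `^ (- s))%R%:E * siegel_integrand s z)); last 5 first.
  - apply: (measurableT_comp mC); apply: measurable_addmx => //.
    by apply: measurable_mulmx => //; exact: measurable_mulmx.
  - by apply: measurable_funeM; exact: measurable_siegel_integrand.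
  - by move=> z; exact: siegel_integrand_ge0.
  - by move=> z; rewrite mule_ge0// ?lee_fin ?powR_ge0.
  - exact: inE.
  rewrite ge0_integralZl_EFin//; last 3 first.
  - by move=> z _; exact: siegel_integrand_ge0.
  - exact: measurable_siegel_integrand.
  - exact: powR_ge0.
  rewrite muleA -!EFinM -/J; congr (_%:E * _).
  have pD (x y z : R) : (0 < x -> x `^ y * x `^ z = x `^ (y + z))%R.
    by move=> x0; rewrite powRD// (gt_eqF x0) implybT.
  rewrite -/t -uq (powRM _ (ltW u0) (ltW q0)) (powRM _ (ltW q0) (sqr_ge0 _)).
  rewrite -(powR_mulrn 2 (ltW u0)) detk -(powR_mulrn _ (powR_ge0 _ _)) -!powRrM.
  rewrite mulrCA pD// [RHS]mulrCA pD// mulrC.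
  by congr (_ `^ _ * _ `^ _)%R; rewrite /s -!natr1; field.
rewrite (sym_measureS msi (@siegel_integrand_ge0 _ _)).
pose C : R := (pi ^+ n)%R.
have C0 : (0 <= C)%R by rewrite exprn_ge0// pi_ge0.
have q0 (c : R) : (0 < 1 + c ^+ 2)%R by rewrite ltr_pwDl// sqr_ge0.
have mb (c : R) : measurable_fun setT (fun b : 'rV[R]_n =>
    ((1 + c ^+ 2 + (b *m b^T) 0 0) `^ (- (3 / 2 + n%:R / 2)))%R%:E).
  by apply/measurable_EFinP/measurable_powRr_comp/measurable_funD => //;
    apply: measurable_funE; apply: measurable_mulmx => //; exact: measurable_trmx.
have b0 (c : R) (b : 'rV[R]_n) :
    0 <= ((1 + c ^+ 2 + (b *m b^T) 0 0) `^ (- (3 / 2 + n%:R / 2)))%R%:E.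
  by rewrite lee_fin powR_ge0.
have mq : measurable_fun setT (fun c : R => ((1 + c ^+ 2)^-1)%R%:E).
  by apply/measurable_EFinP/measurable_funVr/measurable_funD.
have Jfin : J \is a fin_num by rewrite ge0_fin_numE.
apply: (@le_lt_trans _ _ (\int[leb]_c ((C * fine J)%:E * ((1 + c ^+ 2)^-1)%R%:E))).
  apply: ge0_le_integral => //.
  - by move=> c _; apply: integral_ge0 => b _; apply: integral_ge0 => z _;
      exact: siegel_integrand_ge0.
  - exact: (measurable_integral_bC msi (@siegel_integrand_ge0 _ _)).
  - exact: measurable_funeM.
  move=> c _; under eq_integral do rewrite inner.
  under eq_integral do rewrite -muleA [X in _ * X]muleC muleA -[J]fineK//.
  rewrite ge0_integralZl//; last by rewrite mule_ge0// ?fineK// lee_fin powR_ge0.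
  have h2 : (2^-1 <= 3 / 2 :> R)%R by lra.
  have := integral_row_le n (q0 c) h2.
  move=> /(@lee_wpmul2l _ (((1 + c ^+ 2) `^ 2^-1)%:E * (fine J)%:E)).
  have -> : (0 <= ((1 + c ^+ 2) `^ 2^-1)%:E * (fine J)%:E).
    by rewrite mule_ge0// ?lee_fin ?powR_ge0 ?fine_ge0.
  move=> /(_ isT)/le_trans; apply; rewrite -!EFinM lee_fin.
  rewrite le_eqVlt; apply/orP; left; apply/eqP.
  rewrite -(powR_inv1 (ltW (q0 c))) mulrACA [RHS]mulrC [(_ `^ (-1))%R]
    (_ : _ = (1 + c ^+ 2) `^ 2^-1 * (1 + c ^+ 2) `^ (- (3 / 2)))%R; last first.
    by rewrite -powRD ?(gt_eqF (q0 c)) ?implybT//; congr (_ `^ _)%R; field.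
  by rewrite /C; ring.
rewrite -(lebesgue_integralZl _ mq); last 2 first.
- by rewrite mulr_ge0// fine_ge0.
- by move=> c; rewrite lee_fin invr_ge0 ltW.
by rewrite integralT_oneDsqrV -EFinM ltry.
Qed.

End finite_integral.

(** * Lebesgue measure on symmetric matrices in coordinates *)

Section boxes.
Context {R : realType}.
Local Notation leb := (@lebesgue_measure R).
Local Open Scope ereal_scope.

Definition tbox N (A : nat -> set R) : set (N.-tuple R) :=
  [set t | forall k, (k < N)%N -> A k (t : seq R)`_k].

Lemma measurable_nth N k : measurable_fun setT (fun t : N.-tuple R => (t : seq R)`_k).
Proof.
have [kN|Nk] := ltnP k N.
  rewrite (_ : (fun _ => _) = (@tnth _ R ^~ (Ordinal kN))).
    exact: measurable_tnth.
  by apply/funext => t; rewrite (tnth_nth 0%R).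
rewrite (_ : (fun _ => _) = cst 0%R); first exact: measurable_cst.
by apply/funext => t; rewrite nth_default// size_tuple.
Qed.

Lemma measurable_tbox N (A : nat -> set R) :
  (forall k, measurable (A k)) -> measurable (@tbox N A).
Proof.
move=> mA; rewrite (_ : tbox A = \bigcap_(k in [set: 'I_N])
    ((fun t : N.-tuple R => (t : seq R)`_k) @^-1` A k)).
  apply: fin_bigcap_measurable => // k _; rewrite -[X in measurable X]setTI.
  exact: measurable_nth.
apply/seteqP; split => [t tA k _|t tA k kN]; first exact: tA.
exact: (tA (Ordinal kN)).
Qed.

Lemma lebesgue_tuple_box N (A : nat -> set R) : (forall k, measurable (A k)) ->
  lebesgue_tuple R N (tbox A) = \prod_(k < N) leb (A k).
Proof.
elim: N A => [|N IH] A mA.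
  by rewrite big_ord0 [LHS]diracE mem_set.
rewrite big_ord_recl/=.
have -> : \prod_(i < N) leb (A (bump 0 i)) = \prod_(i < N) leb (A i.+1) by [].
rewrite -(IH (fun k => A k.+1))//.
rewrite -product_measure1E//; last exact: measurable_tbox; last exact: mA.
rewrite /lebesgue_cons /pushforward; congr (product_measure1 _ _ _).
apply/seteqP; split => -[x t]/=.
  by move=> tA; split => [|k kN]; [exact: (tA 0%N)|exact: (tA k.+1)].
by move=> [xA tA] [|k]//= kN; exact: tA.
Qed.

(** Boxes form a pi-system generating the sigma-algebra, exhausted by cubes of
    finite measure. *)
Lemma lebesgue_tuple_unique N (m : {measure set (N.-tuple R) -> \bar R}) :
  (forall A : nat -> set R, (forall k, measurable (A k)) ->
    m (tbox A) = \prod_(k < N) leb (A k)) ->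
  forall X, measurable X -> lebesgue_tuple R N X = m X.
Proof.
move=> mE.
pose G := [set X | exists2 A : nat -> set R,
  (forall k, measurable (A k)) & X = @tbox N A].
pose g i := @tbox N (fun=> `[(- i%:R)%R, i%:R%R]%classic).
apply: (@measure_unique _ _ _ G g).
- apply/seteqP; split.
    apply: smallest_sub; first exact: smallest_sigma_algebra.
    elim/big_ind : _ => [//|X Y XG YG|i _]; first by rewrite subUset.
    move=> _ [Y mY <-]; rewrite setTI; apply: sub_sigma_algebra.
    exists (fun k : nat => if k == i :> nat then Y else setT); first by move=> k; case: ifP.
    apply/seteqP; split => [t /= Yt k kN|t /(_ i (ltn_ord i))/=].
      by case: ifP => // /eqP ->; rewrite -(tnth_nth 0%R).
    by rewrite eqxx -(tnth_nth 0%R).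
  apply: smallest_sub; first exact: sigma_algebra_measurable.
  by move=> _ [A mA ->]; exact: measurable_tbox.
- move=> _ _ [A mA ->] [B mB ->]; exists (fun k => A k `&` B k).
    by move=> k; exact: measurableI.
  apply/seteqP; split => [t [tA tB] k kN|t tAB]; first by split; [exact: tA|exact: tB].
  by split=> k kN; have [] := tAB _ kN.
- by move=> i; exists (fun=> `[(- i%:R)%R, i%:R%R]%classic).
- rewrite -subTset => t _.
  pose S := (\sum_(k < N) `|(t : seq R)`_k|)%R.
  exists (Num.truncn S).+1 => // k kN; rewrite /= in_itv/= -ler_norml.
  apply: le_trans (ltW (truncnS_gt S)).
  by rewrite /S (bigD1 (Ordinal kN))//= lerDl sumr_ge0.
- by move=> _ [A mA ->]; rewrite mE//; exact: lebesgue_tuple_box.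
- move=> i; rewrite [X in X < _]lebesgue_tuple_box// ltey_eq; apply/orP; left.
  by apply: prode_fin_num => k _; rewrite lebesgue_measure_itv/=; case: ifP.
Qed.

Definition rowbox n (B : nat -> set R) : set 'rV[R]_n :=
  [set b | forall j : 'I_n, B j (b 0%R j)].

Lemma measurable_rowbox n (B : nat -> set R) : (forall k, measurable (B k)) ->
  measurable (@rowbox n B).
Proof.
move=> mB; rewrite (_ : rowbox B = \bigcap_(j in [set: 'I_n])
    ((fun b : 'rV[R]_n => b 0%R j) @^-1` B j)).
  apply: fin_bigcap_measurable => // k _; rewrite -[X in measurable X]setTI.
  exact: measurable_entry.
by apply/seteqP; split => [b bB j _|b bB j]; [exact: bB|exact: (bB j)].
Qed.

Lemma lebesgue_row_box n (B : nat -> set R) : (forall k, measurable (B k)) ->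
  lebesgue_row n (rowbox B) = \prod_(j < n) leb (B j).
Proof.
elim: n B => [|n IH] B mB.
  by rewrite big_ord0 [LHS]diracE mem_set// => -[].
rewrite big_ord_recl/=.
have -> : \prod_(i < n) leb (B (bump 0 i)) = \prod_(i < n) leb (B i.+1) by [].
rewrite -(IH (fun k => B k.+1))//.
rewrite -product_measure1E//; last exact: measurable_rowbox; last exact: mB.
rewrite /embed_measure /pushforward; congr (product_measure1 _ _ _).
apply/seteqP; split => -[c b]; rewrite /row_cons/=.
  move=> bB; split => [|j].
    have := bB (@lshift 1 n 0%R).
    by rewrite (@row_mxEl _ 1 1 n) mxE eqxx mulr1n.
  by have := bB (@rshift 1 n j); rewrite (@row_mxEr _ 1 1 n).
move=> [cB bB] j; rewrite -(@splitK 1 n j).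
case: (@fintype.split 1 n j) => k /=; rewrite ?(@row_mxEl _ 1 1 n) ?(@row_mxEr _ 1 1 n).
  by rewrite !ord1 mxE eqxx mulr1n.
exact: bB.
Qed.

(** Only entries on or above the diagonal are constrained: they are the free
    coordinates of a symmetric matrix. *)
Definition symbox n (B : nat -> nat -> set R) : set 'M[R]_n :=
  [set z | forall i j : 'I_n, (i <= j)%N -> B i j (z i j)].

Lemma measurable_symbox n (B : nat -> nat -> set R) :
  (forall i j, measurable (B i j)) -> measurable (@symbox n B).
Proof.
move=> mB; rewrite (_ : symbox B =
    \bigcap_(ij in [set ij : 'I_n * 'I_n | (ij.1 <= ij.2)%N])
    ((fun z : 'M[R]_n => z ij.1 ij.2) @^-1` B ij.1 ij.2)).
  apply: fin_bigcap_measurable => // ij _; rewrite -[X in measurable X]setTI.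
  exact: measurable_entry.
apply/seteqP; split => [z zB [i j]/= ij|z zB i j ij]; first exact: zB.
exact: (zB (i, j)).
Qed.

Lemma sym_measure_box n (B : nat -> nat -> set R) :
  (forall i j, measurable (B i j)) ->
  sym_measure n (symbox B) = \prod_(i < n) \prod_(j < n | (i <= j)%N) leb (B i j).
Proof.
elim: n B => [|n IH] B mB.
  by rewrite big_ord0 [LHS]diracE mem_set// => -[].
rewrite big_ord_recl/= big_ord_recl/= -muleA.
have -> : \prod_(i < n) leb (B 0%N (bump 0 i)) = \prod_(i < n) leb (B 0%N i.+1).
  by [].
have -> : \prod_(i < n) \prod_(j < n.+1 | (bump 0 i <= j)%N) leb (B (bump 0 i) j) =
    \prod_(i < n) \prod_(j < n | (i <= j)%N) leb (B i.+1 j.+1).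
  apply: eq_bigr => i _; rewrite big_mkcond big_ord_recl/= mul1e [RHS]big_mkcond.
  by apply: eq_bigr => j _.
rewrite -(IH (fun i j => B i.+1 j.+1))// -(lebesgue_row_box n (B := fun j => B 0%N j.+1))//.
rewrite -product_measure1E; [|exact: measurable_rowbox|exact: measurable_symbox].
rewrite -[X in _ = _ * X]/(sf_prod (lebesgue_row n) (sym_measure n) _).
rewrite -product_measure1E; [|exact: mB|]; last first.
  by apply: measurableX; [exact: measurable_rowbox|exact: measurable_symbox].
rewrite /embed_measure /pushforward; congr (product_measure1 _ _ _).
apply/seteqP; split => -[c [b C]]; rewrite /sym_cons/=.
  move=> zB; split; [|split].
  - have := zB (@lshift 1 n 0%R) (@lshift 1 n 0%R) isT.
    by rewrite (@block_mxEul _ 1 n 1 n) mxE eqxx mulr1n.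
  - move=> j; have := zB (@lshift 1 n 0%R) (@rshift 1 n j) isT.
    by rewrite (@block_mxEur _ 1 n 1 n).
  - move=> i j ij; have := zB (@rshift 1 n i) (@rshift 1 n j) ij.
    by rewrite (@block_mxEdr _ 1 n 1 n).
move=> [cB [bB CB]] i j; rewrite -(@splitK 1 n i) -(@splitK 1 n j).
case: (@fintype.split 1 n i) => k; case: (@fintype.split 1 n j) => l /=.
- by rewrite (@block_mxEul _ 1 n 1 n) !ord1 mxE eqxx mulr1n.
- by rewrite (@block_mxEur _ 1 n 1 n) !ord1 => _; exact: bB.
- by rewrite !ord1.
- by rewrite (@block_mxEdr _ 1 n 1 n); exact: CB.
Qed.

(** Position of the entry (i, j), i <= j, when the triangle is read column by
    column; by symmetry this is the row by row reading of the lower triangle. *)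
Definition sym_index i j := ('C(j.+1, 2) + i)%N.

Lemma sym_index_lt n i j : (i <= j < n)%N -> (sym_index i j < 'C(n.+1, 2))%N.
Proof.
move=> /andP[ij jn]; apply: (@leq_trans 'C(j.+2, 2)).
  by rewrite binS bin1 /sym_index addnC [X in (_ < X)%N]addnC ltn_add2r ltnS.
by apply: leq_bin2l.
Qed.

Lemma sym_index_inj i j i' j' : (i <= j)%N -> (i' <= j')%N ->
  sym_index i j = sym_index i' j' -> i = i' /\ j = j'.
Proof.
have lt a b a' b' : (a <= b)%N -> (b < b')%N -> (sym_index a b < sym_index a' b')%N.
  move=> ab bb'; apply: (@leq_trans 'C(b'.+1, 2)); last exact: leq_addr.
  by apply: sym_index_lt; rewrite ab.
move=> ij ij' e; have [jj'|jj'|jj'] := ltngtP j j'.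
- by have := lt i j i' j' ij jj'; rewrite e ltnn.
- by have := lt i' j' i j ij' jj'; rewrite e ltnn.
- by subst j'; split=> //; move/eqP: e; rewrite eqn_add2l => /eqP.
Qed.

Lemma sym_index_surj n k : (k < 'C(n.+1, 2))%N ->
  exists ij : 'I_n * 'I_n, (ij.1 <= ij.2)%N /\ k = sym_index ij.1 ij.2.
Proof.
elim: n => [|n IH]; first by rewrite bin_small.
rewrite binS bin1 => kn; have [/IH[[i j] /= [ij ->]]|nk] := ltnP k 'C(n.+1, 2).
  by exists (widen_ord (leqnSn n) i, widen_ord (leqnSn n) j).
have kn' : (k - 'C(n.+1, 2) < n.+1)%N by rewrite ltn_subLR.
exists (Ordinal kn', ord_max) => /=; split; first by rewrite -ltnS.
by rewrite /sym_index subnKC.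
Qed.

Lemma prod_sym_index n (F : nat -> \bar R) :
  \prod_(k < 'C(n.+1, 2)) F k =
  \prod_(i < n) \prod_(j < n | (i <= j)%N) F (sym_index i j).
Proof.
elim: n => [|n IH]; first by rewrite !big_ord0.
transitivity (\prod_(k < 'C(n.+1, 2) + n.+1) F k).
  by rewrite (_ : 'C(n.+2, 2) = ('C(n.+1, 2) + n.+1)%N) // binS bin1.
rewrite big_split_ord/= IH.
have -> : \prod_(i < n.+1) \prod_(j < n.+1 | (i <= j)%N) F (sym_index i j) =
    (\prod_(i < n.+1) \prod_(j < n | (i <= j)%N) F (sym_index i j)) *
    \prod_(i < n.+1) F (sym_index i n).
  rewrite -big_split; apply: eq_bigr => i _ /=.
  rewrite big_mkcond big_ord_recr/= -ltnS ltn_ord; congr (_ * _).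
  by rewrite [RHS]big_mkcond.
congr (_ * _); rewrite [RHS]big_ord_recr/= [X in _ = _ * X]big_pred0 ?mule1//.
by move=> j; rewrite leqNgt ltn_ord.
Qed.

End boxes.

Section lebesgue_sym_measure.
Context {R : realType} {n : nat}.
Local Open Scope ereal_scope.

Let ijof (k : 'I_'C(n.+1, 2)) : 'I_n * 'I_n :=
  sval (cid (sym_index_surj (ltn_ord k))).

Let ijofP k : ((ijof k).1 <= (ijof k).2)%N /\
  (k : nat) = sym_index (ijof k).1 (ijof k).2.
Proof. by rewrite /ijof; case: cid. Qed.

Let tuple_of_sym (z : 'M[R]_n) : 'C(n.+1, 2).-tuple R :=
  [tuple z (ijof k).1 (ijof k).2 | k < 'C(n.+1, 2)].

Let measurable_tuple_of_sym : measurable_fun setT tuple_of_sym.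
Proof.
apply/measurable_fun_tnthP => k; rewrite /comp/=.
under eq_fun do rewrite tnth_mktuple; exact: measurable_entry.
Qed.

Let tuple_of_symE z i j (kN : (sym_index i j < 'C(n.+1, 2))%N) (ij : (i <= j)%N)
    (iN : (i < n)%N) (jN : (j < n)%N) :
  (tuple_of_sym z : seq R)`_(sym_index i j) = z (Ordinal iN) (Ordinal jN).
Proof.
rewrite -[sym_index i j]/(Ordinal kN : nat) -tnth_nth tnth_mktuple.
have [ij' /= /esym e] := ijofP (Ordinal kN).
have [e1 e2] := sym_index_inj ij' ij e.
by congr (z _ _); apply/val_inj.
Qed.

Let sym_of_tupleK z : z^T = z -> sym_of_tuple (tuple_of_sym z) = z.
Proof.
move=> sz; apply/matrixP => i j; rewrite mxE.
have h (a b : 'I_n) : (a <= b)%N ->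
    (tuple_of_sym z : seq R)`_('C((maxn a b).+1, 2) + minn a b) = z a b.
  move=> ab; have lt : (sym_index a b < 'C(n.+1, 2))%N.
    by apply: sym_index_lt; rewrite ab/=.
  rewrite (maxn_idPr ab) (minn_idPl ab) -/(sym_index a b).
  rewrite (tuple_of_symE z lt ab (ltn_ord a) (ltn_ord b)).
  by congr (z _ _); apply/val_inj.
have [/h//|/h] := orP (leq_total i j).
by rewrite maxnC minnC => ->; rewrite -[in RHS]sz mxE.
Qed.

(** The image of the block measure on coordinate tuples agrees with Lebesgue
    measure on boxes, and a symmetric matrix is determined by its coordinates. *)
Lemma lebesgue_sym_integral (g : 'M[R]_n -> \bar R) :
  measurable_fun setT g -> (forall z, 0 <= g z) ->
  \int[lebesgue_sym]_z g z = \int[sym_measure n]_z g z.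
Proof.
move=> mg g0.
rewrite [LHS](@ge0_integral_pushforward _ _ _ _ _ _ measurable_sym_of_tuple)//.
pose m := measure_function_pushforward__canonical__measure_function_Measure
  (sym_measure n) measurable_tuple_of_sym.
have mE X : measurable X -> lebesgue_tuple R 'C(n.+1, 2) X = m X.
  apply: lebesgue_tuple_unique => A mA.
  rewrite (prod_sym_index n (fun k => lebesgue_measure (A k))) -(sym_measure_box n (B := fun i j => A (sym_index i j)))//.
  rewrite [LHS]/(sym_measure n (tuple_of_sym @^-1` (tbox A))).
  congr (sym_measure n _); apply/seteqP; split => z /=.
    move=> zA i j ij; have lt : (sym_index i j < 'C(n.+1, 2))%N.
      by apply: sym_index_lt; rewrite ij/=.
    have := zA _ lt; rewrite (tuple_of_symE z lt ij (ltn_ord i) (ltn_ord j)).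
    by congr (A _ (z _ _)); apply/val_inj.
  move=> zA k kN; have [ij /= e] := ijofP (Ordinal kN).
  have := tnth_mktuple (fun k => z (ijof k).1 (ijof k).2) (Ordinal kN).
  by rewrite (tnth_nth 0%R) /= => ->; rewrite [k in A k]e; exact: zA.
rewrite (eq_measure_integral m); last by move=> A mA _; exact: mE.
have mgs : measurable_fun setT (g \o @sym_of_tuple R n).
  by apply: measurableT_comp => //; exact: measurable_sym_of_tuple.
rewrite [LHS](@ge0_integral_pushforward _ _ _ _ _ _ measurable_tuple_of_sym)//=.
  apply: sym_measure_eq => //; last by move=> z sz /=; rewrite sym_of_tupleK.
  exact: (measurableT_comp mgs measurable_tuple_of_sym).
by rewrite preimage_setT.
Qed.

End lebesgue_sym_measure.

(** * Elementary functions are smooth *)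

Section elementary_functions.
Context {R : realType} {V : normedModType R}.
Variables (U : set V) (X : set (V -> R)).

(** A syntactic class of functions, closed under every directional derivative;
    smoothness of its members then follows from their differentiability alone. *)
Inductive elementary : (V -> R) -> Prop :=
| elementary_cst c : elementary (fun=> c)
| elementary_base f : X f -> elementary f
| elementaryD f g : elementary f -> elementary g ->
    elementary (fun x => f x + g x)
| elementaryM f g : elementary f -> elementary g ->
    elementary (fun x => f x * g x)
| elementaryV f : elementary f -> (forall x, U x -> f x != 0) ->
    elementary (fun x => (f x)^-1)
| elementary_exp f : elementary f -> elementary (fun x => expR (f x))
| elementary_cos f : elementary f -> elementary (fun x => cos (f x))
| elementary_sin f : elementary f -> elementary (fun x => sin (f x))
| elementary_ln f : elementary f -> (forall x, U x -> 0 < f x) ->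
    elementary (fun x => ln (f x)).

Hypothesis oU : open U.
Hypothesis X_diff : forall f x, X f -> differentiable f x.
Hypothesis X_derive : forall f v, X f -> exists c, forall x, 'D_v f x = c.

Lemma differentiable_comp1 (h : R -> R) (f : V -> R) (x : V) (dh : R) :
  is_derive (f x) 1 h dh -> differentiable f x ->
  differentiable (fun x => h (f x)) x /\
  forall v, 'D_v (fun x => h (f x)) x = 'D_v f x * dh.
Proof.
move=> hd df; have dhx : derivable h (f x) 1 by case: hd.
have dhf : differentiable h (f x) by exact/derivable1_diffP.
have dc : differentiable (h \o f) x by exact: differentiable_comp.
split=> // v; rewrite (deriveE v dc) (deriveE v df) diff_comp//= deriv1E//.
by rewrite derive1E; case: hd => _ ->.
Qed.

Lemma elementary_differentiable f : elementary f ->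
  forall x, U x -> differentiable f x.
Proof.
elim=> {f} [c|f Xf|f g _ df _ dg|f g _ df _ dg|f _ df f0|f _ df|f _ df|f _ df
  |f _ df f0] x Ux.
- exact: differentiable_cst.
- exact: X_diff.
- by apply: differentiableD; [exact: df|exact: dg].
- by apply: differentiableM; [exact: df|exact: dg].
- by apply: differentiableV; [exact: df|exact: f0].
- by have [] := differentiable_comp1 (is_derive_expR (f x)) (df _ Ux).
- by have [] := differentiable_comp1 (is_derive_cos (f x)) (df _ Ux).
- by have [] := differentiable_comp1 (is_derive_sin (f x)) (df _ Ux).
- by have [] := differentiable_comp1 (is_derive1_ln (f0 _ Ux)) (df _ Ux).
Qed.

Lemma elementaryN f : elementary f -> elementary (fun x => - f x).
Proof.
move=> ef; rewrite (_ : (fun _ => _) = fun x => (-1) * f x).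
  by apply: elementaryM => //; exact: elementary_cst.
by apply/funext => x; rewrite mulN1r.
Qed.

(** The derivative is again elementary but only agrees with it on U, where
    quotients and logarithms are differentiable. *)
Lemma elementary_derive f v : elementary f ->
  exists2 g, elementary g & forall x, U x -> 'D_v f x = g x.
Proof.
move=> ef; have := elementary_differentiable ef.
elim: ef => {f} [c|f Xf|f g ef IHf eg IHg|f g ef IHf eg IHg|f ef IHf f0
  |f ef IHf|f ef IHf|f ef IHf|f ef IHf f0] _.
- by exists (fun=> 0); [exact: elementary_cst|move=> x _; exact: derive_cst].
- have [c fc] := X_derive v Xf.
  by exists (fun=> c); [exact: elementary_cst|move=> x _; exact: fc].
- have [f' ef' f'E] := IHf (elementary_differentiable ef).
  have [g' eg' g'E] := IHg (elementary_differentiable eg).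
  exists (fun x => f' x + g' x); first exact: elementaryD.
  move=> x Ux; rewrite -f'E// -g'E// deriveD//;
    by apply: diff_derivable; exact: elementary_differentiable.
- have [f' ef' f'E] := IHf (elementary_differentiable ef).
  have [g' eg' g'E] := IHg (elementary_differentiable eg).
  exists (fun x => f x * g' x + g x * f' x).
    by apply: elementaryD; exact: elementaryM.
  move=> x Ux; rewrite -f'E// -g'E// deriveM//;
    by apply: diff_derivable; exact: elementary_differentiable.
- have [f' ef' f'E] := IHf (elementary_differentiable ef).
  exists (fun x => - ((f x)^-1 * (f x)^-1) * f' x).
    apply: elementaryM => //; apply: elementaryN.
    by apply: elementaryM; exact: elementaryV.
  move=> x Ux; rewrite deriveV ?f0//; last first.
    by apply: diff_derivable; exact: elementary_differentiable.
  by rewrite f'E// expr2 invfM.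
- have [f' ef' f'E] := IHf (elementary_differentiable ef).
  exists (fun x => f' x * expR (f x)).
    by apply: elementaryM => //; exact: elementary_exp.
  move=> x Ux; rewrite -f'E//.
  by have [_ ->] := differentiable_comp1 (is_derive_expR (f x))
    (elementary_differentiable ef Ux).
- have [f' ef' f'E] := IHf (elementary_differentiable ef).
  exists (fun x => f' x * - sin (f x)).
    by apply: elementaryM => //; apply: elementaryN; exact: elementary_sin.
  move=> x Ux; rewrite -f'E//.
  by have [_ ->] := differentiable_comp1 (is_derive_cos (f x))
    (elementary_differentiable ef Ux).
- have [f' ef' f'E] := IHf (elementary_differentiable ef).
  exists (fun x => f' x * cos (f x)).
    by apply: elementaryM => //; exact: elementary_cos.
  move=> x Ux; rewrite -f'E//.
  by have [_ ->] := differentiable_comp1 (is_derive_sin (f x))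
    (elementary_differentiable ef Ux).
- have [f' ef' f'E] := IHf (elementary_differentiable ef).
  exists (fun x => f' x * (f x)^-1).
    apply: elementaryM => //; apply: elementaryV => // x Ux.
    by rewrite gt_eqF ?f0.
  move=> x Ux; rewrite -f'E//.
  by have [_ ->] := differentiable_comp1 (is_derive1_ln (f0 _ Ux))
    (elementary_differentiable ef Ux).
Qed.

Lemma elementary_continuous f : elementary f ->
  forall x, U x -> {for x, continuous f}.
Proof.
by move=> ef x Ux; apply: differentiable_continuous;
  exact: elementary_differentiable.
Qed.

Lemma elementary_smooth f : elementary f -> smooth_on U f.
Proof.
move=> ef vs.
have [g eg fg] : exists2 g, elementary g &
    forall x, U x -> iter_derive vs f x = g x.
  elim: vs => [|v vs [g eg fg]]; first by exists f.
  have [h eh gh] := elementary_derive v eg.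
  exists h => // x Ux; rewrite -gh//=; apply: near_eq_derive.
  by apply: filterS fg _; exact: open_nbhs_nbhs.
move=> x Ux; have nfg : {near x, iter_derive vs f =1 g}.
  by apply: filterS fg _; exact: open_nbhs_nbhs.
split=> [|v].
  have := elementary_continuous eg Ux.
  rewrite /prop_for /continuous_at (fg _ Ux); apply: cvg_trans.
  apply: near_eq_cvg; near=> y; apply/esym; near: y; exact: nfg.
apply: (near_eq_derivable (f := g)).
  near=> y; apply/esym; near: y; exact: nfg.
by apply: diff_derivable; exact: elementary_differentiable.
Unshelve. all: by end_near. Qed.

Lemma elementary_ext f g : elementary f -> f =1 g -> elementary g.
Proof. by move=> ef /funext <-. Qed.

Lemma elementary_sum I (r : seq I) (f : I -> V -> R) :
  (forall i, elementary (f i)) -> elementary (fun x => \sum_(i <- r) f i x).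
Proof.
move=> ef; elim: r => [|i r IH].
  apply: (elementary_ext (elementary_cst 0)) => x; by rewrite big_nil.
apply: (elementary_ext (elementaryD (ef i) IH)) => x; by rewrite big_cons.
Qed.

Lemma elementary_prod I (r : seq I) (f : I -> V -> R) :
  (forall i, elementary (f i)) -> elementary (fun x => \prod_(i <- r) f i x).
Proof.
move=> ef; elim: r => [|i r IH].
  apply: (elementary_ext (elementary_cst 1)) => x; by rewrite big_nil.
apply: (elementary_ext (elementaryM (ef i) IH)) => x; by rewrite big_cons.
Qed.

Definition elementary_mx m n (f : V -> 'M[R]_(m, n)) : Prop :=
  forall i j, elementary (fun x => f x i j).

Lemma elementary_mulmx m n p (f : V -> 'M[R]_(m, n)) (g : V -> 'M[R]_(n, p)) :
  elementary_mx f -> elementary_mx g -> elementary_mx (fun x => f x *m g x).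
Proof.
move=> ef eg i j.
have H k : elementary (fun x => f x i k * g x k j) by exact: elementaryM.
by apply: (elementary_ext (elementary_sum _ H)) => x; rewrite mxE.
Qed.

Lemma elementary_trmx m n (f : V -> 'M[R]_(m, n)) :
  elementary_mx f -> elementary_mx (fun x => (f x)^T).
Proof. by move=> ef i j; apply: (elementary_ext (ef j i)) => x; rewrite mxE. Qed.

Lemma elementary_det n (f : V -> 'M[R]_n) :
  elementary_mx f -> elementary (fun x => \det (f x)).
Proof.
move=> ef; apply: elementary_sum => s; apply: elementaryM.
  exact: elementary_cst.
by apply: elementary_prod => i; exact: ef.
Qed.

Lemma elementary_adjugate n (f : V -> 'M[R]_n) :
  elementary_mx f -> elementary_mx (fun x => \adj (f x)).
Proof.
move=> ef i j.
have : elementary (fun x => (-1) ^+ (j + i) * \det (row' j (col' i (f x)))).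
  apply: elementaryM; first exact: elementary_cst.
  by apply: elementary_det => k l; apply: (elementary_ext (ef _ _)) => x; rewrite !mxE.
by move=> /elementary_ext; apply => x; rewrite mxE.
Qed.

(** The inverse matrix is written with the adjugate, which is polynomial in the
    entries, so that the expression makes sense everywhere. *)
Lemma elementary_invmx n (f : V -> 'M[R]_n) :
  elementary_mx f -> (forall x, U x -> f x \in unitmx) ->
  elementary_mx (fun x => (\det (f x))^-1 *: \adj (f x)).
Proof.
move=> ef uf i j.
apply: (elementary_ext (f := fun x => (\det (f x))^-1 * (\adj (f x)) i j)).
  apply: elementaryM; last exact: elementary_adjugate.
  apply: elementaryV; first exact: elementary_det.
  by move=> x /uf; rewrite unitmxE unitfE.
by move=> x; rewrite [RHS]mxE.
Qed.

End elementary_functions.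

Section matrix_entries.
Context {R : realType} {m n : nat}.

Definition mx_entries : set ('M[R]_(m, n) -> R) :=
  [set f | exists i j, f = fun A : 'M[R]_(m, n) => A i j].

Lemma mx_entries_diff f (x : 'M[R]_(m, n)) : mx_entries f -> differentiable f x.
Proof. by move=> [i [j ->]]; exact: differentiable_coord. Qed.

Lemma mx_entries_derive f v : mx_entries f -> exists c, forall x, 'D_v f x = c.
Proof.
move=> [i [j ->]]; exists (v i j) => x.
apply: cvg_lim => //; apply: cvg_near_cst.
near=> h; rewrite /= !mxE addrK /GRing.scale/= mulrA mulVf ?mul1r//.
near: h; exact: nbhs_dnbhs_neq.
Unshelve. all: by end_near. Qed.

Lemma elementary_mx_id U : elementary_mx (V := 'M[R]_(m, n)) U mx_entries id.
Proof. by move=> i j; apply: elementary_base; exists i, j. Qed.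

End matrix_entries.

(** * Matrices of signature (p, q) *)

Section matrix_limits.
Context {R : realType}.

Lemma cvg_mx T (F : set_system T) {FF : Filter F} m n (f : T -> 'M[R]_(m, n)) (M : 'M[R]_(m, n)) :
  (forall i j, (fun x => f x i j) @ F --> M i j) -> f @ F --> M.
Proof.
move=> fM A [P MP PA]; have {}MP i j : nbhs (M i j) (P i j) by exact: MP.
have h : \forall x \near F, forall ij : 'I_m * 'I_n, P ij.1 ij.2 (f x ij.1 ij.2).
  by apply: filter_forall => ij; apply: (fM ij.1 ij.2); exact: MP.
by apply: filterS h => x h; apply: PA => i j; have := h (i, j).
Qed.

Lemma cvg_entry T (F : set_system T) {FF : Filter F} m n (f : T -> 'M[R]_(m, n))
    (M : 'M[R]_(m, n)) i j : f @ F --> M -> (fun x => f x i j) @ F --> M i j.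
Proof.
move=> fM; apply: (@cvg_comp _ _ _ f (fun A : 'M[R]_(m, n) => A i j) _ _ _ fM).
exact: coord_continuous.
Qed.

Lemma cvg_mulmx T (F : set_system T) {FF : Filter F} m n p
    (f : T -> 'M[R]_(m, n)) (g : T -> 'M[R]_(n, p)) (M : 'M[R]_(m, n)) (N : 'M[R]_(n, p)) :
  f @ F --> M -> g @ F --> N -> (fun x => f x *m g x) @ F --> M *m N.
Proof.
move=> fM gN; apply: cvg_mx => i j; rewrite mxE; under eq_fun do rewrite mxE.
apply: cvg_big => [|k _]; first exact: add_continuous.
apply: cvgM.
  exact: cvg_entry.
exact: cvg_entry.
Qed.

Lemma cvg_select T (F : set_system T) {FF : Filter F} m n p q
    (f : T -> 'M[R]_(m, n)) (M : 'M[R]_(m, n)) (h : 'M[R]_(m, n) -> 'M[R]_(p, q)) :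
  (forall i j, exists k l, forall w, h w i j = w k l) ->
  f @ F --> M -> (fun x => h (f x)) @ F --> h M.
Proof.
move=> hE fM; apply: cvg_mx => i j; have [k [l hkl]] := hE i j.
by rewrite hkl; under eq_fun do rewrite hkl; exact: cvg_entry.
Qed.

Definition schur n (w : 'M[R]_(1 + n)) : 'M[R]_n :=
  drsubmx w - (w 0 0)^-1 *: (dlsubmx w *m ursubmx w).

Lemma cvg_schur T (F : set_system T) {FF : Filter F} n
    (f : T -> 'M[R]_(1 + n)) (M : 'M[R]_(1 + n)) : M 0 0 != 0 ->
  f @ F --> M -> (fun x => schur (f x)) @ F --> schur M.
Proof.
move=> M0 fM; apply: cvgB.
  by apply: (cvg_select (h := @drsubmx R 1 n 1 n)) fM => i j;
    eexists; eexists => w; rewrite !mxE.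
apply: cvgZ; first by apply: cvgV => //; exact: cvg_entry.
apply: cvg_mulmx.
  by apply: (cvg_select (h := @dlsubmx R 1 n 1 n)) fM => i j;
    eexists; eexists => w; rewrite !mxE.
by apply: (cvg_select (h := @ursubmx R 1 n 1 n)) fM => i j;
    eexists; eexists => w; rewrite !mxE.
Qed.

Lemma cvg_symmetrize T (F : set_system T) {FF : Filter F} n
    (f : T -> 'M[R]_n) (M : 'M[R]_n) :
  f @ F --> M -> (fun x => 2^-1 *: (f x + (f x)^T)) @ F --> 2^-1 *: (M + M^T).
Proof.
move=> fM; apply: cvg_mx => i j; rewrite !mxE; under eq_fun do rewrite !mxE.
by apply: cvgM; [exact: cvg_cst|apply: cvgD; exact: cvg_entry].
Qed.

End matrix_limits.

Section signature_open.
Context {R : realType}.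

Lemma card_set_row n (P : pred R) (a : R) (b : 'rV[R]_n) :
  #|[set i | P ((row_mx a%:M b : 'rV[R]_(1 + n)) 0 i)]%SET| =
  (P a + #|[set i | P (b 0%R i)]%SET|)%N.
Proof.
rewrite -!sum1dep_card big_split_ord/= big_mkcond/= big_ord_recl big_ord0 addn0.
rewrite row_mxEl mxE eqxx mulr1n; congr (_ + _)%N.
by apply: eq_bigl => i; rewrite row_mxEr.
Qed.

(** Induction with Schur complements: near diag(a, b) the first diagonal entry
    keeps the sign of a, and the Schur complement is close to diag(b). *)
Lemma signature_near_diag n (e : 'rV[R]_n) : (forall i, e 0 i != 0) ->
  \forall w \near diag_mx e, w^T = w ->
    has_signature #|[set i | 0 < e 0 i]%SET| #|[set i | e 0 i < 0]%SET| w.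
Proof.
elim: n e => [|n IH] e e0.
  apply: filterE => w _; exists 1%:M, e; split=> //; first exact: unitmx1.
  by apply/matrixP => -[].
move: e e0; rewrite -[n.+1]/(1 + n)%N => e; rewrite -[e]hsubmxK.
rewrite [lsubmx e]mx11_scalar; move: (lsubmx e 0 0) (rsubmx e) => a b {e} ab0.
have a0 : a != 0 by have := ab0 (lshift n 0); rewrite row_mxEl mxE eqxx.
have b0 i : b 0 i != 0 by have := ab0 (rshift 1 i); rewrite row_mxEr.
set D := diag_mx _.
have DE : D = block_mx a%:M 0 0 (diag_mx b).
  by rewrite /D diag_mx_row; congr block_mx; apply/matrixP => i j; rewrite !ord1 !mxE.
have D00 : D 0 0 = a.
  have -> : (0 : 'I_(1 + n)) = lshift n 0 by apply/val_inj.
  by rewrite DE block_mxEul mxE eqxx.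
have cS : schur w @[w --> D] --> diag_mx b.
  have -> : diag_mx b = schur D.
    by rewrite /schur D00 DE block_mxKdr block_mxKdl block_mxKur mul0mx scaler0 subr0.
  apply: (@cvg_schur _ _ (nbhs D) (nbhs_filter D) n id D); first by rewrite D00.
  exact: cvg_id.
have near_a : \forall w \near D, 0 < (w : 'M[R]_(1 + n)) 0 0 * a.
  have c : (w : 'M[R]_(1 + n)) 0 0 @[w --> D] --> a.
    by rewrite -D00; exact: coord_continuous.
  have [a_gt0|a_lt0|a_eq0] := ltgtP 0 a; last by rewrite -a_eq0 eqxx in a0.
    by apply: filterS (cvgr_gt _ c _ a_gt0) => w; rewrite pmulr_lgt0.
  by apply: filterS (cvgr_lt _ c _ a_lt0) => w; rewrite nmulr_lgt0.
near=> w => sw.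
have wa : 0 < w 0 0 * a by near: w.
have w00 : w 0 0 != 0 by apply: contraTneq wa => ->; rewrite mul0r ltxx.
have [wE sC] := @trmx_block_sym _ n w sw.
have dlE : dlsubmx w = (ursubmx w)^T by rewrite trmx_ursub sw.
have [g [d [ug SE dpos dneg]]] : has_signature #|[set i | 0 < b 0 i]%SET|
    #|[set i | b 0 i < 0]%SET| (schur w).
  have : (schur w)^T = schur w -> has_signature #|[set i | 0 < b 0 i]%SET|
    #|[set i | b 0 i < 0]%SET| (schur w) by near: w; exact: (cS _ (IH b b0)).
  by apply; rewrite /schur linearB/= linearZ/= trmx_mul dlE trmxK sC.
have sgn_pos : (0 < w 0 0) = (0 < a).
  move: wa; have [a_gt0|a_lt0|a_eq0] := ltgtP 0 a.
  - by rewrite pmulr_lgt0.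
  - by rewrite nmulr_lgt0// => /lt_gtF.
  - by rewrite -a_eq0 eqxx in a0.
have sgn_neg : (w 0 0 < 0) = (a < 0).
  by rewrite !ltNge !le_eqVlt ![0 == _]eq_sym (negbTE w00) (negbTE a0)/= sgn_pos.
pose L : 'M[R]_(1 + n) := block_mx 1%:M 0 ((w 0 0)^-1 *: (ursubmx w)^T) 1%:M.
exists (L *m block_mx 1%:M 0 0 g), (row_mx (w 0 0)%:M d); split.
- by rewrite unitmx_mul !unitmxE !det_lblock !det1 !mul1r unitr1 -unitmxE.
- have dE : diag_mx (row_mx (w 0 0)%:M d) = block_mx (w 0 0)%:M 0 0 (diag_mx d).
    by rewrite diag_mx_row; congr block_mx; apply/matrixP => i j; rewrite !ord1 !mxE.
  rewrite trmx_mul dE !mulmxA -(mulmxA L) -(mulmxA L) -(mulmxA _ _ L^T).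
  rewrite tr_block_mx !trmx0 trmx1 !mulmx_block.
  rewrite !(mul0mx, mulmx0, add0r, addr0, mul1mx, mulmx1) -SE.
  rewrite /L tr_block_mx trmx0 !trmx1 !mulmx_block linearZ/= trmxK.
  rewrite !(mul0mx, mulmx0, add0r, addr0, mul1mx, mulmx1).
  rewrite mul_mx_scalar mul_scalar_mx !scalerA divff// !scale1r -scalemxAl.
  by rewrite /schur dlE addrC subrK.
- by rewrite !card_set_row dpos sgn_pos.
- rewrite (card_set_row (fun x => x < 0)) dneg sgn_neg.
  by rewrite (card_set_row (fun x => x < 0)).
Unshelve. all: by end_near. Qed.

Lemma signature_neq0 n p q (e : 'rV[R]_n) : (p + q = n)%N ->
  #|[set i | 0 < e 0 i]%SET| = p -> #|[set i | e 0 i < 0]%SET| = q ->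
  forall i, e 0 i != 0.
Proof.
move=> pqn pE qE i; apply/negP => /eqP ei0.
have : (p + q <= #|~: [set i]%SET|)%N.
  rewrite -pE -qE -cardsUI (_ : _ :&: _ = finset.set0)%SET ?cards0 ?addn0; last first.
    by apply/setP => j; rewrite !inE; apply/negP => /andP[/lt_gtF ->].
  apply: subset_leq_card; apply/fintype.subsetP => j; rewrite !inE; apply: contraTN => /eqP ->.
  by rewrite ei0 ltxx.
have n0 : (0 < n)%N by exact: leq_ltn_trans (leq0n _) (ltn_ord i).
by rewrite pqn cardsC1 card_ord leqNgt ltn_predL n0.

Qed.

Lemma Omega_unitmx n p q (z : 'M[R]_n) : (p + q = n)%N -> Omega p q z ->
  z \in unitmx.
Proof.
move=> pqn [g [e [ug -> pE qE]]]; rewrite !unitmx_mul unitmx_tr ug andbT/=.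
rewrite unitmxE det_diag unitfE; apply/prodf_neq0 => i _.
exact: signature_neq0 pqn pE qE i.
Qed.

Lemma Omega_sym n p q (z : 'M[R]_n) : Omega p q z -> z^T = z.
Proof.
by move=> [g [e [_ -> _ _]]]; rewrite !trmx_mul trmxK tr_diag_mx mulmxA.
Qed.

(** Congruence by the inverse of g moves z to a diagonal matrix. *)
Lemma Omega_near n p q (z : 'M[R]_n) : (p + q = n)%N -> Omega p q z ->
  \forall w \near z, w^T = w -> Omega p q w.
Proof.
move=> pqn [g [e [ug zE pE qE]]].
have e0 := signature_neq0 pqn pE qE.
have c : invmx g *m w *m (invmx g)^T @[w --> z] --> diag_mx e.
  have -> : diag_mx e = invmx g *m z *m (invmx g)^T.
    rewrite zE !mulmxA mulVmx// mul1mx -mulmxA -trmx_mul mulVmx//.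
    by rewrite trmx1 mulmx1.
  apply: (@cvg_mulmx _ _ (nbhs z) (nbhs_filter z)); last exact: cvg_cst.
  apply: (@cvg_mulmx _ _ (nbhs z) (nbhs_filter z)); first exact: cvg_cst.
  exact: cvg_id.
near=> w => sw.
have [g1 [e1 [ug1 wE pE1 qE1]]] : has_signature #|[set i | 0 < e 0 i]%SET|
    #|[set i | e 0 i < 0]%SET| (invmx g *m w *m (invmx g)^T).
  have : (invmx g *m w *m (invmx g)^T)^T = invmx g *m w *m (invmx g)^T ->
      has_signature #|[set i | 0 < e 0 i]%SET| #|[set i | e 0 i < 0]%SET|
        (invmx g *m w *m (invmx g)^T).
    by near: w; exact: (c _ (signature_near_diag e0)).
  by apply; rewrite !trmx_mul trmxK sw mulmxA.
exists (g *m g1), e1; split; rewrite ?pE1 ?qE1//; first by rewrite unitmx_mul ug.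
rewrite trmx_mul !mulmxA -(mulmxA g g1) -(mulmxA g _ g1^T) -wE !mulmxA mulmxV//.
by rewrite mul1mx -mulmxA -trmx_mul mulmxV// trmx1 mulmx1.
Unshelve. all: by end_near. Qed.

(** The set is not open among all matrices, only among symmetric ones: it is
    the intersection of an open set with the symmetric matrices. *)
Lemma measurable_Omega n p q : (p + q = n)%N -> measurable (@Omega R n p q).
Proof.
move=> pqn.
pose sym (w : 'M[R]_n) : 'M[R]_n := 2^-1 *: (w + w^T).
have symE w : w^T = w -> sym w = w.
  by move=> sw; rewrite /sym sw; apply/matrixP => i j; rewrite !mxE; field.
pose O : set 'M[R]_n := (fun w => Omega p q (sym w))^°.
have -> : Omega p q = O `&` [set w | w^T = w].
  apply/seteqP; split => [z Oz|z [/interior_subset + sz]]; last by rewrite symE.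
  split; last exact: Omega_sym Oz.
  have sz := Omega_sym Oz.
  have := Omega_near pqn Oz; rewrite -{1}(symE z sz) => h.
  have csym : sym w @[w --> z] --> sym z.
    by apply: (@cvg_symmetrize _ _ (nbhs z)); exact: cvg_id.
  rewrite /O /= /interior; near=> w.
  have : (sym w)^T = sym w -> Omega p q (sym w) by near: w; exact: (csym _ h).
  by apply; rewrite /sym linearZ/= linearD/= trmxK addrC.
apply: measurableI; first by apply: mx_open_measurable; exact: open_interior.
rewrite (_ : [set w | _] = \bigcap_(ij in [set: 'I_n * 'I_n])
    ((fun w : 'M[R]_n => w ij.2 ij.1 - w ij.1 ij.2) @^-1` [set 0])).
  apply: fin_bigcap_measurable => // ij _; rewrite -[X in measurable X]setTI.
  by apply: measurable_funB => //; exact: measurable_entry.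
apply/seteqP; split => [w /= sw ij _|w wE].
  by rewrite /= -{1}sw mxE subrr.
apply/matrixP => i j; rewrite mxE; apply/eqP; rewrite -subr_eq0; apply/eqP.
by have := wE (i, j); apply.
Unshelve. all: by end_near. Qed.

End signature_open.

(** * Complex powers and complex-valued functions *)

Section complex_powers.
Context {R : realType}.
Implicit Types (z w s : R[i]) (t u : R).

Lemma ReM z w : complex.Re (z * w) =
  complex.Re z * complex.Re w - complex.Im z * complex.Im w.
Proof. by case: z w => [a b] [c e]. Qed.

Lemma ImM z w : complex.Im (z * w) =
  complex.Re z * complex.Im w + complex.Im z * complex.Re w.
Proof. by case: z w => [a b] [c e]. Qed.

Lemma ReD z w : complex.Re (z + w) = complex.Re z + complex.Re w.
Proof. by case: z w => [a b] [c e]. Qed.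

Lemma ImD z w : complex.Im (z + w) = complex.Im z + complex.Im w.
Proof. by case: z w => [a b] [c e]. Qed.

Lemma ReN z : complex.Re (- z) = - complex.Re z.
Proof. by case: z. Qed.

Lemma ImN z : complex.Im (- z) = - complex.Im z.
Proof. by case: z. Qed.

Lemma complex_ext z w : complex.Re z = complex.Re w ->
  complex.Im z = complex.Im w -> z = w.
Proof. by case: z w => [a b] [c e] /= -> ->. Qed.

Lemma Re_half z : complex.Re (z / 2) = complex.Re z / 2.
Proof.
have -> : (2 : R[i])^-1 = (2^-1 : R)%:C%C by rewrite fmorphV/= rmorph_nat.
by rewrite ReM /= mulr0 subr0.
Qed.

Lemma normsqE z : normsq z = complex.Re z ^+ 2 + complex.Im z ^+ 2.
Proof.
by case: z => a b; rewrite /normsq /= sqr_sqrtr// addr_ge0// sqr_ge0.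
Qed.

Lemma normsq_ge0 z : 0 <= normsq z.
Proof. exact: sqr_ge0. Qed.

Lemma normc_ge0 z : 0 <= Normc.normc z.
Proof. by case: z => a b; exact: sqrtr_ge0. Qed.

Lemma normc_real t : Normc.normc t%:C%C = `|t|.
Proof. by rewrite /= expr0n addr0 sqrtr_sqr. Qed.

Lemma normRe_le z : `|complex.Re z| <= Normc.normc z.
Proof.
by rewrite -(ler_pXn2r (ltn0Sn 1)) ?nnegrE ?normc_ge0// real_normK ?num_real//
  -/(normsq z) normsqE lerDl sqr_ge0.
Qed.

Lemma normIm_le z : `|complex.Im z| <= Normc.normc z.
Proof.
by rewrite -(ler_pXn2r (ltn0Sn 1)) ?nnegrE ?normc_ge0// real_normK ?num_real//
  -/(normsq z) normsqE lerDr sqr_ge0.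
Qed.

(** Only an inequality at t = 0, where the convention for purely imaginary s
    gives 0 on the left and 1 on the right. *)
Lemma normc_cpow_le t s : 0 <= t -> Normc.normc (cpow t s) <= t `^ complex.Re s.
Proof.
rewrite le_eqVlt => /orP[/eqP<-|t0].
  rewrite /cpow eqxx; have [->|s0] := eqVneq s 0.
    by rewrite Normc.normc1 powRr0.
  by rewrite Normc.normc0 powR_ge0.
rewrite /cpow gt_eqF// Normc.normcM normc_real /= cos2Dsin2 sqrtr1 mulr1.
by rewrite ger0_norm ?expR_ge0// /powR gt_eqF.
Qed.

Lemma cpow1 s : cpow 1 s = 1.
Proof.
by rewrite /cpow oner_eq0 ln1 !mulr0 expR0 cos0 sin0 mul1r.
Qed.

(** At u = 0 both sides are 1 if s = 0 and 0 otherwise, since then cpow t s = 1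
    in the first case. *)
Lemma cpowM t u s : 0 < t -> 0 <= u -> cpow (t * u) s = cpow t s * cpow u s.
Proof.
move=> t0; rewrite le_eqVlt => /orP[/eqP<-|u0].
  rewrite mulr0 {1 3}/cpow eqxx; have [->|s0] := eqVneq s 0; last by rewrite mulr0.
  by rewrite mulr1 /cpow gt_eqF//= !mul0r expR0 cos0 sin0 mul1r.
rewrite /cpow mulf_eq0 !(gt_eqF t0) (gt_eqF u0) orbF lnM ?posrE// !mulrDr expRD cosD sinD.
by apply: complex_ext; rewrite !(ReM, ImM) /=; ring.
Qed.

Lemma cpow_add t s1 s2 : 0 < t -> cpow t (s1 + s2) = cpow t s1 * cpow t s2.
Proof.
move=> t0; rewrite /cpow gt_eqF// ReD ImD !mulrDl expRD cosD sinD.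
by apply: complex_ext; rewrite !(ReM, ImM) /=; ring.
Qed.

Lemma cpow_sqr t s : 0 < t -> cpow (t ^+ 2) (s / 2) = cpow t s.
Proof.
by move=> t0; rewrite expr2 cpowM ?ltW// -cpow_add// -splitr.
Qed.

Section measurability.
Context d (T : measurableType d) (D : set T).

Lemma cmeasurableM (f g : T -> R[i]) : cmeasurable_fun D f ->
  cmeasurable_fun D g -> cmeasurable_fun D (fun x => f x * g x).
Proof.
move=> [mf1 mf2] [mg1 mg2]; split.
  by under eq_fun do rewrite ReM; apply: measurable_funB; exact: measurable_funM.
by under eq_fun do rewrite ImM; apply: measurable_funD; exact: measurable_funM.
Qed.

Lemma cmeasurableD (f g : T -> R[i]) : cmeasurable_fun D f ->
  cmeasurable_fun D g -> cmeasurable_fun D (fun x => f x + g x).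
Proof.
move=> [mf1 mf2] [mg1 mg2]; split.
  by under eq_fun do rewrite ReD; exact: measurable_funD.
by under eq_fun do rewrite ImD; exact: measurable_funD.
Qed.

Lemma cmeasurable_real (f : T -> R) : measurable_fun D f ->
  cmeasurable_fun D (fun x => (f x)%:C%C).
Proof. by move=> mf; split => //=; exact: measurable_cst. Qed.

Lemma measurable_normsq (f : T -> R[i]) : cmeasurable_fun D f ->
  measurable_fun D (fun x => normsq (f x)).
Proof.
move=> [mf1 mf2]; under eq_fun do rewrite normsqE.
by apply: measurable_funD; exact: measurable_funX.
Qed.

Lemma measurable_normc (f : T -> R[i]) : cmeasurable_fun D f ->
  measurable_fun D (fun x => Normc.normc (f x)).
Proof.
move=> mf; rewrite (_ : (fun x => _) = (fun x => Num.sqrt (normsq (f x)))).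
  apply: measurableT_comp (measurable_normsq mf).
  by apply: continuous_measurable_fun => x; exact: sqrt_continuous.
by apply/funext => x; rewrite /normsq sqrtr_sqr ger0_norm// normc_ge0.
Qed.

End measurability.

Lemma measurable_cpow s : cmeasurable_fun setT (fun t : R => cpow t s).
Proof.
pose c t := (cos (complex.Im s * ln t) +i* sin (complex.Im s * ln t))%C.
have msl (r : R) : measurable_fun setT (fun t : R => r * ln t).
  by apply: measurable_funM; [exact: measurable_cst|exact: measurable_ln].
have mc : cmeasurable_fun setT c.
  split; apply: (measurableT_comp _ (msl _)); apply: continuous_measurable_fun.
    exact: continuous_cos.
  exact: continuous_sin.
have [mp1 mp2] : cmeasurable_fun setT
    (fun t : R => (expR (complex.Re s * ln t))%:C%C * c t).
  apply: cmeasurableM => //; apply: cmeasurable_real.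
  by apply: (measurableT_comp _ (msl _)); exact: measurable_expR.
have m0 : measurable_fun setT (fun t : R => t == 0).
  by apply: measurable_fun_eqr; [exact: measurable_id|exact: measurable_cst].
split.
  rewrite (_ : (fun _ => _) = fun t : R => if t == 0 then complex.Re (s == 0)%:R
    else complex.Re ((expR (complex.Re s * ln t))%:C%C * c t)).
    by apply: measurable_fun_ifT => //; exact: measurable_cst.
  by apply/funext => t; rewrite /cpow; case: ifP.
rewrite (_ : (fun _ => _) = fun t : R => if t == 0 then complex.Im (s == 0)%:R
  else complex.Im ((expR (complex.Re s * ln t))%:C%C * c t)).
  by apply: measurable_fun_ifT => //; exact: measurable_cst.
by apply/funext => t; rewrite /cpow; case: ifP.
Qed.

Lemma cmeasurable_cpow d (T : measurableType d) (D : set T) (f : T -> R) s :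
  measurable_fun D f -> cmeasurable_fun D (fun x => cpow (f x) s).
Proof.
move=> mf; have [m1 m2] := measurable_cpow s.
by split; [exact: (measurableT_comp m1 mf)|exact: (measurableT_comp m2 mf)].
Qed.

End complex_powers.

(** * Domination of the kernel and the Cauchy-Schwarz bound *)

Section domination.
Context {R : realType}.

Definition det_1sqr n (z : 'M[R]_n) : R := \det (1%:M + z *m z).

Lemma measurable_det_1sqr n : measurable_fun setT (@det_1sqr n).
Proof.
by apply: measurable_det; apply: measurable_addmx => //; exact: measurable_mulmx.
Qed.

(** Writing y = v k with v in the Stiefel manifold, both sides scale by (det
    k)^4. *)
Lemma det_kernel_le n d (z : 'M[R]_n) (y : 'M[R]_(n, d)) : z^T = z ->
  z \in unitmx -> full_rank y ->
  (\det z * \det (y^T *m invmx z *m y)) ^+ 2 <=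
  \det (y^T *m y) ^+ 2 * det_1sqr z.
Proof.
move=> sz uz /full_rank_polar[v [k [uk vv ->]]].
have -> : (v *m k)^T *m invmx z *m (v *m k) =
    k^T *m (v^T *m invmx z *m v) *m k by rewrite trmx_mul !mulmxA.
have -> : (v *m k)^T *m (v *m k) = k^T *m k.
  by rewrite trmx_mul mulmxA -(mulmxA k^T) vv mulmx1.
rewrite !det_mulmx !det_tr.
have -> : \det z * (\det k * \det (v^T *m invmx z *m v) * \det k) =
    \det k * \det k * \det (minorproj z v) by rewrite -(det_minorproj vv uz); ring.
rewrite exprMn; apply: ler_wpM2l; first exact: sqr_ge0.
exact: sqr_det_minorproj_le.
Qed.

(** The Cauchy-Schwarz inequality from the family of arithmetic-geometric
    inequalities, by choosing the best t. *)
Lemma le_sqrt_of_mul_le (x N I : R) : 0 <= x -> 0 <= N -> 0 <= I ->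
  (forall t, 0 < t -> x <= t / 2 * N + (2 * t)^-1 * I) -> x ^+ 2 <= N * I.
Proof.
rewrite le_eqVlt => /orP[/eqP<- N0 I0 _|x0]; first by rewrite expr0n mulr_ge0.
rewrite le_eqVlt => /orP[/eqP<-|N0] I0 h.
  have I1 : 0 < I + 1 by lra.
  have := h _ (divr_gt0 I1 x0).
  have -> : (I + 1) / x / 2 * 0 + (2 * ((I + 1) / x))^-1 * I =
      x * (I / (2 * (I + 1))) by field; rewrite !gt_eqF.
  move=> h'; have : 1 <= I / (2 * (I + 1)) by rewrite -(ler_pM2l x0) mulr1.
  by rewrite ler_pdivlMr ?mulr_gt0// mul1r; lra.
have := h _ (divr_gt0 x0 N0).
have -> : x / N / 2 * N + (2 * (x / N))^-1 * I = x / 2 + N * I / (2 * x).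
  by field; rewrite !gt_eqF.
rewrite -lerBlDl => h'; have {h'} : x / 2 <= N * I / (2 * x) by lra.
rewrite ler_pdivlMr ?mulr_gt0// expr2.
by have -> : x / 2 * (2 * x) = x * x by field.
Qed.

Context {n d p q : nat} (nu mu : R[i]).
Local Notation nu0 := (complex.Re nu).
Local Notation mu0 := (complex.Re mu).
Hypotheses (pqn : (p + q = n)%N) (numu : n.+1%:R <= nu0 + mu0) (mu_le0 : mu0 <= 0).

Lemma measurable_integrandP (alpha beta : R[i]) (f : 'M[R]_n -> R[i]) (y : 'M[R]_(n, d)) :
  cmeasurable_fun (Omega p q) f ->
  cmeasurable_fun (Omega p q) (integrandP alpha beta f y).
Proof.
move=> mf; have mO := @measurable_Omega R _ _ _ pqn.
have mid : measurable_fun (@Omega R n p q) id by [].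
have mz : measurable_fun (@Omega R n p q) (fun z => `|\det z|).
  by apply: measurableT_comp; [exact: normr_measurable|exact: measurable_det].
apply: cmeasurableM; last first.
  by apply: cmeasurable_real; exact: measurable_powRr_comp.
apply: cmeasurableM => //; apply: cmeasurableM; first exact: cmeasurable_cpow.
apply: cmeasurable_cpow; apply: measurableT_comp; first exact: normr_measurable.
apply: measurable_det; apply: measurable_mulmx => //; apply: measurable_mulmx => //.
by apply: measurable_invmx => // z Oz; exact: Omega_unitmx Oz.
Qed.

(** The dominating function: its integral bounds the transform at every point
    of the Stiefel manifold. *)
Definition weighted (f : 'M[R]_n -> R[i]) (z : 'M[R]_n) : R :=
  Normc.normc (f z) * det_1sqr z `^ ((nu0 - n.+1%:R) / 4).

Lemma weighted_ge0 f z : 0 <= weighted f z.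
Proof. by rewrite mulr_ge0 ?normc_ge0 ?powR_ge0. Qed.

(** The powers of |det z| and |det(y^T z^-1 y)| regroup as nonnegative powers
    of |det z| and of their product, each at most a multiple of det(1 +
    z^2)^(1/2). *)
Lemma kernel_le (z : 'M[R]_n) (y : 'M[R]_(n, d)) : Omega p q z -> full_rank y ->
  Normc.normc (kernelK (nu / 2) (- mu / 2) z y) * `|\det z| `^ (- (n.+1%:R / 2))
  <= \det (y^T *m y) `^ (- mu0 / 2) * det_1sqr z `^ ((nu0 - n.+1%:R) / 4).
Proof.
move=> Oz fy; have sz := Omega_sym Oz; have uz := Omega_unitmx pqn Oz.
set a : R := `|\det z|; set b : R := `|\det (y^T *m invmx z *m y)|.
set D := det_1sqr z; set g := \det (y^T *m y).
have a0 : 0 < a by rewrite normr_gt0 -unitfE -unitmxE.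
have b0 : 0 <= b by rewrite normr_ge0.
have D1 : 1 <= D by exact: det_1sqr_ge1.
have D0 : 0 < D by lra.
have g0 : 0 < g by exact: full_rank_det_gt0.
have aD : a <= D `^ 2^-1.
  rewrite powR12_sqrt ?(ltW D0)// -ler_sqr ?nnegrE ?sqrtr_ge0 ?(ltW a0)//.
  by rewrite sqr_sqrtr ?(ltW D0)// real_normK ?num_real// sqr_det_le.
have abD : a * b <= g * D `^ 2^-1.
  rewrite powR12_sqrt ?(ltW D0)// -ler_sqr ?nnegrE; last 2 first.
  - by rewrite mulr_ge0 ?(ltW a0).
  - by rewrite mulr_ge0 ?sqrtr_ge0 ?(ltW g0).
  rewrite [X in _ <= X]exprMn sqr_sqrtr ?(ltW D0)// -normrM real_normK ?num_real//.
  exact: det_kernel_le.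
set B : R := - mu0 / 2; set A : R := (nu0 + mu0 - n.+1%:R) / 2.
have B0 : 0 <= B by rewrite divr_ge0 ?oppr_ge0.
have A0 : 0 <= A by rewrite divr_ge0 ?subr_ge0.
rewrite /kernelK Normc.normcM.
have -> : (nu0 - n.+1%:R) / 4 = 2^-1 * A + 2^-1 * B by rewrite /A /B; field.
rewrite powRD ?(gt_eqF D0) ?implybT// mulrCA (powRrM D _ A) (powRrM D _ B) -powRM ?powR_ge0 ?(ltW g0)//.
apply: (@le_trans _ _ (a `^ A * (a * b) `^ B)); last first.
  have ab0 : 0 <= a * b by rewrite mulr_ge0 ?(ltW a0).
  apply: ler_pM; rewrite ?powR_ge0//; apply: ge0_ler_powR; rewrite // nnegrE.
  - exact: ltW.
  - exact: powR_ge0.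
  - by rewrite mulr_ge0 ?powR_ge0 ?(ltW g0).
rewrite powRM ?(ltW a0)// mulrA -powRD ?(gt_eqF a0) ?implybT//.
have -> : A + B = nu0 / 2 + - (n.+1%:R / 2) by rewrite /A /B; field.
rewrite powRD ?(gt_eqF a0) ?implybT// [leRHS]mulrAC; apply: ler_wpM2r; first exact: powR_ge0.
apply: ler_pM; rewrite ?normc_ge0//.
  by apply: (le_trans (normc_cpow_le _ (ltW a0))); rewrite Re_half.
by apply: (le_trans (normc_cpow_le _ b0)); rewrite Re_half ReN.
Qed.

Lemma integrandP_le f (z : 'M[R]_n) (y : 'M[R]_(n, d)) : Omega p q z -> full_rank y ->
  Normc.normc (integrandP (nu / 2) (- mu / 2) f y z) <=
  \det (y^T *m y) `^ (- mu0 / 2) * weighted f z.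
Proof.
move=> Oz fy; rewrite !Normc.normcM normc_real (ger0_norm (powR_ge0 _ _)).
rewrite /weighted [leRHS]mulrCA -(mulrA (Normc.normc (f z))).
apply: ler_wpM2l; first exact: normc_ge0.
by rewrite -Normc.normcM; exact: kernel_le.
Qed.

Definition siegel_const : R :=
  fine (\int[@lebesgue_sym R n]_z siegel_integrand (n.+1%:R / 2) z).

Lemma siegel_constE :
  (\int[@lebesgue_sym R n]_z siegel_integrand (n.+1%:R / 2) z = siegel_const%:E)%E.
Proof.
rewrite fineK// ge0_fin_numE; last first.
  by apply: integral_ge0 => z _; exact: siegel_integrand_ge0.
rewrite lebesgue_sym_integral; first exact: siegel_integral_finite.
  exact: measurable_siegel_integrand.
by move=> z; exact: siegel_integrand_ge0.
Qed.

Lemma siegel_const_ge0 : 0 <= siegel_const.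
Proof.
by apply: fine_ge0; apply: integral_ge0 => z _; exact: siegel_integrand_ge0.
Qed.

(** The two terms are, up to t, the density of the norm of f and det(1 +
    z^2)^(-nu0/2), whose product is the square of the left-hand side; nu0 >=
    n+1 is used to enlarge the second. *)
Lemma weighted_le f (z : 'M[R]_n) t : Omega p q z -> 0 < t ->
  weighted f z <= t / 2 * (normsq (f z) * det_1sqr z `^ (nu0 - n.+1%:R / 2)) +
    (2 * t)^-1 * det_1sqr z `^ (- (n.+1%:R / 2)).
Proof.
move=> Oz t0; have sz := Omega_sym Oz.
set D := det_1sqr z; have D1 : 1 <= D by exact: det_1sqr_ge1.
have D0 : 0 < D by lra.
apply: (@le_trans _ _ (t / 2 * (normsq (f z) * D `^ (nu0 - n.+1%:R / 2)) +
    (2 * t)^-1 * D `^ (- nu0 / 2))); last first.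
  rewrite lerD2l; apply: ler_wpM2l; first by rewrite invr_ge0 mulr_ge0 ?ltW.
  apply: ler_powR => //; rewrite mulNr lerN2 ler_pM2r ?invr_gt0//.
  by apply: le_trans numu _; rewrite gerDl.
set u := D `^ ((nu0 - n.+1%:R / 2) / 2); set v := D `^ (- nu0 / 4).
have -> : D `^ (nu0 - n.+1%:R / 2) = u ^+ 2.
  by rewrite expr2 -powRD ?(gt_eqF D0) ?implybT//; congr (_ `^ _); field.
have -> : D `^ (- nu0 / 2) = v ^+ 2.
  by rewrite expr2 -powRD ?(gt_eqF D0) ?implybT//; congr (_ `^ _); field.
have -> : weighted f z = Normc.normc (f z) * (u * v).
  by rewrite -powRD ?(gt_eqF D0) ?implybT//; congr (_ * _ `^ _); field.
rewrite /normsq -subr_ge0; set c := Normc.normc _.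
have -> : t / 2 * (c ^+ 2 * u ^+ 2) + (2 * t)^-1 * v ^+ 2 - c * (u * v) =
    (2 * t)^-1 * (t * c * u - v) ^+ 2 by field; rewrite gt_eqF.
by rewrite mulr_ge0 ?sqr_ge0// invr_ge0 mulr_ge0 ?ltW.
Qed.

Section on_HG.
Context (f : 'M[R]_n -> R[i]) (Hf : HG nu0 p q f).

Lemma HG_normsq_ge0 : (0 <= HG_normsq nu0 p q f)%E.
Proof. by apply: integral_ge0 => z _; rewrite lee_fin mulr_ge0 ?normsq_ge0 ?powR_ge0. Qed.

Definition HG_norm2 : R := fine (HG_normsq nu0 p q f).

Lemma HG_norm2E : HG_normsq nu0 p q f = HG_norm2%:E.
Proof. by rewrite fineK// ge0_fin_numE ?HG_normsq_ge0//; case: Hf. Qed.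

Lemma measurable_weighted : measurable_fun (Omega p q) (weighted f).
Proof.
have [mf _] := Hf; apply: measurable_funM; first exact: measurable_normc.
apply: measurable_powRr_comp; apply: measurable_funTS; exact: measurable_det_1sqr.
Qed.

Lemma integral_weighted_le t : 0 < t ->
  (\int[lebesgue_sym]_(z in Omega p q) (weighted f z)%:E <=
   (t / 2 * HG_norm2 + (2 * t)^-1 * siegel_const)%:E)%E.
Proof.
move=> t0; have mO := @measurable_Omega R _ _ _ pqn; have [mf _] := Hf.
have mD s : measurable_fun (Omega p q) (fun z : 'M[R]_n => det_1sqr z `^ s).
  by apply: measurable_powRr_comp; apply: measurable_funTS; exact: measurable_det_1sqr.
have mU : measurable_fun (Omega p q)
    (fun z => normsq (f z) * det_1sqr z `^ (nu0 - n.+1%:R / 2)).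
  by apply: measurable_funM; [exact: measurable_normsq|exact: mD].
have t2 : 0 <= t / 2 by lra.
have t3 : 0 <= (2 * t)^-1 by rewrite invr_ge0 mulr_ge0 ?ltW.
apply: (@le_trans _ _ (\int[lebesgue_sym]_(z in Omega p q)
   ((t / 2)%:E * (normsq (f z) * det_1sqr z `^ (nu0 - n.+1%:R / 2))%:E +
    (2 * t)^-1%:E * siegel_integrand (n.+1%:R / 2) z))%E).
  apply: ge0_le_integral => //.
  - by move=> z _; rewrite lee_fin weighted_ge0.
  - by apply/measurable_EFinP; exact: measurable_weighted.
  - apply: emeasurable_funD; apply: emeasurable_funM => //; try exact: measurable_cst.
      exact/measurable_EFinP.
    by apply/measurable_EFinP; exact: mD.
  - by move=> z Oz; rewrite -!EFinM -EFinD lee_fin; exact: weighted_le.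
rewrite ge0_integralD//; last 4 first.
- move=> z _; apply: mule_ge0; first by rewrite lee_fin.
  by rewrite lee_fin; apply: mulr_ge0; [exact: normsq_ge0|exact: powR_ge0].
- by apply: emeasurable_funM => //; exact/measurable_EFinP.
- move=> z _; apply: mule_ge0; first by rewrite lee_fin.
  exact: siegel_integrand_ge0.
- by apply: emeasurable_funM => //; apply/measurable_EFinP; exact: mD.
rewrite ge0_integralZl_EFin//; last 2 first.
- by move=> z _; rewrite lee_fin mulr_ge0 ?normsq_ge0 ?powR_ge0.
- exact/measurable_EFinP.
rewrite ge0_integralZl_EFin//; last 2 first.
- by move=> z _; exact: siegel_integrand_ge0.
- by apply/measurable_EFinP; exact: mD.
rewrite -[X in ((t / 2)%:E * X + _)%E]/(HG_normsq nu0 p q f) HG_norm2E.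
rewrite EFinD !EFinM; apply: leeD => //.
apply: lee_wpmul2l => //; rewrite -siegel_constE.
apply: ge0_subset_integral => //; first exact: measurable_siegel_integrand.
by move=> z _; exact: siegel_integrand_ge0.
Qed.

Lemma integrable_weighted : lebesgue_sym.-integrable (Omega p q) (EFin \o weighted f).
Proof.
apply/integrableP; split; first by apply/measurable_EFinP; exact: measurable_weighted.
rewrite (@eq_integral _ _ _ _ _ (EFin \o weighted f)); last first.
  by move=> z _; rewrite abse_EFin ger0_norm// weighted_ge0.
exact: (le_lt_trans (integral_weighted_le ltr01)) (ltry _).
Qed.

Lemma sqr_Rintegral_weighted_le :
  Rintegral lebesgue_sym (Omega p q) (weighted f) ^+ 2 <= HG_norm2 * siegel_const.
Proof.
apply: le_sqrt_of_mul_le.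
- by apply: Rintegral_ge0 => z _; exact: weighted_ge0.
- by apply: fine_ge0; exact: HG_normsq_ge0.
- exact: siegel_const_ge0.
move=> t t0; rewrite -lee_fin fineK; first exact: integral_weighted_le.
exact: (integrable_fin_num (measurable_Omega pqn) integrable_weighted).
Qed.

Lemma integrable_integrandP (y : 'M[R]_(n, d)) : full_rank y ->
  cintegrable lebesgue_sym (Omega p q) (integrandP (nu / 2) (- mu / 2) f y).
Proof.
move=> fy; have mO := @measurable_Omega R _ _ _ pqn; have [mf _] := Hf.
have [m1 m2] := measurable_integrandP (nu / 2) (- mu / 2) y mf.
have iG : lebesgue_sym.-integrable (Omega p q)
   (fun z => (\det (y^T *m y) `^ (- mu0 / 2))%:E * (EFin \o weighted f) z)%E.
  by apply: integrableZl => //; exact: integrable_weighted.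
have le z (Oz : Omega p q z) := integrandP_le f Oz fy.
have G0 z : 0 <= \det (y^T *m y) `^ (- mu0 / 2) * weighted f z.
  by rewrite mulr_ge0 ?powR_ge0 ?weighted_ge0.
split; apply: (le_integrable mO _ _ iG) => //; try exact/measurable_EFinP.
  move=> z Oz; rewrite -EFinM !abse_EFin lee_fin (ger0_norm (G0 z)).
  exact: le_trans (normRe_le _) (le z Oz).
move=> z Oz; rewrite -EFinM !abse_EFin lee_fin (ger0_norm (G0 z)).
exact: le_trans (normIm_le _) (le z Oz).
Qed.

(** The factor 2 comes from bounding the real and imaginary parts separately. *)
Lemma normsq_opP_le (y : 'M[R]_(n, d)) : Stiefel y ->
  normsq (opP (nu / 2) (- mu / 2) p q f y) <= 2 * siegel_const * HG_norm2.
Proof.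
move=> Sy; have fy : full_rank y := stiefel_full_rank Sy.
have mO := @measurable_Omega R _ _ _ pqn.
have [i1 i2] := integrable_integrandP fy.
have iw := integrable_weighted.
have le z (Oz : Omega p q z) := integrandP_le f Oz fy.
have W := sqr_Rintegral_weighted_le.
rewrite Sy det1 in le.
have one : (1 : R) `^ (- mu0 / 2) = 1 by rewrite powR1.
have bound (g : 'M[R]_n -> R) : lebesgue_sym.-integrable (Omega p q) (EFin \o g) ->
    (forall z, Omega p q z -> `|g z| <= weighted f z) ->
    Rintegral lebesgue_sym (Omega p q) g ^+ 2 <= HG_norm2 * siegel_const.
  move=> ig gw; apply: le_trans W; rewrite -(real_normK (num_real (Rintegral _ _ _))).
  rewrite ler_pXn2r ?nnegrE//; last by apply: Rintegral_ge0 => z _; exact: weighted_ge0.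
  apply: (le_trans (le_normr_Rintegral mO ig)).
  apply: le_Rintegral => //.
  exact: integrable_norm.
rewrite normsqE /=.
have := bound _ i1 _; have := bound _ i2 _; move=> h2 h1.
have {}h1 := h1 _; have {}h2 := h2 _.
rewrite -mulrA mulr2n mulrDl mul1r [siegel_const * _]mulrC; apply: lerD.
  apply: h1 => z Oz; apply: (le_trans (normRe_le _)); have := le z Oz.
  by rewrite one mul1r.
apply: h2 => z Oz; apply: (le_trans (normIm_le _)); have := le z Oz.
by rewrite one mul1r.
Qed.

End on_HG.
End domination.

(** * The zero set of the kernel determinant *)

Section null_set.
Context {R : realType} {n d : nat}.

Lemma measurable_minorproj (y : 'M[R]_(n, d)) :
  measurable_fun setT (fun z : 'M[R]_n => \det (minorproj z y)).
Proof.
apply: measurable_det; apply: measurable_addmx => //.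
by apply: measurable_mulmx.
Qed.

Lemma finite_root (r : {poly R}) : r != 0 -> finite_set [set x | root r x].
Proof.
elim: (size r) {-2}r (leqnn (size r)) => [|k IH] {}r sr r0.
  by move: sr; rewrite leqn0 size_poly_eq0 (negbTE r0).
have [[x rx]|no] := pselect (exists x, root r x); last first.
  by rewrite (_ : [set x | _] = set0)// -subset0 => x rx; apply: no; exists x.
have /factor_theorem[s sE] := rx.
have s0 : s != 0 by apply: contraNneq r0 => s0; rewrite sE s0 mul0r.
apply: (@sub_finite_set _ _ ([set x] `|` [set x | root s x])).
  move=> u /=; rewrite sE rootM root_XsubC => /orP[ru|/eqP->]; [by right|by left].
rewrite finite_setU; split=> //; apply: IH => //.
by move: sr; rewrite sE size_Mmonic ?monicXsubC// size_XsubC addn2.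
Qed.

Local Open Scope ereal_scope.

(** Translate by t times the identity, which preserves the measure, and
    integrate over all t in R. Exchanging the integrals gives 0, because each
    line meets the set in finitely many points; so the measure times the length
    of R is 0. *)
Lemma minorproj_null (y : 'M[R]_(n, d)) : (y^T *m y)%R = 1%:M%R ->
  lebesgue_sym [set z : 'M[R]_n | \det (minorproj z y) = 0%R] = 0.
Proof.
move=> yy; set M := [set z | _].
have mM : measurable M.
  rewrite -[M]setTI.
  rewrite (_ : M = (fun z : 'M[R]_n => \det (minorproj z y)) @^-1` [set 0%R])//.
  exact: measurable_minorproj.
have mI : measurable_fun setT (EFin \o (\1_M : 'M[R]_n -> R)).
  by apply/measurable_EFinP; exact: measurable_indic.
have I0 (z : 'M[R]_n) : 0 <= (EFin \o (\1_M : 'M[R]_n -> R)) z by rewrite lee_fin.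
rewrite -(setIT M) -integral_indic// lebesgue_sym_integral//.
set I := \int[sym_measure n]_z _.
have Ige0 : 0 <= I by exact: integral_ge0.
(* Every translate by t has the same integral I. *)
have tr (t : R) : \int[sym_measure n]_z (EFin \o (\1_M : 'M[R]_n -> R)) (z + t%:M)%R = I.
  by rewrite -(@sym_measure_translation R n t%:M) ?tr_scalar_mx.
have mf : measurable_fun setT
   (fun x : R * 'M[R]_n => (EFin \o (\1_M : 'M[R]_n -> R)) (x.2 + x.1%:M)%R).
  apply: (measurableT_comp mI); apply: measurable_addmx => //.
  exact: measurable_scalar_mx.
have := @fubini_tonelli _ _ _ _ _ lebesgue_measure (sym_measure n) _ mf (fun x => I0 _).
rewrite /=; under eq_integral do rewrite tr.
rewrite integral_cst//.
have -> : \int[sym_measure n]_z \int[lebesgue_measure]_t (\1_M (z + t%:M)%R)%:E = 0.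
  rewrite integral0_eq// => z _.
  have mA : measurable [set t : R | M (z + t%:M)%R].
    rewrite -[X in measurable X]setTI.
    have mfz : measurable_fun setT (fun t : R => (z + t%:M)%R).
      by apply: measurable_addmx => //; exact: measurable_scalar_mx.
    exact: mfz.
  rewrite (_ : (fun t => _) = (fun t => (\1_[set t : R | M (z + t%:M)%R] t)%:E)).
    rewrite integral_indic// setIT; apply: countable_lebesgue_measure0.
    apply: finite_set_countable.
    apply: (@sub_finite_set _ _ ([set 0%R] `|`
      [set t | root (char_poly (z *m (1%:M - y *m y^T))%R) (- t)%R])).
      move=> t Mt; have [->|t0] := eqVneq t 0%R; first by left.
      by right; exact: (minorproj_shift yy t0).
    rewrite finite_setU; split=> //.
    rewrite (_ : [set t | _] = -%R @^-1` [set x |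
      root (char_poly (z *m (1%:M - y *m y^T))%R) x])//.
    apply: finite_preimage; first by move=> a b _ _; exact: oppr_inj.
    by apply: finite_root; rewrite monic_neq0// char_poly_monic.
  by apply/funext => t; rewrite !indicE; congr (_%:R%:E); apply/idP/idP; rewrite !inE.
move=> h; have {}h : I * lebesgue_measure [set: R] = 0 by exact: h.
have LT : lebesgue_measure [set: R] = +oo.
  by rewrite -set_itvNyy lebesgue_measure_itv/=.
move: Ige0 h; rewrite LT le_eqVlt => /orP[/eqP<-//|Igt0].
by rewrite gt0_muley.
Qed.

End null_set.

(** * Limits of matrix expressions *)

Section continuity_tools.
Context {R : realType}.

Lemma cvg_trmx T (F : set_system T) {FF : Filter F} m n
    (f : T -> 'M[R]_(m, n)) (M : 'M[R]_(m, n)) :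
  f @ F --> M -> (fun x => (f x)^T) @ F --> M^T.
Proof.
apply: (@cvg_select R _ _ FF _ _ _ _ f M (@trmx R m n)) => i j.
by exists j, i => w; rewrite mxE.
Qed.

Lemma cvg_det T (F : set_system T) {FF : Filter F} n (f : T -> 'M[R]_n) (M : 'M[R]_n) :
  f @ F --> M -> (fun x => \det (f x)) @ F --> \det M.
Proof.
move=> fM; apply: cvg_big => [|s _]; first exact: add_continuous.
apply: cvgM; first exact: cvg_cst.
apply: cvg_big => [|k _]; first exact: mul_continuous.
exact: cvg_entry.
Qed.

Lemma cvg_cpow T (F : set_system T) {FF : Filter F} (f : T -> R) (t : R) (s : R[i]) :
  0 < t -> f @ F --> t ->
  (fun x => complex.Re (cpow (f x) s)) @ F --> complex.Re (cpow t s) /\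
  (fun x => complex.Im (cpow (f x) s)) @ F --> complex.Im (cpow t s).
Proof.
move=> t0 ft.
pose m u := expR (complex.Re s * ln u); pose c u := cos (complex.Im s * ln u).
pose e u := sin (complex.Im s * ln u).
have RE u : 0 < u -> complex.Re (cpow u s) = m u * c u.
  by move=> u0; rewrite /cpow gt_eqF// ReM /= mul0r subr0.
have IE u : 0 < u -> complex.Im (cpow u s) = m u * e u.
  by move=> u0; rewrite /cpow gt_eqF// ImM /= mul0r addr0.
have fl r : (fun x => r * ln (f x)) @ F --> r * ln t.
  apply: cvgM; first exact: cvg_cst.
  by apply: (cvg_comp _ _ ft); exact: continuous_ln.
have fm : (fun x => m (f x)) @ F --> m t.
  by apply: (cvg_comp _ _ (fl _)); exact: continuous_expR.
have fpos : \forall x \near F, 0 < f x by have := ft _ (lt_nbhsr t0).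
split.
  rewrite RE//; apply: cvg_trans (cvgM fm (_ : (fun x => c (f x)) @ F --> c t)).
    apply: near_eq_cvg; near=> x; rewrite RE//; near: x; exact: fpos.
  by apply: (cvg_comp _ _ (fl _)); exact: continuous_cos.
rewrite IE//; apply: cvg_trans (cvgM fm (_ : (fun x => e (f x)) @ F --> e t)).
  apply: near_eq_cvg; near=> x; rewrite IE//; near: x; exact: fpos.
by apply: (cvg_comp _ _ (fl _)); exact: continuous_sin.
Unshelve. all: by end_near. Qed.

(** Dominated convergence is about sequences, and the dominating function
    exists only for y in a neighbourhood U, so continuity is tested on
    sequences in U. *)
Lemma sequential_continuous (V : pseudoMetricType R) (g : V -> R) (y0 : V) (U : set V) :
  nbhs y0 U ->
  (forall u : nat -> V, (forall k, U (u k)) -> u @ \oo --> y0 ->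
     (fun k => g (u k)) @ \oo --> g y0) ->
  {for y0, continuous g}.
Proof.
move=> yU h; apply/cvg_ballP => eps e0; apply: contrapT => no.
have ex k : exists y, [/\ U y, ball y0 k.+1%:R^-1 y & ~ ball (g y0) eps (g y)].
  apply: contrapT => nex; apply: no.
  have b0 : nbhs y0 (ball y0 (k.+1%:R^-1 : R)) by apply: near_ball; rewrite invr_gt0.
  near=> y; apply: contrapT => nb; apply: nex; exists y; split => //.
    by near: y.
  by near: y.
have [u /all_and3[uU ub un]] := choice ex.
have uy : u @ \oo --> y0.
  apply/cvg_ballP => r r0; near=> k; apply: le_ball (ub k).
  by apply/ltW; near: k; exact: near_infty_natSinv_lt (PosNum r0).
have /cvg_ballP/(_ _ e0) := h u uU uy.
by move=> /filter_ex[k]; exact: un.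
Unshelve. all: by end_near. Qed.

Lemma cvg_gram_det n d T (F : set_system T) {FF : Filter F} (A : 'M[R]_n)
    (f : T -> 'M[R]_(n, d)) (M : 'M[R]_(n, d)) : f @ F --> M ->
  (fun x => \det ((f x)^T *m A *m f x)) @ F --> \det (M^T *m A *m M).
Proof.
move=> fM; apply: cvg_det; apply: cvg_mulmx => //; apply: cvg_mulmx; last exact: cvg_cst.
exact: cvg_trmx.
Qed.

Lemma full_rank_near n d (y : 'M[R]_(n, d)) C : full_rank y -> \det (y^T *m y) < C ->
  \forall w \near y, full_rank w /\ \det (w^T *m w) < C.
Proof.
move=> fy yC.
have c : (fun w : 'M[R]_(n, d) => \det (w^T *m w)) @ y --> \det (y^T *m y).
  have := @cvg_gram_det n d _ (nbhs y) (nbhs_filter y) 1%:M id y cvg_id.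
  by rewrite mulmx1; under eq_fun do rewrite mulmx1.
have y0 := full_rank_det_gt0 fy.
near=> w; split; last by near: w; exact: (c _ (lt_nbhsl yC)).
apply/full_rankE; rewrite gt_eqF//; near: w; exact: (c _ (lt_nbhsr y0)).
Unshelve. all: by end_near. Qed.

Lemma open_full_rank n d : open (@full_rank R n d).
Proof.
rewrite openE => y fy.
have := full_rank_near fy (_ : \det (y^T *m y) < \det (y^T *m y) + 1).
by rewrite ltrDl => /(_ ltr01); apply: (@filterS _ _ (nbhs_filter y)) => w [].
Qed.

End continuity_tools.

(** * Continuity of the transform *)

Section opP_continuity.
Context {R : realType} {n d p q : nat} (nu mu : R[i]).
Local Notation nu0 := (complex.Re nu).
Local Notation mu0 := (complex.Re mu).
Hypotheses (pqn : (p + q = n)%N) (numu : n.+1%:R <= nu0 + mu0) (mu_le0 : mu0 <= 0).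

Lemma kernel_det_neq0_ae (y : 'M[R]_(n, d)) : full_rank y ->
  {ae lebesgue_sym, forall z, Omega p q z -> \det (y^T *m invmx z *m y) != 0}.
Proof.
move=> /full_rank_polar[v [k [uk vv yE]]].
have N : lebesgue_sym.-negligible [set z : 'M[R]_n | \det (minorproj z v) = 0].
  apply/negligibleP; last exact: minorproj_null.
  rewrite -[X in measurable X]setTI.
  by have := measurable_minorproj v measurableT (measurable_set1 0).
apply: negligibleS N => z /= nz; apply: contrapT => dz; apply: nz => Oz.
apply/eqP => d0; apply: dz; rewrite -(det_minorproj vv (Omega_unitmx pqn Oz)).
have : \det (y^T *m invmx z *m y) = \det k ^+ 2 * \det (v^T *m invmx z *m v).
  rewrite yE trmx_mul.
  have -> : k^T *m v^T *m invmx z *m (v *m k) = k^T *m (v^T *m invmx z *m v) *m k.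
    by rewrite !mulmxA.
  by rewrite !det_mulmx det_tr; ring.
rewrite d0 => /esym/eqP; rewrite mulf_eq0 expf_eq0/=.
by move: uk; rewrite unitmxE unitfE => /negbTE-> /= /eqP->; rewrite mulr0.
Qed.

Context (f : 'M[R]_n -> R[i]) (Hf : HG nu0 p q f).
Local Notation K := (integrandP (nu / 2) (- mu / 2) f).

(** Dominated convergence along sequences with bounded Gram determinant; h is
    the real or the imaginary part. *)
Lemma opP_continuous_part (h : R[i] -> R) (y : 'M[R]_(n, d)) :
  h = @complex.Re R \/ h = @complex.Im R -> full_rank y ->
  {for y, continuous (fun w => Rintegral lebesgue_sym (Omega p q) (fun z => h (K w z)))}.
Proof.
move=> hE fy; have mO := @measurable_Omega R _ _ _ pqn; have [mf _] := Hf.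
have y0 := full_rank_det_gt0 fy.
pose C := \det (y^T *m y) + 1.
have C0 : 0 <= C by rewrite addr_ge0 ?ltW.
have yC : \det (y^T *m y) < C by rewrite /C ltrDl.
have mK (w : 'M[R]_(n, d)) : measurable_fun (Omega p q) (EFin \o (fun z => h (K w z))).
  have [m1 m2] := measurable_integrandP pqn (nu / 2) (- mu / 2) w mf.
  by apply/measurable_EFinP; case: hE => ->.
apply: (sequential_continuous (full_rank_near fy yC)) => u uU uy.
pose G (z : 'M[R]_n) : \bar R := ((C `^ (- mu0 / 2))%:E * (EFin \o weighted nu f) z)%E.
have iG : lebesgue_sym.-integrable (Omega p q) G.
  by apply: integrableZl => //; exact: (integrable_weighted pqn numu mu_le0 Hf).
have [|||||_ _] := @dominated_convergence _ _ _ lebesgue_sym (Omega p q) mO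
    (fun k => EFin \o (fun z => h (K (u k) z))) (EFin \o (fun z => h (K y z))) G.
- by move=> k; exact: mK.
- exact: mK.
- have := kernel_det_neq0_ae fy; apply: filterS => z nz Oz.
  apply/cvg_EFin; first by near=> k.
  rewrite /comp/=.
  have t0 : 0 < `|\det (y^T *m invmx z *m y)| by rewrite normr_gt0 nz.
  have tk : (fun k => `|\det ((u k)^T *m invmx z *m u k)|) @ \oo -->
      `|\det (y^T *m invmx z *m y)|.
    by apply: cvg_norm; exact: cvg_gram_det.
  have [cR cI] := cvg_cpow (- mu / 2) t0 tk.
  pose A := f z * cpow `|\det z| (nu / 2) * (`|\det z| `^ (- (n.+1%:R / 2)))%:C%C.
  have KE w : K w z = A * cpow `|\det (w^T *m invmx z *m w)| (- mu / 2).
    by rewrite /integrandP /kernelK /A; ring.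
  rewrite KE; under eq_fun do rewrite KE.
  case: hE => ->.
    rewrite ReM; under eq_fun do rewrite ReM.
    by apply: cvgB; apply: cvgM => //; exact: cvg_cst.
  rewrite ImM; under eq_fun do rewrite ImM.
  by apply: cvgD; apply: cvgM => //; exact: cvg_cst.
- exact: iG.
- apply: aeW => z k Oz; have [fk dk] := uU k.
  rewrite /comp abse_EFin /G /= -EFinM lee_fin.
  apply: (@le_trans _ _ (Normc.normc (K (u k) z))).
    by case: hE => ->; [exact: normRe_le|exact: normIm_le].
  apply: (le_trans (integrandP_le pqn numu mu_le0 f Oz fk)).
  apply: ler_wpM2r; first exact: weighted_ge0.
  apply: ge0_ler_powR; first by rewrite divr_ge0 ?oppr_ge0.
  - by rewrite nnegrE ltW ?full_rank_det_gt0.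
  - by rewrite nnegrE.
  - exact: ltW.
move=> cv; rewrite /Rintegral; apply: fine_cvg; rewrite fineK//.
apply: integrable_fin_num => //.
have [i1 i2] := integrable_integrandP pqn numu mu_le0 Hf fy.
by case: hE => ->.
Unshelve. all: by end_near. Qed.

End opP_continuity.

Lemma measurable_continuous_on (R : realType) (m d : nat) (U : set 'M[R]_(m, d)) (g : 'M[R]_(m, d) -> R) :
  open U -> (forall y, U y -> {for y, continuous g}) -> measurable_fun U g.
Proof.
move=> oU cg; apply: (measurability _ (RGenOpens.measurableE R)) => // _ [_ [a [b ->] <-]].
apply: mx_open_measurable; rewrite openE => y [Uy gy].
have := cg y Uy _ (open_nbhs_nbhs (conj (@interval_open _ (BRight a) (BLeft b) isT isT) gy)).
exact: (@filterI _ _ (nbhs_filter y) _ _ (open_nbhs_nbhs (conj oU Uy))).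
Qed.


(** * Linearity, equivariance and intertwining *)

Section complex_integral.
Context {R : realType} d (T : measurableType d) (m : {measure set T -> \bar R}) (D : set T).
Hypothesis mD : measurable D.
Implicit Types f g : T -> R[i].

Lemma eq_cintegral f g : (forall x, D x -> f x = g x) -> cintegral m D f = cintegral m D g.
Proof.
move=> fg; congr (_ +i* _)%C; apply: eq_Rintegral => x; rewrite inE => Dx;
by rewrite fg.
Qed.

Lemma cintegralD f g : cintegrable m D f -> cintegrable m D g ->
  cintegral m D (fun x => f x + g x) = cintegral m D f + cintegral m D g.
Proof.
move=> [f1 f2] [g1 g2]; apply: complex_ext; rewrite ?ReD ?ImD /=.
  by rewrite -RintegralD//; apply: eq_Rintegral => x _; rewrite ReD.
by rewrite -RintegralD//; apply: eq_Rintegral => x _; rewrite ImD.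
Qed.

Lemma cintegralZl (c : R[i]) f : cintegrable m D f ->
  cintegral m D (fun x => c * f x) = c * cintegral m D f.
Proof.
move=> [f1 f2]; have iZ (r : R) h : m.-integrable D (EFin \o h) ->
    m.-integrable D (EFin \o (fun x => r * h x)).
  by move=> ih; exact: (integrableZl mD r ih).
apply: complex_ext; rewrite ?ReM ?ImM /=.
  rewrite -!RintegralZl// -RintegralB//; try exact: iZ.
  by apply: eq_Rintegral => x _; rewrite ReM.
rewrite -!RintegralZl// -RintegralD//; try exact: iZ.
by apply: eq_Rintegral => x _; rewrite ImM.
Qed.

Lemma cintegral_ae_eq f g : cmeasurable_fun D f -> cmeasurable_fun D g ->
  {ae m, forall x, D x -> f x = g x} -> cintegral m D f = cintegral m D g.
Proof.
move=> [f1 f2] [g1 g2] fg; congr (_ +i* _)%C; congr fine;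
  apply: ae_eq_integral => //; try exact/measurable_EFinP;
  by apply: filterS fg => x h Dx; rewrite /= h.
Qed.

End complex_integral.

Section congruence.
Context {R : realType} {n : nat}.

Lemma Omega_congruence p q (a z : 'M[R]_n) : a \in unitmx ->
  Omega p q z -> Omega p q (a *m z *m a^T).
Proof.
move=> ua [g [e [ug -> pE qE]]]; exists (a *m g), e; split => //.
  by rewrite unitmx_mul ua.
by rewrite trmx_mul !mulmxA.
Qed.

Lemma measurable_congruence (a : 'M[R]_n) D :
  measurable_fun D (fun z : 'M[R]_n => a *m z *m a^T).
Proof.
apply: measurable_mulmx; last exact: measurable_cst.
by apply: measurable_mulmx; [exact: measurable_cst|exact: measurable_id].
Qed.

Lemma congruenceK (a z : 'M[R]_n) : a \in unitmx ->
  invmx a *m (a *m z *m a^T) *m (invmx a)^T = z.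
Proof.
move=> ua; rewrite !mulmxA mulVmx// mul1mx -mulmxA -trmx_mul mulVmx//.
by rewrite trmx1 mulmx1.
Qed.

Context (a : 'M[R]_n) (p q : nat).
Hypotheses (ua : a \in unitmx) (pqn : (p + q = n)%N).

Lemma Omega_congruenceE (z : 'M[R]_n) : Omega p q (a *m z *m a^T) <-> Omega p q z.
Proof.
split; last exact: Omega_congruence.
move=> Oz; rewrite -(congruenceK z ua); apply: Omega_congruence => //.
by rewrite unitmx_inv.
Qed.

Lemma ge0_lebesgue_sym_congruence (g : 'M[R]_n -> \bar R) :
  measurable_fun (Omega p q) g -> (forall z, (0 <= g z)%E) ->
  (\int[lebesgue_sym]_(z in Omega p q) g z =
   (`|\det a| ^+ n.+1)%:E * \int[lebesgue_sym]_(z in Omega p q) g (a *m z *m a^T))%E.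
Proof.
move=> mg g0; have mO := @measurable_Omega R _ _ _ pqn.
rewrite integral_mkcond [in RHS]integral_mkcond.
have mr : measurable_fun setT (g \_ (Omega p q)) by apply/(measurable_restrictT _ mO).
have r0 z : (0 <= (g \_ (Omega p q)) z)%E by rewrite /patch; case: ifP.
have mra : measurable_fun setT (fun z => (g \_ (Omega p q)) (a *m z *m a^T)).
  by apply: (measurableT_comp mr); exact: measurable_congruence.
rewrite lebesgue_sym_integral// (sym_measure_congruence ua)//; congr (_ * _)%E.
rewrite -lebesgue_sym_integral//; apply: eq_integral => z _.
rewrite /patch; congr (if _ then _ else _).
by apply/idP/idP; rewrite !inE => /Omega_congruenceE.
Qed.

(** The hypothesis is on the transformed function because integrability is
    known there: it is proportional to the integrand of P f. *)
Lemma Rintegral_congruence (g : 'M[R]_n -> R) :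
  measurable_fun (Omega p q) g ->
  lebesgue_sym.-integrable (Omega p q) (EFin \o (fun z => g (a *m z *m a^T))) ->
  Rintegral lebesgue_sym (Omega p q) g =
  `|\det a| ^+ n.+1 *
  Rintegral lebesgue_sym (Omega p q) (fun z => g (a *m z *m a^T)).
Proof.
move=> mg ig; have mO := @measurable_Omega R _ _ _ pqn.
rewrite /Rintegral integralE [in RHS]integralE.
have mE : measurable_fun (Omega p q) (EFin \o g) by exact/measurable_EFinP.
rewrite (ge0_lebesgue_sym_congruence (measurable_funepos mE))//.
rewrite (ge0_lebesgue_sym_congruence (measurable_funeneg mE))//.
have key (c : R) (X Y : \bar R) : X \is a fin_num -> Y \is a fin_num ->
    fine (c%:E * X - c%:E * Y)%E = c * fine (X - Y)%E.
  by case: X Y => [x||] [y||]//= _ _; rewrite mulrBr.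
have -> : (fun z => (EFin \o g)^\+ (a *m z *m a^T))%E =
    ((EFin \o (fun z => g (a *m z *m a^T)))^\+)%E.
  by apply/funext => z; rewrite !funeposE.
have -> : (fun z => (EFin \o g)^\- (a *m z *m a^T))%E =
    ((EFin \o (fun z => g (a *m z *m a^T)))^\-)%E.
  by apply/funext => z; rewrite !funenegE.
rewrite key//; first exact: integrable_pos_fin_num.
exact: integrable_neg_fin_num.
Qed.

End congruence.

Section transform_properties.
Context {R : realType} {n d p q : nat} (nu mu : R[i]).
Local Notation nu0 := (complex.Re nu).
Local Notation mu0 := (complex.Re mu).
Hypotheses (pqn : (p + q = n)%N) (numu : n.+1%:R <= nu0 + mu0) (mu_le0 : mu0 <= 0).
Local Notation K := (integrandP (nu / 2) (- mu / 2)).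
Local Notation P := (opP (nu / 2) (- mu / 2) p q).
Implicit Types f g : 'M[R]_n -> R[i].

Lemma full_rank_mulr (y : 'M[R]_(n, d)) (k : 'M[R]_d) : k \in unitmx ->
  full_rank y -> full_rank (y *m k).
Proof.
by move=> uk fy; rewrite /full_rank /= mxrankMfree// row_free_unit.
Qed.

Lemma full_rank_mull (a : 'M[R]_n) (y : 'M[R]_(n, d)) : a \in unitmx ->
  full_rank y -> full_rank (a *m y).
Proof.
move=> ua fy; rewrite /full_rank /= -mxrank_tr trmx_mul mxrankMfree ?mxrank_tr//.
by rewrite row_free_unit unitmx_tr.
Qed.

Lemma integrandP_mulr f (y : 'M[R]_(n, d)) (k : 'M[R]_d) z : k \in unitmx ->
  K f (y *m k) z = cpow `|\det k| (- mu) * K f y z.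
Proof.
move=> uk; rewrite /integrandP /kernelK trmx_mul.
have -> : k^T *m y^T *m invmx z *m (y *m k) = k^T *m (y^T *m invmx z *m y) *m k.
  by rewrite !mulmxA.
have k0 : 0 < `|\det k| by rewrite normr_gt0 -unitfE -unitmxE.
have -> : `|\det (k^T *m (y^T *m invmx z *m y) *m k)| =
    `|\det k| ^+ 2 * `|\det (y^T *m invmx z *m y)|.
  by rewrite !(det_mulmx (k^T *m _)) det_mulmx det_tr !normrM; ring.
by rewrite cpowM ?exprn_gt0// cpow_sqr//; ring.
Qed.

Lemma opP_equivariant f : HG nu0 p q f -> equivariant mu (P f : 'M[R]_(n, d) -> _).
Proof.
move=> Hf y k fy uk; have mO := @measurable_Omega R _ _ _ pqn.
rewrite /opP -cintegralZl//; last exact: integrable_integrandP.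
by apply: eq_cintegral => z _; exact: integrandP_mulr.
Qed.

Lemma opP_linear (c : R[i]) f g (y : 'M[R]_(n, d)) :
  HG nu0 p q f -> HG nu0 p q g -> full_rank y ->
  P (fun z => c * f z + g z) y = c * P f y + P g y.
Proof.
move=> Hf Hg fy; have mO := @measurable_Omega R _ _ _ pqn.
have iF := integrable_integrandP pqn numu mu_le0 Hf fy.
have iG := integrable_integrandP pqn numu mu_le0 Hg fy.
have iZ : cintegrable lebesgue_sym (Omega p q) (fun z => c * K f y z).
  have [i1 i2] := iF; split.
    rewrite (_ : _ \o _ = (fun z => (complex.Re c)%:E * (EFin \o (fun z => complex.Re (K f y z))) z
      - (complex.Im c)%:E * (EFin \o (fun z => complex.Im (K f y z))) z)%E).
      by apply: integrableB => //; exact: integrableZl.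
    by apply/funext => z; rewrite /= ReM EFinB !EFinM.
  rewrite (_ : _ \o _ = (fun z => (complex.Re c)%:E * (EFin \o (fun z => complex.Im (K f y z))) z
    + (complex.Im c)%:E * (EFin \o (fun z => complex.Re (K f y z))) z)%E).
    by apply: integrableD => //; exact: integrableZl.
  by apply/funext => z; rewrite /= ImM EFinD !EFinM.
rewrite /opP -cintegralZl// -cintegralD//.
by apply: eq_cintegral => z _; rewrite /integrandP; ring.
Qed.

Lemma opP_ae_eq f g (y : 'M[R]_(n, d)) : HG nu0 p q f -> HG nu0 p q g ->
  {ae lebesgue_sym, forall z, Omega p q z -> f z = g z} -> P f y = P g y.
Proof.
move=> [mf _] [mg _] fg; have mO := @measurable_Omega R _ _ _ pqn.
apply: cintegral_ae_eq => //; try exact: measurable_integrandP.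
by apply: filterS fg => z h Oz; rewrite /integrandP h.
Qed.

(** The exponents of |det a| cancel: -nu from the representation, nu from |det
    z|^(nu/2), and -(n+1) from the density against the Jacobian. *)
Lemma integrandP_piG (a : 'M[R]_n) f (y : 'M[R]_(n, d)) (w : 'M[R]_n) :
  a \in unitmx -> w \in unitmx ->
  `|\det a|%:C%C ^+ n.+1 * K (piG nu a f) y (a *m w *m a^T) =
  K f (invmx a *m y) w.
Proof.
move=> ua uw; rewrite /integrandP /kernelK /piG congruenceK//.
have a0 : 0 < `|\det a| by rewrite normr_gt0 -unitfE -unitmxE.
have w0 : 0 < `|\det w| by rewrite normr_gt0 -unitfE -unitmxE.
have -> : y^T *m invmx (a *m w *m a^T) *m y =
    (invmx a *m y)^T *m invmx w *m (invmx a *m y).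
  have uawa : a *m w *m a^T \in unitmx by rewrite !unitmx_mul ua uw unitmx_tr.
  have -> : invmx (a *m w *m a^T) = (invmx a)^T *m invmx w *m invmx a.
    have h : (invmx a)^T *m invmx w *m invmx a *m (a *m w *m a^T) = 1%:M.
      rewrite -!mulmxA (mulmxA (invmx a)) mulVmx// mul1mx (mulmxA (invmx w)).
      by rewrite mulVmx// mul1mx -trmx_mul mulmxV// trmx1.
    by rewrite -[RHS]mulmx1 -(mulmxV uawa) mulmxA h mul1mx.
  by rewrite trmx_mul !mulmxA.
have -> : `|\det (a *m w *m a^T)| = `|\det a| ^+ 2 * `|\det w|.
  by rewrite !det_mulmx det_tr !normrM; ring.
rewrite cpowM ?exprn_gt0 ?ltW// cpow_sqr// powRM ?exprn_ge0 ?ltW//.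
have -> : (`|\det a| ^+ 2) `^ (- (n.+1%:R / 2)) = `|\det a| ^- n.+1.
  rewrite -(powR_mulrn 2 (ltW a0)) -powRrM.
  have -> : 2%:R * - (n.+1%:R / 2) = - n.+1%:R :> R by field.
  by rewrite powRN powR_mulrn ?ltW.
have e1 : cpow `|\det a| (- nu) * cpow `|\det a| nu = 1.
  by rewrite -cpow_add// addNr /cpow gt_eqF//= !mul0r expR0 cos0 sin0 mul1r.
have t1 : `|\det a|%:C%C ^+ n.+1 * (`|\det a| ^- n.+1)%:C%C = 1.
  by rewrite -rmorphXn -rmorphM/= mulfV// gt_eqF// exprn_gt0.
rewrite rmorphM/=; set e := cpow _ (- nu) in e1 *; set e' := cpow _ nu in e1 *.
set t := _ ^+ n.+1 in t1 *; set t' := (_ ^- n.+1)%:C%C in t1 *.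
have H (F W X U : R[i]) : t * (e * F * (e' * W * X) * (t' * U)) =
    (e * e') * (t * t') * (F * (W * X) * U) by ring.
by rewrite H e1 t1 !mul1r.
Qed.

Lemma cmeasurable_piG (a : 'M[R]_n) f : a \in unitmx ->
  cmeasurable_fun (Omega p q) f -> cmeasurable_fun (Omega p q) (piG nu a f).
Proof.
move=> ua [f1 f2]; have mO := @measurable_Omega R _ _ _ pqn.
have uV : invmx a \in unitmx by rewrite unitmx_inv.
apply: cmeasurableM; first by split; exact: measurable_cst.
have im : [set invmx a *m z *m (invmx a)^T | z in Omega p q] `<=` Omega p q.
  by move=> _ [z Oz <-]; exact: Omega_congruence.
split.
  exact: (measurable_comp mO im f1 (@measurable_congruence R n (invmx a) (Omega p q))).
exact: (measurable_comp mO im f2 (@measurable_congruence R n (invmx a) (Omega p q))).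
Qed.

Lemma opP_intertwines (a : 'M[R]_n) f (y : 'M[R]_(n, d)) : a \in unitmx ->
  HG nu0 p q f -> full_rank y -> P (piG nu a f) y = piL a (P f) y.
Proof.
move=> ua Hf fy; have mO := @measurable_Omega R _ _ _ pqn; have [mf _] := Hf.
have [m1 m2] := measurable_integrandP pqn (nu / 2) (- mu / 2) y (cmeasurable_piG ua mf).
have fya : full_rank (invmx a *m y) by apply: full_rank_mull => //; rewrite unitmx_inv.
have [i1 i2] := integrable_integrandP pqn numu mu_le0 Hf fya.
have a0 : 0 < `|\det a| by rewrite normr_gt0 -unitfE -unitmxE.
set c := `|\det a| ^+ n.+1; have c0 : 0 < c by rewrite exprn_gt0.
have E w : Omega p q w -> K (piG nu a f) y (a *m w *m a^T) =
    (c^-1)%:C%C * K f (invmx a *m y) w.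
  move=> Ow; rewrite -(integrandP_piG f y ua (Omega_unitmx pqn Ow)) mulrA.
  by rewrite -rmorphXn -rmorphM/= -/c mulVf ?gt_eqF// mul1r.
have part (h : R[i] -> R) : (forall (r : R) x, h (r%:C%C * x) = r * h x) ->
    measurable_fun (Omega p q) (fun z => h (K (piG nu a f) y z)) ->
    lebesgue_sym.-integrable (Omega p q) (EFin \o (fun z => h (K f (invmx a *m y) z))) ->
    Rintegral lebesgue_sym (Omega p q) (fun z => h (K (piG nu a f) y z)) =
    Rintegral lebesgue_sym (Omega p q) (fun z => h (K f (invmx a *m y) z)).
  move=> hZ mh ih.
  have ihE z : Omega p q z ->
      h (K (piG nu a f) y (a *m z *m a^T)) = c^-1 * h (K f (invmx a *m y) z).
    by move=> Oz; rewrite E// hZ.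
  rewrite (Rintegral_congruence ua pqn mh).
    rewrite -RintegralZl//; last first.
      apply: eq_integrable (integrableZl mO c^-1 ih) => //.
      by move=> z; rewrite inE => Oz; rewrite /= ihE.
    by apply: eq_Rintegral => z; rewrite inE => Oz; rewrite ihE// mulrA mulfV ?gt_eqF// mul1r.
  apply: eq_integrable (integrableZl mO c^-1 ih) => //.
  by move=> z; rewrite inE => Oz; rewrite /= ihE.
rewrite /piL /opP; apply: complex_ext => /=.
  by apply: part => // r x; rewrite ReM /= mul0r subr0.
by apply: part => // r x; rewrite ImM /= mul0r addr0.
Qed.

End transform_properties.

(** * Compactness of the Stiefel manifold *)

Lemma ultra_fmap T U (f : T -> U) (F : set_system T) :
  UltraFilter F -> UltraFilter (f @ F).
Proof.
move=> UF; have PF : ProperFilter F by exact: ultra_proper.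
split=> [|G PG FG]; first exact: fmap_proper_filter.
apply/seteqP; split=> // A GA.
have [//|FA] := in_ultra_setVsetC (f @^-1` A) UF.
have GAc : G (~` A) by apply: FG.
have : G (A `&` ~` A) by exact: filterI.
by rewrite setICr => /filter_not_empty.
Qed.

Section stiefel.
Context {R : realType} {n d : nat}.

Lemma stiefel_entry_le1 (y : 'M[R]_(n, d)) i j : Stiefel y -> `|y i j| <= 1.
Proof.
move=> Sy; rewrite -(@expr_le1 _ 2)// real_normK ?num_real//.
have -> : 1 = (y^T *m y) j j by rewrite Sy mxE eqxx.
rewrite mxE (bigD1 i)//= mxE -expr2 lerDl sumr_ge0// => k _.
by rewrite mxE -expr2 sqr_ge0.
Qed.

(** Along an ultrafilter each entry converges, being bounded; so the matrix
    converges, and the defining equation passes to the limit. *)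
Lemma compact_Stiefel : compact (@Stiefel R n d).
Proof.
rewrite compact_ultra => F UF FS.
have FF : Filter F by exact: ultra_proper.
have lim (ij : 'I_n * 'I_d) : exists x : R,
    (fun y : 'M[R]_(n, d) => y ij.1 ij.2) @ F --> x.
  have := @segment_compact R (-1) 1; rewrite compact_ultra.
  move=> /(_ ((fun y : 'M[R]_(n, d) => y ij.1 ij.2) @ F)).
  have -> : `[(-1)%R, 1%R]%classic = `[-1, 1]%classic :> set R by [].
  case=> [||x [_ Fx]]; last by exists x.
    exact: ultra_fmap.
  rewrite /fmap/=; near=> y; rewrite /= in_itv/= -ler_norml.
  apply: stiefel_entry_le1; near: y; exact: FS.
have [l ll] := choice lim.
pose M : 'M[R]_(n, d) := \matrix_(i, j) l (i, j).
have FM : id @ F --> M.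
  by apply: cvg_mx => i j; rewrite mxE; exact: (ll (i, j)).
exists M; split; last exact: FM.
have G : (fun y : 'M[R]_(n, d) => y^T *m y) @ F --> M^T *m M.
  by apply: cvg_mulmx => //; exact: cvg_trmx.
rewrite /Stiefel/=; apply/matrixP => i j.
have h := @cvg_entry R _ F FF _ _ _ _ i j G.
apply: (cvg_unique _ h) => //.
have : (fun=> (1%:M : 'M[R]_d) i j) @ F --> (1%:M : 'M[R]_d) i j by exact: cvg_cst.
apply: cvg_trans; apply: near_eq_cvg; near=> y.
by have -> : y^T *m y = 1%:M by near: y; exact: FS.
Unshelve. all: by end_near. Qed.

End stiefel.

(** * Equivariant functions and column spaces *)

Lemma cvg_complexM (R : realType) T (F : set_system T) {FF : Filter F}
    (f g : T -> R[i]) (a b : R[i]) :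
  (fun x => complex.Re (f x)) @ F --> complex.Re a ->
  (fun x => complex.Im (f x)) @ F --> complex.Im a ->
  (fun x => complex.Re (g x)) @ F --> complex.Re b ->
  (fun x => complex.Im (g x)) @ F --> complex.Im b ->
  (fun x => complex.Re (f x * g x)) @ F --> complex.Re (a * b) /\
  (fun x => complex.Im (f x * g x)) @ F --> complex.Im (a * b).
Proof.
move=> f1 f2 g1 g2; split.
  rewrite ReM; under eq_fun do rewrite ReM.
  by apply: cvgB; apply: cvgM.
rewrite ImM; under eq_fun do rewrite ImM.
by apply: cvgD; apply: cvgM.
Qed.

Lemma cvg_affine (R : realType) T (F : set_system T) {FF : Filter F} m n p
    (a : 'M[R]_(m, n)) (b : 'M[R]_(p, n)) (f : T -> 'M[R]_(m, p)) (M : 'M[R]_(m, p)) :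
  f @ F --> M -> (fun x => a + f x *m b) @ F --> a + M *m b.
Proof.
move=> fM; apply: cvg_mx => i j; rewrite mxE; under eq_fun do rewrite mxE.
apply: cvgD; first exact: cvg_cst.
by apply: cvg_entry; apply: cvg_mulmx => //; exact: cvg_cst.
Qed.

Section projector.
Context {R : realType} {n d : nat}.
Implicit Types y v w : 'M[R]_(n, d).

(** The orthogonal projector onto the column space of a full rank y, written
    with the adjugate so as to be elementary. *)
Definition projector y : 'M[R]_n :=
  y *m ((\det (y^T *m y))^-1 *: \adj (y^T *m y)) *m y^T.

(** The squared Frobenius distance of projectors, for v in the Stiefel
    manifold. *)
Definition proj_dist v y : R :=
  \sum_i \sum_j ((projector y - v *m v^T) i j) ^+ 2.

Lemma gram_unitmx y : full_rank y -> y^T *m y \in unitmx.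
Proof. by move=> fy; rewrite unitmxE unitfE gt_eqF// full_rank_det_gt0. Qed.

Lemma projectorE y : full_rank y -> projector y = y *m invmx (y^T *m y) *m y^T.
Proof. by move=> fy; rewrite /projector /invmx gram_unitmx. Qed.

Lemma projector_Stiefel v : Stiefel v -> projector v = v *m v^T.
Proof.
by move=> Sv; rewrite projectorE ?Sv ?invmx1 ?mulmx1//; exact: stiefel_full_rank.
Qed.

Lemma projector_mulr y k : full_rank y -> k \in unitmx ->
  projector (y *m k) = projector y.
Proof.
move=> fy uk; rewrite !projectorE//; last exact: full_rank_mulr.
have uG := gram_unitmx fy.
have -> : invmx ((y *m k)^T *m (y *m k)) = invmx k *m invmx (y^T *m y) *m (invmx k)^T.
  have -> : (y *m k)^T *m (y *m k) = k^T *m (y^T *m y *m k).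
    by rewrite trmx_mul !mulmxA.
  have uA : k^T *m (y^T *m y *m k) \in unitmx by rewrite !unitmx_mul unitmx_tr uk uG.
  have h : invmx k *m invmx (y^T *m y) *m (invmx k)^T *m (k^T *m (y^T *m y *m k)) = 1%:M.
    rewrite -!mulmxA (mulmxA (invmx k)^T) -trmx_mul mulmxV// trmx1 mul1mx.
    by rewrite (mulmxA y^T) (mulmxA (invmx (y^T *m y))) mulVmx// mul1mx mulVmx.
  by rewrite -[RHS]mulmx1 -(mulmxV uA) [RHS]mulmxA h mul1mx.
rewrite trmx_mul !mulmxA mulmxK// -(mulmxA _ (invmx k)^T) -trmx_mul mulmxV//.
by rewrite trmx1 mulmx1.
Qed.

Lemma proj_dist_mulr v y k : full_rank y -> k \in unitmx ->
  proj_dist v (y *m k) = proj_dist v y.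
Proof. by move=> fy uk; rewrite /proj_dist projector_mulr. Qed.

Lemma sqr_le_proj_dist v y i j : ((projector y - v *m v^T) i j) ^+ 2 <= proj_dist v y.
Proof.
rewrite /proj_dist (bigD1 i)//= (bigD1 j)//= -addrA lerDl addr_ge0//.
  by apply: sumr_ge0 => k _; exact: sqr_ge0.
by apply: sumr_ge0 => k _; apply: sumr_ge0 => l _; exact: sqr_ge0.
Qed.

Lemma proj_dist0 v : Stiefel v -> proj_dist v v = 0.
Proof.
move=> Sv; rewrite /proj_dist projector_Stiefel// subrr.
by apply: big1 => i _; apply: big1 => j _; rewrite mxE expr0n.
Qed.

Local Notation smooth_elementary :=
  (elementary (V := 'M[R]_(n, d)) full_rank mx_entries).

Lemma elementary_gram :
  elementary_mx (V := 'M[R]_(n, d)) full_rank mx_entries (fun y => y^T *m y).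
Proof.
have h := @elementary_mx_id R n d full_rank.
by apply: elementary_mulmx => //; exact: elementary_trmx.
Qed.

Lemma elementary_proj_dist v : smooth_elementary (proj_dist v).
Proof.
have h := @elementary_mx_id R n d full_rank.
have hp : elementary_mx (V := 'M[R]_(n, d)) full_rank mx_entries projector.
  apply: elementary_mulmx; last exact: elementary_trmx.
  apply: elementary_mulmx => //; apply: elementary_invmx; last exact: gram_unitmx.
  exact: elementary_gram.
have hij i j : smooth_elementary (fun y => ((projector y - v *m v^T) i j) ^+ 2).
  apply: (elementary_ext (f := fun y => (projector y i j + - (v *m v^T) i j) *
    (projector y i j + - (v *m v^T) i j))).
    by apply: elementaryM; apply: elementaryD => //; exact: elementary_cst.
  by move=> y /=; rewrite !mxE expr2.
by apply: elementary_sum => i; apply: elementary_sum => j.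
Qed.

Lemma entries_continuous (g : 'M[R]_(n, d) -> R) : smooth_elementary g ->
  forall y, full_rank y -> {for y, continuous g}.
Proof.
by apply: elementary_continuous; [move=> f x; exact: mx_entries_diff].
Qed.

Lemma entries_smooth (g : 'M[R]_(n, d) -> R) : smooth_elementary g ->
  smooth_on full_rank g.
Proof.
apply: elementary_smooth; first exact: open_full_rank.
  by move=> f x; exact: mx_entries_diff.
by move=> f v; exact: mx_entries_derive.
Qed.

Lemma normcD (x y : R[i]) : Normc.normc (x + y) <= Normc.normc x + Normc.normc y.
Proof. exact: le_normcD. Qed.

Lemma normcN (x : R[i]) : Normc.normc (- x) = Normc.normc x.
Proof. by case: x => a b /=; rewrite !sqrrN. Qed.

Lemma normc_le_ReIm (x : R[i]) : Normc.normc x <= `|complex.Re x| + `|complex.Im x|.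
Proof.
rewrite -ler_sqr ?nnegrE ?normc_ge0 ?addr_ge0// -/(normsq x) normsqE.
rewrite -(real_normK (num_real (complex.Re x))) -(real_normK (num_real (complex.Im x))).
by rewrite sqrrD addrAC lerDl mulrn_wge0// mulr_ge0.
Qed.

Section modulus.
Variables (mu : R[i]) (F : 'M[R]_(n, d) -> R[i]).
Hypotheses (eF : equivariant mu F)
  (cR : forall y, full_rank y -> {for y, continuous (fun w => complex.Re (F w))})
  (cI : forall y, full_rank y -> {for y, continuous (fun w => complex.Im (F w))}).

Let F0 y := cpow (\det (y^T *m y)) (mu / 2) * F y.

Let F0_mulr y k : full_rank y -> k \in unitmx -> F0 (y *m k) = F0 y.
Proof.
move=> fy uk; have k0 : 0 < `|\det k| by rewrite normr_gt0 -unitfE -unitmxE.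
rewrite /F0 eF//.
have -> : (y *m k)^T *m (y *m k) = k^T *m (y^T *m y *m k).
  by rewrite trmx_mul !mulmxA.
have -> : \det (k^T *m (y^T *m y *m k)) = `|\det k| ^+ 2 * \det (y^T *m y).
  by rewrite !(det_mulmx k^T) !(det_mulmx _ k) det_tr real_normK ?num_real//; ring.
rewrite cpowM ?exprn_gt0 ?(ltW (full_rank_det_gt0 fy))// cpow_sqr//.
have e1 : cpow `|\det k| mu * cpow `|\det k| (- mu) = 1.
  by rewrite -cpow_add// subrr /cpow gt_eqF//= !mul0r expR0 cos0 sin0 mul1r.
set a := cpow _ mu in e1 *; set b := cpow _ (- mu) in e1 *; set c := cpow _ (mu / 2).
have -> : a * c * (b * F y) = (a * b) * (c * F y) by ring.
by rewrite e1 mul1r.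
Qed.

Let F0_Stiefel v : Stiefel v -> F0 v = F v.
Proof. by move=> Sv; rewrite /F0 Sv det1 cpow1 mul1r. Qed.

(** Although proj_dist only sees column spaces, it controls F: the function
    F0(y) = det(y^T y)^(mu/2) F(y) is invariant under GL_d and equals F on the
    Stiefel manifold, and w w^T v, which has the same column space as w, is
    close to v when w w^T is close to v v^T. *)
Lemma modulus_Stiefel v eps : Stiefel v -> 0 < eps -> exists2 r, 0 < r &
  forall w, Stiefel w -> proj_dist v w < r -> Normc.normc (F w - F v) <= eps.
Proof.
move=> Sv e0; have fv : full_rank v := stiefel_full_rank Sv.
have e2 : 0 < eps / 2 by lra.
pose Q y := [/\ full_rank y, `|complex.Re (F0 v) - complex.Re (F0 y)| < eps / 2 &
  `|complex.Im (F0 v) - complex.Im (F0 y)| < eps / 2].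
have nQ : \forall y \near v, Q y.
  have g0 := full_rank_det_gt0 fv.
  have cg : (fun y => \det (y^T *m y)) @ v --> \det (v^T *m v).
    apply: entries_continuous => //; apply: elementary_det; exact: elementary_gram.
  have [c1 c2] := @cvg_cpow R _ (nbhs v) (nbhs_filter v) _ _ (mu / 2) g0 cg.
  have [b1 b2] := @cvg_complexM R _ (nbhs v) (nbhs_filter v) _ _ _ _ c1 c2
    (cR fv) (cI fv).
  near=> y; split.
  - near: y; apply: open_nbhs_nbhs; split => //; exact: open_full_rank.
  - near: y; exact: (b1 _ (nbhsx_ballx (complex.Re (F0 v)) (eps / 2) e2)).
  - near: y; exact: (b2 _ (nbhsx_ballx (complex.Im (F0 v)) (eps / 2) e2)).
(* With E = w w^T - v v^T one has v + E v = w (w^T v). *)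
have cE : (fun E : 'M[R]_n => v + E *m v) @ (0 : 'M[R]_n) --> v.
  have : (fun E : 'M[R]_n => v + E *m v) @ (0 : 'M[R]_n) --> v + (0 : 'M[R]_n) *m v.
    apply: (@cvg_affine R _ _ (nbhs_filter (0 : 'M[R]_n)) _ _ _ v v id 0); exact: cvg_id.
  by rewrite mul0mx addr0.
have /nbhs_ballP[rho /= rho0 hrho] := cE _ nQ.
exists (rho ^+ 2); first by rewrite exprn_gt0.
move=> w Sw dw; have fw : full_rank w := stiefel_full_rank Sw.
have : Q (v + (w *m w^T - v *m v^T) *m v).
  apply: hrho; split=> // i j; rewrite /ball/= mxE sub0r normrN.
  have := le_lt_trans (sqr_le_proj_dist v w i j) dw; rewrite projector_Stiefel//.
  by rewrite -(real_normK (num_real _)) ltr_pXn2r// nnegrE ltW.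
have -> : v + (w *m w^T - v *m v^T) *m v = w *m (w^T *m v).
  by rewrite mulmxBl -(mulmxA v) Sv mulmx1 addrC subrK mulmxA.
move=> [fwv Rw Iw].
(* w (w^T v) has rank d, so w^T v is invertible. *)
have uk : w^T *m v \in unitmx.
  rewrite -row_free_unit /row_free eqn_leq rank_leq_row/= -{1}fwv.
  exact: mxrankM_maxr.
move: Rw Iw; rewrite F0_mulr// !F0_Stiefel// => Rw Iw.
apply: (le_trans (normc_le_ReIm _)); rewrite ReD ImD ReN ImN.
by rewrite [eps]splitr; apply: lerD; rewrite distrC ltW.
Unshelve. all: by end_near. Qed.

End modulus.
End projector.

(** * Smooth equivariant approximation *)

Section weighted_average.
Context {R : realType}.

Lemma normc_sum_le (I : Type) (s : seq I) (c : I -> R[i]) :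
  Normc.normc (\sum_(i <- s) c i) <= \sum_(i <- s) Normc.normc (c i).
Proof.
elim: s => [|i s IH]; first by rewrite !big_nil Normc.normc0.
by rewrite !big_cons; apply: (le_trans (normcD _ _)); rewrite lerD2l.
Qed.

(** Indices with value far from a have weight at most e^2, while the total
    weight is at least e; so together they contribute at most (size s) B e. *)
Lemma weighted_average_le (I : eqType) (s : seq I) (c : I -> R[i]) (w : I -> R)
    (a : R[i]) (eps B e : R) :
  0 <= eps -> 0 <= B -> 0 < e ->
  (forall i, 0 <= w i) ->
  (forall i, i \in s -> Normc.normc (c i - a) <= B) ->
  (forall i, i \in s -> Normc.normc (c i - a) <= eps \/ w i <= e * e) ->
  (exists2 i, i \in s & e <= w i) ->
  Normc.normc (\sum_(i <- s) c i * (w i / \sum_(j <- s) w j)%:C%C - a) <=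
  eps + (size s)%:R * B * e.
Proof.
move=> eps0 B0 e0 w0 cB cw [i0 si0 wi0]; set W := \sum_(j <- s) w j.
have We : e <= W.
  apply: (le_trans wi0); rewrite /W (big_rem i0)//= lerDl; exact: sumr_ge0.
have W0 : 0 < W by exact: lt_le_trans e0 We.
have -> : \sum_(i <- s) c i * (w i / W)%:C%C - a =
    \sum_(i <- s) (c i - a) * (w i / W)%:C%C.
  under [RHS]eq_bigr do rewrite mulrBl.
  rewrite sumrB -mulr_sumr -rmorph_sum/= -mulr_suml divff ?gt_eqF//.
  by rewrite mulr1.
apply: (le_trans (normc_sum_le _ _)).
apply: (@le_trans _ _ (\sum_(i <- s) (eps * w i + B * (e * e)) / W)).
  rewrite big_seq [leRHS]big_seq; apply: ler_sum => i si.
  rewrite Normc.normcM normc_real ger0_norm ?divr_ge0 ?(ltW W0)// (mulrA (Normc.normc _)).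
  apply: ler_wpM2r; first by rewrite invr_ge0 ltW.
  have [h|h] := cw i si.
    apply: (@le_trans _ _ (eps * w i)); first exact: ler_wpM2r.
    by rewrite lerDl !mulr_ge0// ltW.
  apply: (@le_trans _ _ (B * (e * e))); last by rewrite lerDr mulr_ge0.
  by apply: ler_pM => //; [exact: normc_ge0|exact: cB].
rewrite -mulr_suml big_split/= -mulr_sumr -/W big_const_seq count_predT iter_addr addr0.
rewrite mulrDl mulfK ?gt_eqF// lerD2l -[B * (e * e) *+ _]mulr_natl ler_pdivrMr//.
rewrite !mulrA; apply: ler_wpM2l => //.
by rewrite !mulr_ge0 ?ler0n// ltW.
Qed.

End weighted_average.

Lemma Re_sum (R : realType) (I : Type) (s : seq I) (c : I -> R[i]) :
  complex.Re (\sum_(i <- s) c i) = \sum_(i <- s) complex.Re (c i).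
Proof. by apply: (big_morph (@complex.Re R)) => //; exact: ReD. Qed.

Lemma Im_sum (R : realType) (I : Type) (s : seq I) (c : I -> R[i]) :
  complex.Im (\sum_(i <- s) c i) = \sum_(i <- s) complex.Im (c i).
Proof. by apply: (big_morph (@complex.Im R)) => //; exact: ImD. Qed.

Section approximation.
Context {R : realType} {n d : nat}.
Local Notation M := 'M[R]_(n, d).
Local Notation smooth_elementary := (elementary (V := M) full_rank mx_entries).

Lemma measurable_Stiefel : measurable (@Stiefel R n d).
Proof.
rewrite (_ : Stiefel = \bigcap_(ij in [set: 'I_d * 'I_d])
    ((fun w : M => (w^T *m w) ij.1 ij.2) @^-1` [set (1%:M : 'M[R]_d) ij.1 ij.2])).
  apply: fin_bigcap_measurable => // ij _; rewrite -[X in measurable X]setTI.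
  have h : measurable_fun setT (fun w : M => (w^T *m w) ij.1 ij.2).
    by apply: measurable_funE; apply: measurable_mulmx => //; exact: measurable_trmx.
  exact: h.
apply/seteqP; split => [w /= sw ij _|w wE]; first by rewrite /= sw.
by apply/matrixP => i j; exact: (wE (i, j) I).
Qed.

Variables (mu : R[i]) (F : M -> R[i]).
Hypotheses (eF : equivariant mu F)
  (cR : forall y, full_rank y -> {for y, continuous (fun w => complex.Re (F w))})
  (cI : forall y, full_rank y -> {for y, continuous (fun w => complex.Im (F w))}).

(** The radius r v depends on v, so compactness is needed and not only total
    boundedness; half radii leave room between the two kinds of weights. *)
Lemma finite_net eps : 0 < eps -> exists (r : M -> R) (s : seq M),
  [/\ forall v, 0 < r v, forall v, v \in s -> Stiefel v,
      forall v w, v \in s -> Stiefel w -> proj_dist v w < r v ->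
        Normc.normc (F w - F v) <= eps &
      forall w, Stiefel w -> exists2 v, v \in s & proj_dist v w < r v / 2].
Proof.
move=> e0.
have ex (v : M) : exists x : R, 0 < x /\ (Stiefel v -> forall w,
    Stiefel w -> proj_dist v w < x -> Normc.normc (F w - F v) <= eps).
  have [Sv|nSv] := pselect (Stiefel v); last by exists 1.
  by have [x x0 hx] := modulus_Stiefel eF cR cI Sv e0; exists x.
have [r hr] := choice ex.
pose O (v : M) : set M := ([set w | proj_dist v w < r v / 2])°.
have OP v w : Stiefel w -> proj_dist v w < r v / 2 -> O v w.
  move=> Sw dw; have fw := stiefel_full_rank Sw.
  have c := entries_continuous (elementary_proj_dist v) fw.
  exact: (c _ (lt_nbhsl dw)).
have := @compact_Stiefel R n d; rewrite compact_cover.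
move=> /(_ _ (@Stiefel R n d) O); case.
- by move=> v _; exact: open_interior.
- move=> w Sw; exists w => //; apply: OP => //.
  by rewrite proj_dist0// divr_gt0//; case: (hr w).
move=> D' D'S cov; exists r, (finmap.enum_fset D'); split.
- by move=> v; case: (hr v).
- by move=> v vD; have := D'S v vD; rewrite inE.
- move=> v w vD; have := D'S v vD; rewrite inE => Sv.
  by have [_ h] := hr v; exact: h.
- by move=> w /cov[v /= vD /interior_subset vw]; exists v.
Qed.

Let t := - mu / 2.
Let g (y : M) := \det (y^T *m y).
Let A y := expR (complex.Re t * ln (g y)) * cos (complex.Im t * ln (g y)).
Let B y := expR (complex.Re t * ln (g y)) * sin (complex.Im t * ln (g y)).

Let elementary_AB : smooth_elementary A /\ smooth_elementary B.
Proof.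
have eln : smooth_elementary (fun y => ln (g y)).
  apply: elementary_ln; last by move=> y fy; exact: full_rank_det_gt0.
  by apply: elementary_det; exact: elementary_gram.
have eM r : smooth_elementary (fun y => r * ln (g y)).
  by apply: elementaryM => //; exact: elementary_cst.
split; apply: elementaryM; try exact: elementary_exp.
  exact: elementary_cos.
exact: elementary_sin.
Qed.

(** The approximant is det(y^T y)^(-mu/2) times the average of the values F(v)
    over the net, with Gaussian weights in proj_dist normalised by r v: the
    weight is at least e if v is one of the net points near y, and at most e^2
    when proj_dist v y >= r v. *)
Lemma smooth_approximation eps : 0 < eps -> exists2 Phi : M -> R[i],
  HL_smooth mu Phi & forall v, Stiefel v -> Normc.normc (F v - Phi v) <= eps.
Proof.
move=> e0; have e2 : 0 < eps / 2 by lra.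
have [r [s [r0 sS Fs cov]]] := finite_net e2.
have [s0|sn0] := eqVneq s [::].
  exists (fun=> 0); last by move=> v /cov[w]; rewrite s0.
  split; last by move=> y k _ _; rewrite mulr0.
  by split; apply: entries_smooth; exact: elementary_cst.
(* Bd bounds |F v - F w| for v in the net and w in the Stiefel manifold. *)
pose Bd := 2 * (\sum_(v <- s) Normc.normc (F v)) + eps.
have Fle v : v \in s -> Normc.normc (F v) <= \sum_(v <- s) Normc.normc (F v).
  move=> vs; rewrite (big_rem v)//= lerDl; apply: sumr_ge0 => w _; exact: normc_ge0.
have Sge0 : 0 <= \sum_(v <- s) Normc.normc (F v).
  by apply: sumr_ge0 => w _; exact: normc_ge0.
have Bd0 : 0 <= Bd by rewrite /Bd; lra.
pose m : R := (size s)%:R; have m0 : 0 <= m by rewrite /m ler0n.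
(* Chosen so that m Bd e <= eps / 2 and e <= 1. *)
pose e : R := eps / (2 * (m * Bd + 1) + eps).
have mB0 : 0 <= m * Bd by rewrite mulr_ge0.
have D0 : 0 < 2 * (m * Bd + 1) + eps by lra.
have ep : 0 < e by rewrite divr_gt0.
have e1 : e <= 1 by rewrite ler_pdivrMr// mul1r; lra.
have mBe : m * Bd * e <= eps / 2.
  rewrite /e mulrA ler_pdivrMr//.
  have : 0 <= eps * eps by rewrite mulr_ge0 ?ltW.
  by move: mB0; set X := m * Bd; nra.
have lne : ln e <= 0 by rewrite ln_le0.
have l2r v : 2 * ln e / r v <= 0.
  by apply: mulr_le0_ge0; [rewrite pmulr_rle0|rewrite invr_ge0 ltW].
(* Equal to e^2 at distance r v and to e at distance r v / 2. *)
pose w v y := expR (2 * ln e / r v * proj_dist v y).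
pose W y := \sum_(v <- s) w v y.
have w0 v y : 0 < w v y by exact: expR_gt0.
have W0 y : 0 < W y.
  have [x xs] : exists x, x \in s.
    by case: (s) sn0 => // x s' _; exists x; rewrite mem_head.
  by rewrite /W (big_rem x)//= ltr_wpDr// sumr_ge0// => v _; rewrite ltW.
have [eA eB] := elementary_AB.
have ew v : smooth_elementary (w v).
  apply: elementary_exp; apply: elementaryM; first exact: elementary_cst.
  exact: elementary_proj_dist.
have eq v : smooth_elementary (fun y => w v y / W y).
  apply: elementaryM => //; apply: elementaryV; first exact: elementary_sum.
  by move=> y _; rewrite gt_eqF.
pose S y := \sum_(v <- s) F v * (w v y / W y)%:C%C.
have eSR : smooth_elementary (fun y => complex.Re (S y)).
  apply: (elementary_ext (f := fun y => \sum_(v <- s) complex.Re (F v) * (w v y / W y))).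
    by apply: elementary_sum => v; apply: elementaryM => //; exact: elementary_cst.
  by move=> y; rewrite Re_sum; apply: eq_bigr => v _; rewrite ReM /= mulr0 subr0.
have eSI : smooth_elementary (fun y => complex.Im (S y)).
  apply: (elementary_ext (f := fun y => \sum_(v <- s) complex.Im (F v) * (w v y / W y))).
    by apply: elementary_sum => v; apply: elementaryM => //; exact: elementary_cst.
  by move=> y; rewrite Im_sum; apply: eq_bigr => v _; rewrite ImM /= mulr0 add0r.
exists (fun y => (A y +i* B y)%C * S y).
  split; first (split; apply: entries_smooth).
  - apply: (elementary_ext (f := fun y => A y * complex.Re (S y) + - (B y * complex.Im (S y)))).
      by apply: elementaryD; [|apply: elementaryN]; exact: elementaryM.
    by move=> y; rewrite ReM.
  - apply: (elementary_ext (f := fun y => A y * complex.Im (S y) + B y * complex.Re (S y))).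
      by apply: elementaryD; exact: elementaryM.
    by move=> y; rewrite ImM.
  move=> y k fy uk; have k0 : 0 < `|\det k| by rewrite normr_gt0 -unitfE -unitmxE.
  have AB z : full_rank z -> (A z +i* B z)%C = cpow (g z) t.
    move=> fz; rewrite /cpow gt_eqF ?full_rank_det_gt0//.
    by apply: complex_ext; [rewrite ReM|rewrite ImM];
      rewrite [complex.Re _%:C%C]/= [complex.Im _%:C%C]/= mul0r ?subr0 ?addr0.
  have -> : S (y *m k) = S y.
    have wk v : w v (y *m k) = w v y by rewrite /w proj_dist_mulr.
    rewrite /S /W; under eq_bigr do under eq_bigr do rewrite wk.
    by under eq_bigr do rewrite wk.
  rewrite !AB//; last exact: full_rank_mulr.
  have -> : g (y *m k) = `|\det k| ^+ 2 * g y.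
    rewrite /g; have -> : (y *m k)^T *m (y *m k) = k^T *m (y^T *m y *m k).
      by rewrite trmx_mul !mulmxA.
    by rewrite !(det_mulmx k^T) !(det_mulmx _ k) det_tr real_normK ?num_real//; ring.
  rewrite cpowM ?exprn_gt0 ?(ltW (full_rank_det_gt0 fy))// /t cpow_sqr//.
  by rewrite mulrA.
move=> v Sv; have -> : (A v +i* B v)%C = 1.
  by rewrite /A /B /g Sv det1 ln1 !mulr0 expR0 cos0 sin0 mulr1 mulr0.
rewrite mul1r -normcN opprB; apply: (@le_trans _ _ (eps / 2 + m * Bd * e)); last first.
  by rewrite [leRHS]splitr lerD2l.
apply: weighted_average_le => //.
- exact: ltW.
- by move=> u; exact: ltW.
- move=> u us; apply: (le_trans (normcD _ _)); rewrite normcN.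
  have [j js vj] := cov v Sv.
  have h1 := Fle u us; have h2 := Fle j js.
  have h3 : Normc.normc (F v) <= Normc.normc (F v - F j) + Normc.normc (F j).
    by rewrite -{1}(subrK (F j) (F v)); exact: normcD.
  have h4 : Normc.normc (F v - F j) <= eps / 2.
    by apply: Fs => //; apply: (lt_trans vj); rewrite ltr_pdivrMr// ltr_pMr// ltr1n.
  by rewrite /Bd; lra.
- move=> u us; have [lt|ge] := ltP (proj_dist u v) (r u).
    by left; rewrite -normcN opprB; exact: Fs.
  right; rewrite -{1 2}(lnK (x := e)) ?posrE// -expRD /w ler_expR.
  have -> : ln e + ln e = 2 * ln e / r u * r u by rewrite divfK ?gt_eqF//; ring.
  by apply: ler_wnM2l => //; exact: l2r.
have [j js vj] := cov v Sv; exists j => //.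
rewrite -{1}(lnK (x := e)) ?posrE// /w ler_expR.
have {1}-> : ln e = 2 * ln e / r j * (r j / 2) by field; rewrite gt_eqF.
apply: ler_wnM2l; last exact: ltW.
exact: l2r.
Qed.

Lemma smooth_cmeasurable (G : M -> R[i]) :
  csmooth_on full_rank G -> cmeasurable_fun full_rank G.
Proof.
move=> [s1 s2]; split; apply: measurable_continuous_on; try exact: open_full_rank.
  by move=> y fy; have [] := s1 [::] y fy.
by move=> y fy; have [] := s2 [::] y fy.
Qed.

(** Uniform approximation on the Stiefel manifold suffices, since sigma is
    finite. *)
Lemma HL_continuous (sigma : {finite_measure set M -> \bar R}) :
  (HL_normsq sigma F < +oo)%E -> HL sigma mu F.
Proof.
move=> Ffin; have mF : cmeasurable_fun full_rank F.
  by split; apply: measurable_continuous_on => //; exact: open_full_rank.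
have SF : @Stiefel R n d `<=` full_rank by move=> y; exact: stiefel_full_rank.
have mS := measurable_Stiefel.
have mfr : measurable (@full_rank R n d).
  by apply: mx_open_measurable; exact: open_full_rank.
pose s0 := fine (sigma Stiefel).
have sE : sigma Stiefel = s0%:E.
  rewrite fineK// ge0_fin_numE// (le_lt_trans _ (fin_num_fun_lty (fin_num_measure sigma)))//.
  by apply: le_measure; rewrite ?inE.
have s00 : 0 <= s0 by exact: fine_ge0.
have near eps : 0 < eps -> exists Phi, HL_smooth mu Phi /\
    (HL_normsq sigma (fun y => F y - Phi y)%R < eps%:E)%E.
  move=> e0; have p0 : 0 < eps / (s0 + 1) by rewrite divr_gt0//; lra.
  have [|Phi hP FP] := smooth_approximation (eps := Num.sqrt (eps / (s0 + 1))).
    by rewrite sqrtr_gt0.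
  exists Phi; split=> //.
  apply: (@le_lt_trans _ _ (\int[sigma]_(v in Stiefel) (cst (eps / (s0 + 1))%:E v))%E).
    apply: ge0_le_integral => //.
    - by move=> v _; rewrite lee_fin normsq_ge0.
    - apply/measurable_EFinP; apply: (measurable_funS mfr SF).
      apply: measurable_normsq; apply: cmeasurableD => //.
      have [] := smooth_cmeasurable (proj1 hP) => m1 m2.
      split; [under eq_fun do rewrite ReN|under eq_fun do rewrite ImN];
        exact: measurableT_comp.
    - move=> v Sv; rewrite lee_fin /normsq -[leRHS]sqr_sqrtr ?(ltW p0)//.
      by rewrite ler_sqr ?nnegrE ?normc_ge0 ?sqrtr_ge0//; exact: FP.
  rewrite integral_cst// -[X in (_ * X < _)%E]/(sigma Stiefel) sE -EFinM lte_fin mulrAC ltr_pdivrMr; last by lra.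
  by rewrite ltr_pM2l//; lra.
by split.
Qed.

End approximation.

(** * Boundedness and values in the target space *)

Section opP_bounded.
Context {R : realType} {n d p q : nat} (nu mu : R[i]).
Local Notation nu0 := (complex.Re nu).
Local Notation mu0 := (complex.Re mu).
Hypotheses (pqn : (p + q = n)%N) (numu : n.+1%:R <= nu0 + mu0) (mu_le0 : mu0 <= 0).
Context (sigma : {finite_measure set 'M[R]_(n, d) -> \bar R}).
Context (f : 'M[R]_n -> R[i]) (Hf : HG nu0 p q f).
Local Notation Pf := (opP (nu / 2) (- mu / 2) p q f : 'M[R]_(n, d) -> R[i]).

Definition Stiefel_mass : R := fine (sigma Stiefel).

Lemma Stiefel_massE : sigma Stiefel = Stiefel_mass%:E.
Proof.
rewrite fineK// ge0_fin_numE//.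
apply: le_lt_trans (fin_num_fun_lty (fin_num_measure sigma)).
by apply: le_measure; rewrite ?inE//; exact: measurable_Stiefel.
Qed.

Lemma opP_continuous_Re (y : 'M[R]_(n, d)) : full_rank y ->
  {for y, continuous (fun w => complex.Re (Pf w))}.
Proof. by move=> fy; apply: opP_continuous_part => //; left. Qed.

Lemma opP_continuous_Im (y : 'M[R]_(n, d)) : full_rank y ->
  {for y, continuous (fun w => complex.Im (Pf w))}.
Proof. by move=> fy; apply: opP_continuous_part => //; right. Qed.

(** The bound is uniform in y, so it only needs to be multiplied by the mass of
    the Stiefel manifold. *)
Lemma HL_normsq_opP_le : (HL_normsq sigma Pf <=
  (2 * @siegel_const R n * Stiefel_mass)%:E * HG_normsq nu0 p q f)%E.
Proof.
rewrite (HG_norm2E Hf) -EFinM.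
have -> : 2 * @siegel_const R n * Stiefel_mass * HG_norm2 nu (p := p) (q := q) f =
  2 * @siegel_const R n * HG_norm2 nu (p := p) (q := q) f * Stiefel_mass by ring.
rewrite EFinM -Stiefel_massE -integral_cst; last exact: measurable_Stiefel.
have mS := @measurable_Stiefel R n d.
apply: ge0_le_integral => //.
- by move=> v _; rewrite lee_fin normsq_ge0.
- apply/measurable_EFinP; apply: (@measurable_funS _ _ _ _ full_rank).
  + by apply: mx_open_measurable; exact: open_full_rank.
  + by move=> y; exact: stiefel_full_rank.
  + apply: measurable_normsq; split; apply: measurable_continuous_on; try exact: open_full_rank.
      by move=> y; exact: opP_continuous_Re.
    by move=> y; exact: opP_continuous_Im.
- by move=> v Sv; rewrite lee_fin; exact: normsq_opP_le.
Qed.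

Lemma HL_opP : HL sigma mu Pf.
Proof.
apply: HL_continuous.
- exact: opP_equivariant.
- exact: opP_continuous_Re.
- exact: opP_continuous_Im.
by apply: (le_lt_trans HL_normsq_opP_le); rewrite (HG_norm2E Hf) -EFinM ltry.
Qed.

End opP_bounded.

Theorem theorem7p1 (R : realType) (n d p q : nat) (nu mu : R[i])
    (sigma : {finite_measure set 'M[R]_(n, d) -> \bar R}) :
  let nu0 : R := complex.Re nu in
  let mu0 : R := complex.Re mu in
  let alpha : R[i] := nu / 2 in
  let beta : R[i] := - mu / 2 in
  let P : ('M[R]_n -> R[i]) -> 'M[R]_(n, d) -> R[i] := opP alpha beta p q in
  (1 <= d)%N -> (d <= n.-1)%N ->
  (p + q = n)%N ->
  Stiefel_measure sigma ->
  n%:R * nu0 + d%:R * mu0 > (n * n.+1)%:R / 2 ->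
  n%:R * nu0 - d%:R * mu0 > (n * n.+1)%:R / 2 ->
  nu0 + mu0 >= n.+1%:R ->
  mu0 <= 0 ->
  (* absolute convergence of the integral *)
  (forall (f : 'M[R]_n -> R[i]) (y : 'M[R]_(n, d)),
     HG nu0 p q f -> full_rank y ->
     cintegrable lebesgue_sym (Omega p q) (integrandP alpha beta f y)) /\
  (* P maps H^G_nu(p,q) to H^L_mu *)
  (forall f, HG nu0 p q f -> HL sigma mu (P f)) /\
  (* P f depends only on the class of f *)
  (forall f g, HG nu0 p q f -> HG nu0 p q g ->
     {ae lebesgue_sym, forall z, Omega p q z -> f z = g z} ->
     forall y, full_rank y -> P f y = P g y) /\
  (* linearity *)
  (forall (c : R[i]) f g, HG nu0 p q f -> HG nu0 p q g ->
     forall y, full_rank y ->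
       P (fun z => c * f z + g z) y = c * P f y + P g y) /\
  (* boundedness *)
  (exists2 C : R, 0 <= C & forall f, HG nu0 p q f ->
     (HL_normsq sigma (P f) <= (C ^+ 2)%:E * HG_normsq nu0 p q f)%E) /\
  (* intertwining of pi^G_nu restricted to GL_n(R) with pi^L_mu *)
  (forall (a : 'M[R]_n) f, a \in unitmx -> HG nu0 p q f ->
     forall y, full_rank y -> P (piG nu a f) y = piL a (P f) y).
Proof.
move=> nu0 mu0 alpha beta P _ _ pqn _ _ _ numu mu_le0; rewrite {}/P {}/alpha {}/beta.
split; first by move=> f y Hf fy; exact: (integrable_integrandP pqn numu mu_le0 Hf fy).
split; first by move=> f Hf; exact: (HL_opP pqn numu mu_le0 sigma Hf).
split; first by move=> f g Hf Hg fg y _; exact: (opP_ae_eq mu pqn y Hf Hg fg).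
split; first by move=> c f g Hf Hg y fy; exact: (opP_linear pqn numu mu_le0 c Hf Hg fy).
split; last by move=> a f ua Hf y fy; exact: (opP_intertwines pqn numu mu_le0 ua Hf fy).
have C0 : 0 <= 2 * @siegel_const R n * Stiefel_mass sigma.
  by rewrite !mulr_ge0// ?siegel_const_ge0// fine_ge0.
exists (Num.sqrt (2 * @siegel_const R n * Stiefel_mass sigma)); first exact: sqrtr_ge0.
by move=> f Hf; rewrite sqr_sqrtr//; exact: (HL_normsq_opP_le pqn numu mu_le0 sigma Hf).
Qed.
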